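(* Let $\mathcal{N}$ be the basic Cohen model and let $X=\{x_n:n<\omega\}\in\mathcal{N}$ be its canonical Dedekind finite set of generic subsets of $\omega$. In $\mathcal{N}$ the partial order $\mathbb{P}_1=\mathrm{Inj}(\omega,X)$ satisfies the maximum principle.
   Context: Basic Cohen model. Let $M$ be a countable standard transitive model of ZFC. In $M$ let $\mathbb{P}=Fn(\omega\times\omega,2,\omega)$ be the poset of finite partial functions $p:D\to 2$, $D\subseteq\omega\times\omega$ finite, ordered by reverse inclusion. Each bijection $\tilde\pi:\omega\to\omega$ induces an automorphism $\pi$ of $\mathbb{P}$: for $p:D\to2$, $\pi(p)$ has domain $\{(\tilde\pi(i),j):(i,j)\in D\}$ and $\pi(p)(\tilde\pi(i),j)=p(i,j)$. Automorphisms act on $\mathbb{P}$-names by $\pi(\tau)=\{(\pi(p),\pi(\sigma)):(p,\sigma)\in\tau\}$. Let $\mathcal{G}$ be the group of automorphisms of $\mathbb{P}$ generated by $\{\pi_{i,j}: i<j<\omega\}$, where $\tilde\pi_{i,j}$ swaps $i$ and $j$ and fixes everything else. Let $H_n=\{\pi\in\mathcal{G}:\tilde\pi\upharpoonright n=\mathrm{id}\}$, and let $\mathcal{F}$ be the normal filter of subgroups of $\mathcal{G}$ generated by $\{H_n:n<\omega\}$. A $\mathbb{P}$-name $\tau\in M$ is symmetric if for some $n$ every $\pi\in H_n$ satisfies $\pi(\tau)=\tau$; it is hereditarily symmetric if it is symmetric and every $\sigma$ with $(p,\sigma)\in\tau$ for some $p$ is hereditarily symmetric. For $G$ $\mathbb{P}$-generic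 over $M$, the symmetric model $\mathcal{N}=\mathcal{N}_G=\{\tau^G:\tau\in M\text{ a hereditarily symmetric }\mathbb{P}\text{-name}\}$, a model of ZF with $M\subseteq\mathcal{N}\subseteq M[G]$, is the basic Cohen model. In $M[G]$ define $x_n=\{k<\omega:\exists p\in G\;\,p(n,k)=1\}$ and $X=\{x_n:n<\omega\}$. Then $X\in\mathcal{N}$, and in $\mathcal{N}$ the set $X$ is infinite and Dedekind finite. For infinite sets $I,J$, $\mathrm{Inj}(I,J)$ is the partial order of all finite injective partial maps from $I$ to $J$ (finite $r\subseteq I\times J$ that are graphs of one-to-one functions), ordered by reverse inclusion: $r_1\unlhd r_2$ iff $r_1\supseteq r_2$. For a partial order $\mathbb{Q}=(\mathbb{Q},\unlhd)$ the maximum principle for $\mathbb{Q}$ says: for every $p\in\mathbb{Q}$ and every formula $\theta(x)$ of set theory with $\mathbb{Q}$-names as parameters, $p\Vdash\exists x\,\theta(x)$ iff there exists a $\mathbb{Q}$-name $\tau$ with $p\Vdash\theta(\tau)$. Here $\Vdash$ is the usual forcing relation, defined in ZF without choice, with existential clause: $p\Vdash\exists x\,\theta(x)$ iff $\forall q\unlhd p\;\exists r\unlhd q\;\exists\tau$ a $\mathbb{Q}$-name with $r\Vdash\theta(\tau)$. ''In $\mathcal{N}$'' means that names and the forcing relation are those of $\mathcal{N}$. *)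

(* Defs.v *)
From HB Require Import structures.
From Stdlib Require Import Relations Wellfounded.
From mathcomp Require Import all_boot.
From mathcomp Require Import boolp classical_sets cardinality.

Set Implicit Arguments.
Unset Strict Implicit.
Unset Printing Implicit Defensive.

Local Open Scope classical_set_scope.
Local Open Scope quotient_scope.

(* The background universe V: well-founded trees modulo bisimulation, so that
   Leibniz equality on V is extensional equality of sets. *)

Inductive tree : Type := Node (A : Type) (f : A -> tree).

Fixpoint bisim (s t : tree) : Prop :=
  match s, t with
  | Node A f, Node B g =>
      (forall a, exists b, bisim (f a) (g b)) /\
      (forall b, exists a, bisim (f a) (g b))
  end.

Lemma bisim_refl s : bisim s s.
Proof. by elim: s => A f IH /=; split=> a; exists a. Qed.

Lemma bisim_sym s t : bisim s t -> bisim t s.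
Proof.
elim: s t => A f IH [B g] /= [H1 H2]; split.
- by move=> b; have [a /IH] := H2 b; exists a.
- by move=> a; have [b /IH] := H1 a; exists b.
Qed.

Lemma bisim_trans t s u : bisim s t -> bisim t u -> bisim s u.
Proof.
elim: s t u => A f IH [B g] [C h] /= [H1 H2] [K1 K2]; split.
- move=> a; have [b ab] := H1 a; have [c bc] := K1 b.
  by exists c; exact: IH ab bc.
- move=> c; have [b bc] := K2 c; have [a ab] := H2 b.
  by exists a; exact: IH ab bc.
Qed.

HB.instance Definition _ := gen_eqMixin tree.
HB.instance Definition _ := gen_choiceMixin tree.

Definition bisimb (s t : tree) : bool := `[< bisim s t >].

Lemma bisimb_refl : reflexive bisimb.
Proof. by move=> s; apply/asboolP; exact: bisim_refl. Qed.

Lemma bisimb_sym : symmetric bisimb.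
Proof. by move=> s t; apply/asboolP/asboolP; exact: bisim_sym. Qed.

Lemma bisimb_trans : transitive bisimb.
Proof.
by move=> t s u /asboolP st /asboolP tu; apply/asboolP; exact: bisim_trans st tu.
Qed.

Canonical bisim_equiv := EquivRel bisimb bisimb_refl bisimb_sym bisimb_trans.

Definition V : Type := {eq_quot bisimb}.

Definition idx (x : V) : Type := let: Node A _ := repr x in A.

Definition el (x : V) : idx x -> V :=
  match repr x as t return ((let: Node A _ := t in A) -> V) with
  | Node A f => fun a => \pi_V (f a)
  end.

Definition mem_V (x y : V) : Prop := exists i : idx y, el i = x.

Notation "x ∈ y" := (mem_V x y) (at level 70, no associativity).

(* The set {f a | a : A}. *)
Definition vset (A : Type) (f : A -> V) : V :=
  \pi_V (Node (fun a => repr (f a))).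

Lemma eqV (s t : tree) : \pi_V s = \pi_V t <-> bisim s t.
Proof.
by split=> [/eqquotP /asboolP|st]; last by apply/eqquotP/asboolP.
Qed.

Lemma mem_pi (x : V) (A : Type) (f : A -> tree) :
  x ∈ \pi_V (Node f) <-> exists a, \pi_V (f a) = x.
Proof.
have : bisim (repr (\pi_V (Node f))) (Node f) by apply/eqV; rewrite reprK.
rewrite /mem_V /idx /el; case: (repr _) => B g /= [gf fg]; split.
- by case=> b <-; have [a ab] := gf b; exists a; apply/esym/eqV.
- by case=> a <-; have [b ab] := fg a; exists b; apply/eqV.
Qed.

Lemma in_vset (x : V) (A : Type) (f : A -> V) :
  x ∈ vset f <-> exists a, f a = x.
Proof.
rewrite mem_pi; split=> -[a]; rewrite ?reprK => <-; exists a => //.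
by rewrite reprK.
Qed.

Lemma V_ext (x y : V) : (forall z, z ∈ x <-> z ∈ y) -> x = y.
Proof.
rewrite -[x]reprK -[y]reprK; case: (repr x) => A f; case: (repr y) => B g h.
apply/eqV; split=> [a|b].
- have [+ _] := h (\pi_V (f a)); rewrite !mem_pi.
  by case=> [|b /esym/eqV ?]; [exists a|exists b].
- have [_ +] := h (\pi_V (g b)); rewrite !mem_pi.
  by case=> [|a /eqV ?]; [exists b|exists a].
Qed.

Lemma mem_V_wf : well_founded mem_V.
Proof.
move=> x; rewrite -[x]reprK; elim: (repr x) => A f IH.
by constructor=> y /mem_pi [a <-].
Qed.

Definition elts (x : V) : set V := [set y | y ∈ x].

Definition upair (x y : V) : V := vset (fun b : bool => if b then x else y).

Definition opair (x y : V) : V := upair (upair x x) (upair x y).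

Lemma in_upair (z x y : V) : z ∈ upair x y <-> z = x \/ z = y.
Proof.
rewrite in_vset; split=> [[[] <-]|[] ->]; [by left|by right| |].
- by exists true.
- by exists false.
Qed.

Lemma pair_inj (a b c d : V) : opair a b = opair c d -> a = c /\ b = d.
Proof.
move=> E.
have hl : upair a a = upair c c \/ upair a a = upair c d.
  by apply/in_upair; rewrite -/(opair c d) -E; apply/in_upair; left.
have hr : upair a b = upair c c \/ upair a b = upair c d.
  by apply/in_upair; rewrite -/(opair c d) -E; apply/in_upair; right.
have hd : upair c d = upair a a \/ upair c d = upair a b.
  by apply/in_upair; rewrite -/(opair a b) E; apply/in_upair; right.
have ac : a = c.
  have : c ∈ upair a a by case: hl => ->; apply/in_upair; left.
  by case/in_upair.
split=> //; subst c.
have : b ∈ upair a d.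
  case: hr => H.
  - have : b ∈ upair a b by apply/in_upair; right.
    by rewrite H => /in_upair[] ->; apply/in_upair; left.
  - by rewrite -H; apply/in_upair; right.
case/in_upair => // ba; subst b.
have : d ∈ upair a a.
  by case: hd => <-; apply/in_upair; right.
by case/in_upair.
Qed.

Definition succ_V (x : V) : V :=
  vset (fun o : option (idx x) => if o is Some i then el i else x).

(* von Neumann numerals *)
Fixpoint num (n : nat) : V :=
  if n is m.+1 then succ_V (num m) else vset (fun e : void => of_void V e).

Definition omega : V := vset num.

(* First-order formulas of the language of set theory, with de Bruijn indices:
   [fEx] binds index 0. *)
Inductive form : Set :=
  | fMem (i j : nat)
  | fEq (i j : nat)
  | fNot (phi : form)
  | fAnd (phi psi : form)
  | fEx (phi : form).

Definition scons (x : V) (e : nat -> V) (n : nat) : V :=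
  if n is m.+1 then e m else x.

(* (K, ∈) |= phi[e] *)
Fixpoint sat (K : set V) (e : nat -> V) (phi : form) : Prop :=
  match phi with
  | fMem i j => e i ∈ e j
  | fEq i j => e i = e j
  | fNot phi => ~ sat K e phi
  | fAnd phi psi => sat K e phi /\ sat K e psi
  | fEx phi => exists x, K x /\ sat K (scons x e) phi
  end.

(* Each axiom of ZFC with its quantifiers relativized to K. *)
Record models_ZFC (K : set V) : Prop := ModelsZFC {
  zfc_extensionality : forall x y, K x -> K y ->
    (forall z, K z -> (z ∈ x <-> z ∈ y)) -> x = y;
  zfc_foundation : forall x, K x -> (exists y, K y /\ y ∈ x) ->
    exists y, [/\ K y, y ∈ x & forall z, K z -> z ∈ x -> ~ z ∈ y];
  zfc_pairing : forall x y, K x -> K y ->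
    exists z, K z /\ forall w, K w -> (w ∈ z <-> w = x \/ w = y);
  zfc_union : forall x, K x ->
    exists u, K u /\
      forall z, K z -> (z ∈ u <-> exists y, [/\ K y, y ∈ x & z ∈ y]);
  zfc_powerset : forall x, K x ->
    exists y, K y /\
      forall z, K z -> (z ∈ y <-> forall w, K w -> w ∈ z -> w ∈ x);
  zfc_infinity : exists x, [/\ K x,
      exists o, [/\ K o, o ∈ x & forall z, K z -> ~ z ∈ o] &
      forall y, K y -> y ∈ x -> exists s, [/\ K s, s ∈ x &
        forall z, K z -> (z ∈ s <-> z ∈ y \/ z = y)]];
  zfc_separation : forall (phi : form) (e : nat -> V) x,
    (forall n, K (e n)) -> K x ->
    exists y, K y /\
      forall z, K z -> (z ∈ y <-> z ∈ x /\ sat K (scons z e) phi);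
  zfc_replacement : forall (phi : form) (e : nat -> V) a,
    (forall n, K (e n)) -> K a ->
    (forall x, K x -> x ∈ a ->
       exists! y, K y /\ sat K (scons y (scons x e)) phi) ->
    exists b, K b /\
      forall x, K x -> x ∈ a ->
        exists y, [/\ K y, y ∈ b & sat K (scons y (scons x e)) phi];
  zfc_choice : forall F, K F ->
    (forall x, K x -> x ∈ F -> exists z, K z /\ z ∈ x) ->
    (forall x y, K x -> K y -> x ∈ F -> y ∈ F ->
       (exists z, [/\ K z, z ∈ x & z ∈ y]) -> x = y) ->
    exists c, K c /\
      forall x, K x -> x ∈ F -> exists! z, [/\ K z, z ∈ x & z ∈ c] }.

Definition transitive_class (K : set V) : Prop :=
  forall x y, K y -> x ∈ y -> K x.

Definition ctm_ZFC (M : set V) : Prop :=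
  [/\ countable M, transitive_class M & models_ZFC M].

(* A poset is given by its class Q of conditions and an order le, where
   [le q p] says that q is stronger than p. *)

Definition rev_incl (q p : V) : Prop := forall z, z ∈ p -> z ∈ q.

Definition dense_in (Q : set V) (le : V -> V -> Prop) (D : set V) : Prop :=
  forall p, Q p -> exists q, D q /\ le q p.

Definition generic (M Q : set V) (le : V -> V -> Prop) (G : set V) : Prop :=
  [/\ G `<=` Q,
      exists p, G p,
      forall p q, G q -> Q p -> le q p -> G p,
      forall p q, G p -> G q -> exists r, [/\ G r, le r p & le r q] &
      forall D : V, M D -> elts D `<=` Q -> dense_in Q le (elts D) ->
        exists p, G p /\ p ∈ D].

Inductive is_name (Q : set V) : V -> Prop :=
  IsName t :
    (forall z, z ∈ t -> exists p s, [/\ z = opair p s, Q p & is_name Q s]) ->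
    is_name Q t.

Definition name_below (s t : V) : Prop := exists p, opair p s ∈ t.

Lemma name_below_wf : well_founded name_below.
Proof.
apply: (@wf_incl _ _ (clos_trans V mem_V)); last exact/wf_clos_trans/mem_V_wf.
move=> s t [p pst]; apply: (t_trans _ _ _ (opair p s)); last exact: t_step.
by apply: (t_trans _ _ _ (upair p s)); apply: t_step; apply/in_upair; right.
Qed.

Definition fst_V (z : V) : V := xget z [set a | exists b, z = opair a b].
Definition snd_V (z : V) : V := xget z [set b | exists a, z = opair a b].

Lemma fst_pair (a b : V) : fst_V (opair a b) = a.
Proof.
rewrite /fst_V; case: xgetP => [x _ /= [c /pair_inj[]]//|/(_ a) /= []].
by exists b.
Qed.

Lemma snd_pair (a b : V) : snd_V (opair a b) = b.
Proof.
rewrite /snd_V; case: xgetP => [x _ /= [c /pair_inj[]]//|/(_ b) /= []].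
by exists a.
Qed.

(* name_rec K h t = {h p (name_rec K h s) | (p, s) ∈ t, p ∈ K}, by recursion on
   names; the characterizing equation is [in_name_rec]. *)

Section NameRec.
Variables (K : set V) (h : V -> V -> V).

Definition name_keep (t : V) (i : idx t) : Prop :=
  K (fst_V (el i)) /\ el i = opair (fst_V (el i)) (snd_V (el i)).

Lemma name_keep_below (t : V) (i : idx t) :
  name_keep i -> name_below (snd_V (el i)) t.
Proof. by case=> _ E; exists (fst_V (el i)); rewrite -E; exists i. Qed.

Definition name_step (t : V) (rec : forall s, name_below s t -> V) : V :=
  vset (fun i : {i : idx t | name_keep i} =>
    h (fst_V (el (sval i))) (rec _ (name_keep_below (svalP i)))).

Definition name_rec : V -> V := Fix name_below_wf (fun=> V) name_step.

Lemma in_name_rec (t z : V) :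
  z ∈ name_rec t <->
  exists p s, [/\ opair p s ∈ t, K p & z = h p (name_rec s)].
Proof.
rewrite /name_rec Fix_eq; last first.
  move=> x f g fg; rewrite /name_step; congr vset.
  by apply/funext => i; rewrite fg.
rewrite in_vset; split.
- case=> -[i ki] <- /=; have [kp E] := ki.
  exists (fst_V (el i)), (snd_V (el i)); split=> //.
  by rewrite -E; exists i.
- case=> p [s [[i E] kp ->]].
  have ki : name_keep i by rewrite /name_keep E fst_pair snd_pair.
  by exists (exist _ i ki) => /=; rewrite E fst_pair snd_pair.
Qed.

End NameRec.

(* t^G = {s^G | (p, s) ∈ t for some p in G} *)
Definition name_val (G : set V) : V -> V := name_rec G (fun _ x => x).

Section Forcing.
Variables (Q : set V) (le : V -> V -> Prop).

(* Atomic forcing.  The clauses are monotone and descend along the well-founded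
   relation [name_below], so the least solution taken here is the only solution,
   i.e. the relation defined by recursion on names; it is absolute, since only
   conditions and elements of the names involved are mentioned. *)
Inductive forces_eq : V -> V -> V -> Prop :=
  ForcesEq p a b :
    (forall q s c, Q q -> le q p -> opair s c ∈ a -> le q s ->
       forces_mem q c b) ->
    (forall q s c, Q q -> le q p -> opair s c ∈ b -> le q s ->
       forces_mem q c a) ->
    forces_eq p a b
with forces_mem : V -> V -> V -> Prop :=
  ForcesMem p a b :
    (forall q, Q q -> le q p -> exists r s c,
       [/\ Q r, le r q, opair s c ∈ b, le r s & forces_eq r a c]) ->
    forces_mem p a b.

Lemma forces_eqP p a b :
  forces_eq p a b <->
  (forall q s c, Q q -> le q p -> opair s c ∈ a -> le q s -> forces_mem q c b) /\
  (forall q s c, Q q -> le q p -> opair s c ∈ b -> le q s -> forces_mem q c a).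
Proof. by split=> [[]|[]] //; exact: ForcesEq. Qed.

Lemma forces_memP p a b :
  forces_mem p a b <->
  forall q, Q q -> le q p -> exists r s c,
    [/\ Q r, le r q, opair s c ∈ b, le r s & forces_eq r a c].
Proof. by split=> [[]|] //; exact: ForcesMem. Qed.

(* The forcing relation as computed in the transitive class N: names are
   elements of N, and e assigns names to the free variables. *)
Fixpoint forces (N : set V) (p : V) (e : nat -> V) (phi : form) : Prop :=
  match phi with
  | fMem i j => forces_mem p (e i) (e j)
  | fEq i j => forces_eq p (e i) (e j)
  | fNot phi => forall q, Q q -> le q p -> ~ forces N q e phi
  | fAnd phi psi => forces N p e phi /\ forces N p e psi
  | fEx phi => forall q, Q q -> le q p -> exists r, [/\ Q r, le r q &
      exists t, [/\ N t, is_name Q t & forces N r (scons t e) phi]]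
  end.

Definition maximum_principle (N : set V) : Prop :=
  forall (p : V) (theta : form) (e : nat -> V),
    Q p -> (forall n, N (e n) /\ is_name Q (e n)) ->
    (forces N p e (fEx theta) <->
     exists t, [/\ N t, is_name Q t & forces N p (scons t e) theta]).

End Forcing.

(* Fn(ω × ω, 2, ω); its elements all belong to every transitive model of ZFC. *)
Definition bit (n k : nat) (b : bool) : V :=
  opair (opair (num n) (num k)) (num b).

Definition Fn : set V := [set p |
  [/\ finite_set (elts p),
      forall z, z ∈ p -> exists n k b, z = bit n k b &
      forall n k b c, bit n k b ∈ p -> bit n k c ∈ p -> b = c]].

(* The automorphism of Fn induced by a permutation f of ω, and its action on
   names. *)
Definition act_cond (f : nat -> nat) (p : V) : V :=
  vset (fun u : {u : nat * nat * bool | bit u.1.1 u.1.2 u.2 ∈ p} =>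
    let: (n, k, b) := sval u in bit (f n) k b).

Definition act_name (f : nat -> nat) : V -> V :=
  name_rec setT (fun p x => opair (act_cond f p) x).

Definition swap (i j k : nat) : nat :=
  if k == i then j else if k == j then i else k.

(* Distinct permutations of ω induce distinct automorphisms of Fn, compatibly
   with composition, so the group is represented by permutations. *)
Inductive cohen_group : (nat -> nat) -> Prop :=
  | cohen_group_gen i j : i < j -> cohen_group (swap i j)
  | cohen_group_id : cohen_group id
  | cohen_group_comp f g : cohen_group f -> cohen_group g -> cohen_group (f \o g)
  | cohen_group_inv f g : cohen_group f -> cancel f g -> cancel g f ->
      cohen_group g.

Definition cohen_H (n : nat) : set (nat -> nat) :=
  [set f | cohen_group f /\ forall k, k < n -> f k = k].

Definition symmetric_name (t : V) : Prop :=
  exists n, forall f, cohen_H n f -> act_name f t = t.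

Inductive hereditarily_symmetric : V -> Prop :=
  HereditarilySymmetric t :
    symmetric_name t ->
    (forall p s, opair p s ∈ t -> hereditarily_symmetric s) ->
    hereditarily_symmetric t.

Definition cohen_model (M G : set V) : set V := [set x | exists t,
  [/\ M t, is_name Fn t, hereditarily_symmetric t & x = name_val G t]].

Definition cohen_real (G : set V) (n : nat) : V :=
  vset (fun k : {k : nat | exists p, G p /\ bit n k true ∈ p} => num (sval k)).

Definition cohen_X (G : set V) : V := vset (cohen_real G).

Definition Inj (I J : V) : set V := [set r |
  [/\ finite_set (elts r),
      forall z, z ∈ r -> exists i j, [/\ z = opair i j, i ∈ I & j ∈ J],
      forall i j k, opair i j ∈ r -> opair i k ∈ r -> j = k &
      forall i j k, opair i k ∈ r -> opair j k ∈ r -> i = j]].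

(* Main.v *)
(* Let N be the symmetric model and Q = Inj(ω, X).  Composing with a finite
   permutation, a Q-generic enumeration of X becomes a Cohen-generic sequence
   over the ground model M, and a hereditarily symmetric name takes the same
   value along any two enumerations of X that agree on its support.  Hence every
   Q-name of N is forced, below densely many conditions, to equal the Q-name
   obtained by evaluating some Cohen name of M along the generic enumeration
   ([tr], [name_repr]), and Q-forcing over N for such names reduces to Cohen
   forcing over M ([transfer]), which is definable there.  If p forces an
   existential statement whose parameters have support m, witnesses are Cohen
   names, and choice in M picks one for each pair of a placement of
   x_0, ..., x_(m-1) in the enumeration and a condition from an antichain.  The
   chosen names are mixed into one name with support m, which lies in N. *)

Require Import Defs.
From Stdlib Require Import Relations Wellfounded.
From mathcomp Require Import all_boot.
From mathcomp Require Import boolp classical_sets cardinality.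

Set Implicit Arguments.
Unset Strict Implicit.
Unset Printing Implicit Defensive.

Local Open Scope classical_set_scope.

(** This is why Cohen forcing is shown definable over M and why a condition on X is coded in M by a
    finite injection b of indices, where (i, j) means that x_j is listed at position i. The two
    forcings are linked by [hold p b]: the Cohen condition p is true of the listed reals. A code b
    leaves all but finitely many positions open, and an open position can still receive a real that
    a given condition says nothing about. Hence the listed reals are generic in the sense of
    [decide], on which [transfer] rests. Witnesses of unbounded support are harmless because
    [sname x] reads x along the listing and never along the numbering of X: every permutation of the
    columns fixes it, whatever the support of x. The mixed name therefore owes its support to the
    placements of the first m reals alone. *)

(** * Set operations and numerals in V *)

Lemma V_ind (P : V -> Prop) :
  (forall x, (forall y, y ∈ x -> P y) -> P x) -> forall x, P x.
Proof. exact: (@well_founded_ind V mem_V mem_V_wf P). Qed.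

(** A component of a name lies several memberships below it, so inductions on names follow the
    transitive closure of membership. *)
Definition tmem : V -> V -> Prop := clos_trans V mem_V.

Lemma tmem_wf : well_founded tmem.
Proof. exact/wf_clos_trans/mem_V_wf. Qed.

Lemma tmem_ind (P : V -> Prop) :
  (forall x, (forall y, tmem y x -> P y) -> P x) -> forall x, P x.
Proof. exact: (@well_founded_ind V tmem tmem_wf P). Qed.

Definition imgV (x : V) (P : V -> Prop) (h : V -> V) : V :=
  vset (fun i : {i : idx x | P (el i)} => h (el (sval i))).

Lemma in_imgV x P h z :
  z ∈ imgV x P h <-> exists a, [/\ a ∈ x, P a & z = h a].
Proof.
rewrite in_vset; split=> [[[i Pi] /= <-]|[_ [[i <-] Pi ->]]].
  by exists (el i); split=> //; exists i.
by exists (exist _ i Pi).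
Qed.

Definition sepV (x : V) (P : V -> Prop) : V := imgV x P id.

Lemma in_sepV x P z : z ∈ sepV x P <-> z ∈ x /\ P z.
Proof.
by rewrite in_imgV; split=> [[a [? ? ->]]|[? ?]] //; exists z.
Qed.

Definition unionV (x : V) : V :=
  vset (fun i : {i : idx x & idx (el i)} => el (tagged i)).

Lemma in_unionV x z : z ∈ unionV x <-> exists y, y ∈ x /\ z ∈ y.
Proof.
rewrite in_vset; split=> [[[i j] /= <-]|[_ [[i <-] [j <-]]]].
  by exists (el i); split; [exists i|exists j].
by exists (Tagged (fun i => idx (el i)) j).
Qed.

Definition cupV (x y : V) : V := unionV (upair x y).

Lemma in_cupV x y z : z ∈ cupV x y <-> z ∈ x \/ z ∈ y.
Proof.
rewrite in_unionV; split=> [[w [/in_upair[]->]]|[]]; [by left|by right| |].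
  by exists x; split=> //; apply/in_upair; left.
by exists y; split=> //; apply/in_upair; right.
Qed.

Definition prodV (x y : V) : V :=
  vset (fun i : idx x * idx y => opair (el i.1) (el i.2)).

Lemma in_prodV x y z :
  z ∈ prodV x y <-> exists a b, [/\ a ∈ x, b ∈ y & z = opair a b].
Proof.
rewrite in_vset; split=> [[[i j] /= <-]|[_ [_ [[i <-] [j <-] ->]]]].
  by exists (el i), (el j); split=> //; [exists i|exists j].
by exists (i, j).
Qed.

Lemma pair_in_prodV x y a b : opair a b ∈ prodV x y <-> a ∈ x /\ b ∈ y.
Proof.
rewrite in_prodV; split=> [[c [d [? ? /pair_inj[-> ->]]]]|[? ?]] //.
by exists a, b.
Qed.

Lemma in_succ x z : z ∈ succ_V x <-> z ∈ x \/ z = x.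
Proof.
rewrite in_vset; split=> [[[i|] <-]|[[i <-]|->]]; [by left; exists i|by right| |].
  by exists (Some i).
by exists None.
Qed.

Lemma in_num0 z : ~ z ∈ num 0.
Proof. by move/in_vset => -[]. Qed.

Lemma in_num n z : z ∈ num n <-> exists2 k, k < n & z = num k.
Proof.
elim: n => [|n IH]; first by split=> [/in_num0|[]].
rewrite [num n.+1]/(succ_V (num n)) in_succ IH; split.
  case=> [[k kn ->]|->]; first by exists k => //; rewrite ltnS ltnW.
  by exists n.
case=> k; rewrite ltnS leq_eqVlt => /orP[/eqP->|kn] ->; [by right|left].
by exists k.
Qed.

Lemma mem_irr x : ~ x ∈ x.
Proof. by elim/V_ind: x => x IH xx; exact: (IH x xx). Qed.

Lemma num_lt k n : num k ∈ num n <-> k < n.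
Proof.
split=> [|kn]; last by apply/in_num; exists k.
rewrite ltnNge => kn; apply/negP => nk.
have : num k ∈ num k.
  case/in_num: kn => j jn E; rewrite {1}E; apply/in_num; exists j => //.
  exact: leq_trans jn nk.
exact: mem_irr.
Qed.

Lemma num_inj : injective num.
Proof.
by move=> i j E; case: (ltngtP i j) => // /num_lt; rewrite E => /mem_irr.
Qed.

Lemma in_omega z : z ∈ omega <-> exists n, z = num n.
Proof. by rewrite in_vset; split=> -[n]; [move<-|move->]; exists n. Qed.

Lemma tmem_snd a b t : opair a b ∈ t -> tmem b t.
Proof.
move=> h; apply: (t_trans _ _ _ (upair a b)); first by apply/t_step/in_upair; right.
by apply: (t_trans _ _ _ (opair a b)); apply: t_step => //; apply/in_upair; right.
Qed.

(** * Definability over a countable transitive model *)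

Class ctm := Ctm { gM : set V; ctmP : ctm_ZFC gM }.

Section Ctm.
Context {C : ctm}.

Lemma M_trans x y : x ∈ y -> gM y -> gM x.
Proof. by case: ctmP => _ h _ xy My; exact: h xy. Qed.

Lemma M_zfc : models_ZFC gM.
Proof. by case: ctmP. Qed.

Lemma M_ex : exists x, gM x.
Proof. by have [x []] := zfc_infinity M_zfc; exists x. Qed.

Lemma enumM_ex :
  exists a : nat -> V, (forall n, gM (a n)) /\ forall x, gM x -> exists n, a n = x.
Proof.
have [cM _ _] := ctmP; have [x0 Mx0] := M_ex.
have [f finj] := elimT (countable_injP gM) cM.
exists (fun n => xget x0 [set x | gM x /\ f x = n]); split=> [n|x Mx].
  by case: xgetP => // y _ [].
exists (f x); case: xgetP => [y _ [My Ey]|/(_ x)[]//].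
by apply: finj => //; rewrite inE.
Qed.

Definition enumM : nat -> V := sval (cid enumM_ex).

Lemma M_enum n : gM (enumM n).
Proof. by rewrite /enumM; case: cid => a [h _] /=. Qed.

Lemma enumM_surj x : gM x -> exists n, enumM n = x.
Proof. by rewrite /enumM; case: cid => a [_ h] /=; exact: h. Qed.

Definition env (e : nat -> V) : Prop := forall n, gM (e n).

Lemma env_scons x e : gM x -> env e -> env (scons x e).
Proof. by move=> Mx Me [|n] /=. Qed.

(* Interleaving an enumeration of M with the variables makes every element of M
   available as a parameter. *)
Definition mix (e : nat -> V) (n : nat) : V :=
  if odd n then enumM n./2 else e n./2.

Definition definable (P : (nat -> V) -> Prop) : Prop :=
  exists phi, forall e, env e -> (sat gM (mix e) phi <-> P e).

(** The language has no function symbols, so a term is handled through its graph, with the value as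
    variable 0. *)
Definition dterm (f : (nat -> V) -> V) : Prop :=
  (forall e, env e -> gM (f e)) /\ definable (fun e => e 0 = f (fun n => e n.+1)).

Definition lift_renaming (r : nat -> nat) (n : nat) : nat :=
  if n is m.+1 then (r m).+1 else 0.

Fixpoint rename (r : nat -> nat) (phi : form) : form :=
  match phi with
  | fMem i j => fMem (r i) (r j)
  | fEq i j => fEq (r i) (r j)
  | fNot phi => fNot (rename r phi)
  | fAnd phi psi => fAnd (rename r phi) (rename r psi)
  | fEx phi => fEx (rename (lift_renaming r) phi)
  end.

Lemma sat_rename K e r phi : sat K e (rename r phi) <-> sat K (e \o r) phi.
Proof.
elim: phi e r => //= [phi IH|phi IH psi IH'|phi IH] e r.
- by rewrite IH.
- by rewrite IH IH'.
- have E x : scons x e \o lift_renaming r = scons x (e \o r).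
    by apply/funext => -[].
  by split=> -[x [Kx h]]; exists x; split=> //; move: h; rewrite IH E.
Qed.

Lemma D_ext P Q : definable P -> (forall e, env e -> (P e <-> Q e)) -> definable Q.
Proof. by move=> [phi h] E; exists phi => e Me; rewrite h //; exact: E. Qed.

Lemma D_rename r P : definable P -> definable (fun e => P (e \o r)).
Proof.
move=> [phi h]; exists (rename (fun n => if odd n then n else (r n./2).*2) phi) => e Me.
rewrite sat_rename -h; last by move=> n; exact: Me.
suff -> : mix e \o (fun n => if odd n then n else (r n./2).*2) = mix (e \o r) by [].
apply/funext => n /=; rewrite /mix; case: (boolP (odd n)) => [->//|_].
by rewrite odd_double doubleK.
Qed.

Lemma D_not P : definable P -> definable (fun e => ~ P e).
Proof. by move=> [phi h]; exists (fNot phi) => e Me /=; rewrite h. Qed.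

Lemma D_and P Q : definable P -> definable Q -> definable (fun e => P e /\ Q e).
Proof.
by move=> [phi h] [psi k]; exists (fAnd phi psi) => e Me /=; rewrite h ?k.
Qed.

(** The body is a predicate of a value and an environment so that unification recovers it from an
    ordinary Rocq quantifier; this lets definability be proved by search. *)
Lemma D_exM (P : V -> (nat -> V) -> Prop) :
  definable (fun e => P (e 0) (fun n => e n.+1)) -> definable (fun e => exists x, gM x /\ P x e).
Proof.
move=> [phi h].
(* Behind the bound variable every index of [mix e] is shifted by one: a constant at odd n is found
   at n+1, and variable m, which belongs at 2m+2, is found at 2m+1. *)
pose r n := if odd n then n.+1 else if n./2 is m.+1 then (m.*2).+1 else 0.
have E e x : scons x (mix e) \o r = mix (scons x e).
  apply/funext => n; rewrite /= /r /mix; case: (boolP (odd n)) => /= [->//|_].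
  by case: n./2 => [|m] //=; rewrite odd_double doubleK.
exists (fEx (rename r phi)) => e Me /=.
by split=> -[x [Mx H]]; exists x; split=> //; move: H; rewrite sat_rename E h //;
  exact: env_scons.
Qed.

Lemma D_or P Q : definable P -> definable Q -> definable (fun e => P e \/ Q e).
Proof.
move=> DP DQ; apply: (D_ext (D_not (D_and (D_not DP) (D_not DQ)))) => e _.
by rewrite not_andP !notK.
Qed.

Lemma D_imp P Q : definable P -> definable Q -> definable (fun e => P e -> Q e).
Proof.
move=> DP DQ; apply: (D_ext (D_or (D_not DP) DQ)) => e _.
by split=> [[]//|]; have [p|] := pselect (P e); [right; auto|left].
Qed.

Lemma D_iff P Q : definable P -> definable Q -> definable (fun e => P e <-> Q e).
Proof. by move=> ? ?; apply: D_and; exact: D_imp. Qed.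

Lemma D_allM (P : V -> (nat -> V) -> Prop) :
  definable (fun e => P (e 0) (fun n => e n.+1)) -> definable (fun e => forall x, gM x -> P x e).
Proof.
move=> /D_not /(D_exM (P := fun x e => ~ P x e)) /D_not DP.
apply: (D_ext DP) => e _; split=> [h x Mx|h [x [Mx]]]; last by apply; exact: h.
by apply: contrapT => H; apply: h; exists x.
Qed.

(** A proposition without variables is classically true or false, hence equivalent to [e 0 = e 0] or
    to its negation, even when it is not first-order. *)
Lemma D_true (Q : Prop) : definable (fun=> Q).
Proof.
have [q|q] := pselect Q; first by exists (fEq 0 0).
by exists (fNot (fEq 0 0)) => e _ /=; split=> // /(_ erefl).
Qed.

Lemma D_gM t : dterm t -> definable (fun e => gM (t e)).
Proof. by move=> [Mt _]; apply: (D_ext (D_true True)) => e Me; split=> // _; exact: Mt. Qed.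

Lemma T_var i : dterm (fun e => e i).
Proof. by split=> [e|]; [exact|exists (fEq 0 (i.+1).*2) => e _;
  rewrite /= /mix odd_double doubleK]. Qed.

Lemma T_const c : gM c -> dterm (fun=> c).
Proof.
move=> Mc; split=> //; have [n En] := enumM_surj Mc.
by exists (fEq 0 (n.*2).+1) => e _; rewrite /= /mix /= odd_double uphalf_double En.
Qed.

Lemma D_eq t u : dterm t -> dterm u -> definable (fun e => t e = u e).
Proof.
move=> [Mt Dt] [Mu Du].
apply: (D_ext (D_exM (P := fun x e => x = t e /\ x = u e) (D_and Dt Du))) => e Me.
by split=> [[x [_ [<-]]]//|E]; exists (t e); split; [exact: Mt|].
Qed.

Lemma D_mem t u : dterm t -> dterm u -> definable (fun e => t e ∈ u e).
Proof.
move=> [Mt Dt] [Mu Du].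
have Du' := D_rename (fun n => if n is m.+1 then m.+2 else 0) Du.
have Dm : definable (fun e => e 1 ∈ e 0) by exists (fMem 2 0).
have D2 := D_exM (P := fun x e => x = u (fun n => e n.+1) /\ e 0 ∈ x)
  (D_and Du' Dm).
apply: (D_ext (D_exM (P := fun y e => y = t e /\ exists x, gM x /\ (x = u e /\ y ∈ x))
  (D_and Dt D2))) => e Me.
split=> [[y [_ [-> [x [_ [-> //]]]]]]|h].
by exists (t e); split; [exact: Mt|split=> //; exists (u e); split; [exact: Mu|]].
Qed.

Lemma T_shift t : dterm t -> dterm (fun e => t (fun n => e n.+1)).
Proof.
move=> [Mt Dt]; split=> [e Me|]; first by apply: Mt => n; exact: Me.
exact: (D_rename (fun n => if n is m.+1 then m.+2 else 0) Dt).
Qed.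

(** Substitution goes through the formula: atoms become instances of [D_mem] and [D_eq], and under a
    quantifier the terms are shifted past the bound variable. *)
Lemma D_subst P (t : nat -> (nat -> V) -> V) :
  definable P -> (forall n, dterm (t n)) -> definable (fun e => P (fun n => t n e)).
Proof.
have key phi s : (forall n, dterm (s n)) -> definable (fun e => sat gM (fun n => s n e) phi).
  elim: phi s => [i j|i j|phi IH|phi IH psi IH'|phi IH] s Ts /=.
  - exact: D_mem.
  - exact: D_eq.
  - exact/D_not/IH.
  - by apply: D_and; [exact: IH|exact: IH'].
  - pose s' n e := if n is m.+1 then s m (fun n => e n.+1) else e 0.
    apply: (D_exM (P := fun x e => sat gM (scons x (fun n => s n e)) phi)).
    apply: (D_ext (IH s' _)) => [[|n]|e _]; first exact: T_var.
      exact: T_shift.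
    suff -> : (fun n => s' n e) = scons (e 0) (fun n => s n (fun m => e m.+1)) by [].
    by apply/funext => -[].
move=> [phi h] Tt.
(* Odd variables stand for constants and are not substituted. *)
pose s n e := if odd n then enumM n./2 else t n./2 e.
apply: (D_ext (key phi s _)) => [n|e Me].
  by rewrite /s; case: (odd n) => //; apply: T_const; exact: M_enum.
have Mt : env (fun n => t n e) by move=> n; case: (Tt n) => Mt _; exact: Mt.
suff -> : (fun n => s n e) = mix (fun n => t n e) by exact: h.
by apply/funext => n; rewrite /s /mix; case: ifP.
Qed.

Lemma T_subst f (t : nat -> (nat -> V) -> V) :
  dterm f -> (forall n, dterm (t n)) -> dterm (fun e => f (fun n => t n e)).
Proof.
move=> [Mf Df] Tt; split=> [e Me|].
  by apply: Mf => n; case: (Tt n) => Mt _; exact: Mt.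
pose t' n e := if n is m.+1 then t m (fun n => e n.+1) else e 0.
apply: (@D_subst _ t' Df) => -[|n]; first exact: T_var.
exact: T_shift.
Qed.

Lemma D_app1 (R : V -> Prop) t : definable (fun e => R (e 0)) -> dterm t -> definable (fun e =>
  R (t e)).
Proof. by move=> DR Tt; apply: (@D_subst _ (fun=> t) DR). Qed.

Lemma D_app2 (R : V -> V -> Prop) t u :
  definable (fun e => R (e 0) (e 1)) -> dterm t -> dterm u -> definable (fun e => R (t e) (u e)).
Proof. by move=> DR Tt Tu; apply: (@D_subst _ (fun n => if n is 0 then t else u) DR) => -[]. Qed.

Lemma D_app3 (R : V -> V -> V -> Prop) t u v :
  definable (fun e => R (e 0) (e 1) (e 2)) -> dterm t -> dterm u -> dterm v ->
  definable (fun e => R (t e) (u e) (v e)).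
Proof.
move=> DR Tt Tu Tv.
by apply: (@D_subst _ (fun n => match n with 0 => t | 1 => u | _ => v end) DR) => -[|[]].
Qed.

Lemma D_app4 (R : V -> V -> V -> V -> Prop) t u v w :
  definable (fun e => R (e 0) (e 1) (e 2) (e 3)) -> dterm t -> dterm u -> dterm v -> dterm w ->
  definable (fun e => R (t e) (u e) (v e) (w e)).
Proof.
move=> DR Tt Tu Tv Tw.
by apply: (@D_subst _ (fun n => match n with 0 => t | 1 => u | 2 => v | _ => w end) DR)
  => -[|[|[]]].
Qed.

Lemma T_app1 (F : V -> V) t : dterm (fun e => F (e 0)) -> dterm t -> dterm (fun e => F (t e)).
Proof. by move=> TF Tt; apply: (@T_subst _ (fun=> t) TF). Qed.

Lemma T_app2 (F : V -> V -> V) t u :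
  dterm (fun e => F (e 0) (e 1)) -> dterm t -> dterm u -> dterm (fun e => F (t e) (u e)).
Proof. by move=> TF Tt Tu; apply: (@T_subst _ (fun n => if n is 0 then t else u) TF) => -[]. Qed.

Lemma T_app3 (F : V -> V -> V -> V) t u v :
  dterm (fun e => F (e 0) (e 1) (e 2)) -> dterm t -> dterm u -> dterm v ->
  dterm (fun e => F (t e) (u e) (v e)).
Proof.
move=> TF Tt Tu Tv.
by apply: (@T_subst _ (fun n => match n with 0 => t | 1 => u | _ => v end) TF) => -[|[]].
Qed.

Lemma D_allin t (P : V -> (nat -> V) -> Prop) :
  dterm t -> definable (fun e => P (e 0) (fun n => e n.+1)) ->
  definable (fun e => forall x, x ∈ t e -> P x e).
Proof.
move=> Tt DP.
have H := D_imp (D_mem (T_var 0) (T_shift Tt)) DP.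
apply: (D_ext (D_allM (P := fun x e => x ∈ t e -> P x e) H)) => e Me.
split=> [h x xt|h x _]; last exact: h.
by apply: h => //; apply: M_trans xt _; case: Tt => Mt _; exact: Mt.
Qed.

Lemma D_exin t (P : V -> (nat -> V) -> Prop) :
  dterm t -> definable (fun e => P (e 0) (fun n => e n.+1)) ->
  definable (fun e => exists x, x ∈ t e /\ P x e).
Proof.
move=> Tt DP.
have H := D_and (D_mem (T_var 0) (T_shift Tt)) DP.
apply: (D_ext (D_exM (P := fun x e => x ∈ t e /\ P x e) H)) => e Me.
split=> [[x [_ h]]|[x [xt h]]]; exists x => //; split=> //.
by apply: M_trans xt _; case: Tt => Mt _; exact: Mt.
Qed.

Lemma M_fst a b t : opair a b ∈ t -> gM t -> gM a.
Proof.
move=> h Mt; apply: (@M_trans _ (upair a a)); first by apply/in_upair; left.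
by apply: M_trans (M_trans h Mt); apply/in_upair; left.
Qed.

Lemma M_snd a b t : opair a b ∈ t -> gM t -> gM b.
Proof.
move=> h Mt; apply: (@M_trans _ (upair a b)); first by apply/in_upair; right.
by apply: M_trans (M_trans h Mt); apply/in_upair; right.
Qed.

Lemma M_upair x y : gM x -> gM y -> gM (upair x y).
Proof.
move=> Mx My; have [z [Mz hz]] := zfc_pairing M_zfc Mx My.
suff -> : upair x y = z by [].
apply: V_ext => w; rewrite in_upair; split=> [h|wz]; apply/hz => //.
  by case: h => ->.
exact: M_trans wz Mz.
Qed.

Lemma T_upair t u : dterm t -> dterm u -> dterm (fun e => upair (t e) (u e)).
Proof.
apply: T_app2; split=> [e Me|]; first exact: M_upair.
apply: (D_ext (D_and (D_and (D_mem (T_var 1) (T_var 0)) (D_mem (T_var 2) (T_var 0)))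
  (D_allin (P := fun x e => x = e 1 \/ x = e 2) (T_var 0)
  (D_or (D_eq (T_var 0) (T_var 2)) (D_eq (T_var 0) (T_var 3)))))) => e _.
split=> [[[h1 h2] h]|->].
  apply: V_ext => w; rewrite in_upair; split; first exact: h.
  by case=> ->.
by rewrite !in_upair; split; [split; [left|right]|move=> x; rewrite in_upair].
Qed.

Lemma T_opair t u : dterm t -> dterm u -> dterm (fun e => opair (t e) (u e)).
Proof. by move=> Tt Tu; do 2!apply: T_upair => //. Qed.

Lemma M_opair x y : gM x -> gM y -> gM (opair x y).
Proof. by move=> ? ?; do 2!apply: M_upair => //. Qed.

Lemma M_union x : gM x -> gM (unionV x).
Proof.
move=> Mx; have [u [Mu hu]] := zfc_union M_zfc Mx.
suff -> : unionV x = u by [].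
apply: V_ext => w; rewrite in_unionV; split=> [[y [yx wy]]|wu].
  have My := M_trans yx Mx; apply/hu; first exact: M_trans wy My.
  by exists y.
by have [y [_ yx wy]] := (hu _ (M_trans wu Mu)).1 wu; exists y.
Qed.

Lemma T_union t : dterm t -> dterm (fun e => unionV (t e)).
Proof.
apply: T_app1; split=> [e Me|]; first exact: M_union.
have h1 : definable (fun e => forall y, y ∈ e 1 -> forall z, z ∈ y -> z ∈ e 0).
  apply: D_allin (T_var 1) _; apply: D_allin (T_var 0) _.
  exact: D_mem (T_var 0) (T_var 2).
have h2 : definable (fun e => forall z, z ∈ e 0 -> exists y, y ∈ e 1 /\ z ∈ y).
  apply: D_allin (T_var 0) _; apply: D_exin (T_var 2) _.
  exact: D_mem (T_var 1) (T_var 0).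
apply: (D_ext (D_and h1 h2)) => e _; split=> [[k1 k2]|->].
  apply: V_ext => w; rewrite in_unionV; split; first exact: k2.
  by case=> y [] /k1; apply.
split=> [y yx z zy|z /in_unionV//]; apply/in_unionV; by exists y.
Qed.

(** The components of a pair in t lie in M by transitivity, so unrestricted quantifiers over them
    agree with quantifiers over M. *)
Lemma D_allop t (P : V -> V -> (nat -> V) -> Prop) :
  dterm t -> definable (fun e => P (e 1) (e 0) (fun n => e n.+2)) ->
  definable (fun e => forall x y, opair x y ∈ t e -> P x y e).
Proof.
move=> Tt DP.
have H := D_imp (D_mem (T_opair (T_var 1) (T_var 0)) (T_shift (T_shift Tt))) DP.
have H1 := D_allM (P := fun y e => opair (e 0) y ∈ t (fun n => e n.+1) ->
  P (e 0) y (fun n => e n.+1)) H.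
have H2 := D_allM (P := fun x e => forall y, gM y -> opair x y ∈ t e -> P x y e) H1.
apply: (D_ext H2) => e Me; split=> [h x y xt|h x _ y _]; last exact: h.
have Mt : gM (t e) by case: Tt => Mt _; exact: Mt.
by apply: (h x _ y _ xt); [exact: M_fst xt _|exact: M_snd xt _].
Qed.

Lemma D_exop t (P : V -> V -> (nat -> V) -> Prop) :
  dterm t -> definable (fun e => P (e 1) (e 0) (fun n => e n.+2)) ->
  definable (fun e => exists x y, opair x y ∈ t e /\ P x y e).
Proof.
move=> Tt /D_not DP.
have H := D_not (D_allop (P := fun x y e => ~ P x y e) Tt DP).
apply: (D_ext H) => e Me; split=> [h|[x [y [xt h]]] H']; last exact: H' xt h.
apply: contrapT => H'; apply: h => x y xt h; apply: H'; by exists x, y.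
Qed.

Lemma D_exeq t (P : V -> V -> (nat -> V) -> Prop) :
  dterm t -> definable (fun e => P (e 1) (e 0) (fun n => e n.+2)) ->
  definable (fun e => exists x y, t e = opair x y /\ P x y e).
Proof.
(* An equation with a pair is read as membership of the pair in the singleton of t. *)
move=> Tt DP; have := D_exop (P := P) (T_upair Tt Tt) DP.
move=> H; apply: (D_ext H) => e Me.
by split=> -[x [y [E h]]]; exists x, y; split=> //; rewrite ?in_upair ?E; auto;
 move/in_upair: E => [].
Qed.

Lemma D_rev_incl t u : dterm t -> dterm u -> definable (fun e => rev_incl (t e) (u e)).
Proof.
move=> Tt Tu; rewrite /rev_incl; apply: D_allin => //.
exact: D_mem (T_var 0) (T_shift Tt).
Qed.

End Ctm.

Create HintDb dfn discriminated.
#[export] Hint Resolve D_gM D_and D_or D_not D_imp D_iff D_exM D_allM D_eq D_mem D_allin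
  D_exin D_allop D_exop D_exeq D_rev_incl T_var T_upair T_opair
  T_union T_const : dfn.
#[export] Hint Extern 9 (definable (fun _ => _)) => simple apply D_true : dfn.
#[export] Hint Extern 1 (gM _) => assumption : dfn.

(** Definability follows the syntax of the predicate, so search with the closure rules proves it. *)
Ltac dfn := typeclasses eauto with dfn.

(** * Separation, replacement and images in M *)

Section Ctm.
Context {C : ctm}.

(** The axiom schemes are stated for plain environments. Taking [enumM] itself as the environment
    keeps every element of M available as a parameter. *)
Lemma D_form P : definable P -> exists phi, forall z y, gM z -> gM y ->
  (sat gM (scons z (scons y enumM)) phi <->
   P (scons z (scons y (fun=> enumM 0)))).
Proof.
move=> [phi h].
(* z and y get indices 0 and 1 and the k-th constant gets k+2; all further variables are read as the
   dummy [enumM 0]. *)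
pose (r n := if odd n then n./2.+2 else if n./2 is m.+1 then
  if m is 0 then 1 else 2 else 0).
exists (rename r phi) => z y Mz My; rewrite sat_rename -h; last first.
  by do 2!apply: env_scons => //; move=> n; exact: M_enum.
have -> // : scons z (scons y enumM) \o r = mix (scons z (scons y (fun=> enumM 0))).
apply/funext => n; rewrite /= /r /mix; case: (odd n) => //.
by case: n./2 => [|[|m]].
Qed.

Lemma M_sep x (P : V -> Prop) : gM x -> definable (fun e => P (e 0)) -> gM (sepV x P).
Proof.
move=> Mx /D_form[phi h].
have [y [My hy]] := zfc_separation M_zfc phi (env_scons (M_enum 0) M_enum) Mx.
suff -> : sepV x P = y by [].
apply: V_ext => z; rewrite in_sepV; split=> [[zx Pz]|zy].
  have Mz := M_trans zx Mx; apply/hy => //; split=> //; apply/h => //.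
  exact: M_enum.
have Mz := M_trans zy My; have [zx /h] := (hy _ Mz).1 zy.
by move=> H; split=> //; apply: H => //; exact: M_enum.
Qed.

Lemma M_repl A (R : V -> V -> Prop) : gM A -> definable (fun e => R (e 0) (e 1)) ->
  (forall a z z', a ∈ A -> R a z -> R a z' -> z = z') ->
  (forall a z, a ∈ A -> R a z -> gM z) ->
  exists y, gM y /\ forall z, z ∈ y <-> exists a, a ∈ A /\ R a z.
Proof.
move=> MA DR Rfun MR.
have DR2 t u : dterm t -> dterm u -> definable (fun e => R (t e) (u e)) by exact: D_app2.
(* The axiom asks for a relation that is total on the set, so A is cut down to the domain of R; the
   set b it provides may be too large and is cut down afterwards. *)
pose (A' := sepV A (fun a => exists z, gM z /\ R a z)).
have MA' : gM A'.
  apply: M_sep => //; apply: D_exM; exact: DR2 (T_var 1) (T_var 0).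
have [phi h] := D_form (P := fun e => R (e 1) (e 0)) (DR2 _ _ (T_var 1) (T_var 0)).
have [||b [Mb hb]] := zfc_replacement M_zfc (phi := phi) (e := enumM) (a := A') _ MA'.
- exact: M_enum.
- move=> x Mx /in_sepV[xA [z [Mz Rxz]]]; exists z; split=> [|z' [Mz']].
    by split=> //; apply/h.
  by move/h => H; apply: Rfun xA Rxz _; exact: H.
exists (sepV b (fun z => exists a, a ∈ A /\ R a z)); split.
  apply: M_sep => //; apply: D_exin; first exact: T_const.
  exact: DR2 (T_var 0) (T_var 1).
move=> z; rewrite in_sepV; split=> [[]//|[a [aA Raz]]]; split; last by exists a.
have Ma := M_trans aA MA; have Mz := MR _ _ aA Raz.
have aA' : a ∈ A' by apply/in_sepV; split=> //; exists z.
have [y [My yb /h Ray]] := hb _ Ma aA'.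
by rewrite (Rfun _ _ _ aA Raz (Ray My Ma)).
Qed.

Lemma M_img A (P : V -> Prop) h : gM A -> definable (fun e => P (e 0)) ->
  dterm (fun e => h (e 0)) -> gM (imgV A P h).
Proof.
move=> MA DP Th.
have [|||y [My hy]] := M_repl (R := fun a z => P a /\ z = h a) MA.
- apply: D_and; first exact: D_app1 DP (T_var 0).
  by apply: D_eq; [exact: T_var|exact: T_app1 Th (T_var 0)].
- by move=> a z z' _ [_ ->] [_ ->].
- move=> a z aA [_ ->]; case: Th => + _ => /(_ (fun=> a)); apply=> _.
  exact: M_trans aA MA.
have -> // : imgV A P h = y.
apply: V_ext => z; rewrite in_imgV hy; split=> [[a [? ? ?]]|[a [? [? ?]]]]; by exists a.
Qed.

Lemma T_img t (P : V -> (nat -> V) -> Prop) (h : V -> (nat -> V) -> V) :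
  dterm t -> definable (fun e => P (e 0) (fun n => e n.+1)) ->
  dterm (fun e => h (e 0) (fun n => e n.+1)) ->
  dterm (fun e => imgV (t e) (fun a => P a e) (fun a => h a e)).
Proof.
move=> Tt DP Th; split=> [e Me|].
  (* With the environment fixed, the parameters become constants and only the element a stays
     variable. *)
  pose (s n (e' : nat -> V) := if n is m.+1 then e m else e' 0).
  have Ts n : dterm (s n) by case: n => [|n]; [exact: T_var|exact/T_const].
  apply: M_img; first by case: Tt => Mt _; exact: Mt.
    exact: (D_subst DP Ts).
  exact: (T_subst Th Ts).
have P1 : definable (fun e => P (e 0) (fun n => e n.+3)).
  by apply: (D_subst DP (t := fun n e => if n is m.+1 then e m.+3 else e 0)) => -[|n];
    exact: T_var.
have h1 : dterm (fun e => h (e 0) (fun n => e n.+3)).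
  by apply: (T_subst Th (t := fun n e => if n is m.+1 then e m.+3 else e 0)) => -[|n];
    exact: T_var.
have T1 := T_shift (T_shift Tt).
have H : definable (fun e => forall y, gM y ->
    (y ∈ e 0 <-> exists a, a ∈ t (fun n => e n.+1) /\ (P a (fun n => e n.+1) /\
       y = h a (fun n => e n.+1)))).
  apply: D_allM; apply: D_iff; first exact: D_mem (T_var 0) (T_var 1).
  apply: D_exin => //; apply: D_and => //; apply: D_eq => //; exact: T_var.
apply: (D_ext H) => e Me.
have E z : (exists a, a ∈ t (fun n => e n.+1) /\ (P a (fun n => e n.+1) /\
       z = h a (fun n => e n.+1))) <-> z ∈ imgV (t (fun n => e n.+1))
     (fun a => P a (fun n => e n.+1)) (fun a => h a (fun n => e n.+1)).
  by rewrite in_imgV; split=> [[a [? [? ?]]]|[a [? ? ?]]]; exists a.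
split=> [k|-> z _]; last by rewrite E.
apply: V_ext => z; rewrite -E; split=> [ze|H']; apply/k => //.
  by apply: M_trans ze _; exact: Me.
case: H' => a [at_ [_ ->]]; case: Th => /(_ (scons a (fun n => e n.+1))) + _.
apply; apply: env_scons => [|n]; last exact: Me.
by apply: M_trans at_ _; case: Tt => Mt _; apply: Mt => n; exact: Me.
Qed.

Lemma T_sep t (P : V -> (nat -> V) -> Prop) :
  dterm t -> definable (fun e => P (e 0) (fun n => e n.+1)) ->
  dterm (fun e => sepV (t e) (fun a => P a e)).
Proof. by move=> Tt DP; apply: T_img => //; exact: T_var. Qed.

Lemma M_pow x : gM x -> exists y, gM y /\ forall z, z ∈ y <-> gM z /\ rev_incl x z.
Proof.
move=> Mx; have [y [My hy]] := zfc_powerset M_zfc Mx; exists y; split=> // z.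
split=> [zy|[Mz zx]]; last by apply/hy => // w _; exact: zx.
have Mz := M_trans zy My; split=> // w wz.
exact: ((hy _ Mz).1 zy _ (M_trans wz Mz) wz).
Qed.

Lemma T_cup t u : dterm t -> dterm u -> dterm (fun e => cupV (t e) (u e)).
Proof. by move=> ? ?; rewrite /cupV; dfn. Qed.

Lemma M_cup x y : gM x -> gM y -> gM (cupV x y).
Proof. by move=> ? ?; apply/M_union/M_upair. Qed.

Lemma M_prod x y : gM x -> gM y -> gM (prodV x y).
Proof.
move=> Mx My; have [p [Mp hp]] := M_pow (M_cup Mx My).
have [q [Mq hq]] := M_pow Mp.
suff -> : prodV x y = sepV q (fun z => exists a, a ∈ x /\ exists b, b ∈ y /\ z = opair a b).
  apply: M_sep => //; dfn.
apply: V_ext => z; rewrite in_prodV in_sepV; split=> [[a [b [ax by_ ->]]]|[_ [a [? [b [? ?]]]]]].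
  have [Ma Mb] := (M_trans ax Mx, M_trans by_ My).
  split; last by exists a; split=> //; exists b.
  apply/hq; split; first exact: M_opair.
  move=> w /in_upair[] ->; apply/hp; (split; first exact: M_upair) => v /in_upair[] ->;
    apply/in_cupV; by [left|right].
by exists a, b.
Qed.

Lemma T_prod t u : dterm t -> dterm u -> dterm (fun e => prodV (t e) (u e)).
Proof.
apply: T_app2; split=> [e Me|]; first exact: M_prod.
have H : definable (fun e => (forall z, z ∈ e 0 -> exists a, a ∈ e 1 /\ exists b, b ∈ e 2 /\
    z = opair a b) /\ (forall a, a ∈ e 1 -> forall b, b ∈ e 2 -> opair a b ∈ e 0)) by dfn.
apply: (D_ext H) => e _; split=> [[h1 h2]|->].
  apply: V_ext => z; rewrite in_prodV; split=> [/h1[a [? [b [? ?]]]]|[a [b [? ? ->]]]].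
    by exists a, b.
  exact: h2.
split=> [z /in_prodV[a [b [? ? ?]]]|a ? b ?]; last by apply/pair_in_prodV.
by exists a; split=> //; exists b.
Qed.

(** [fst_V] returns its argument when that is not a pair; the second case of the defining formula
    accounts for this default. *)
Lemma T_fst t : dterm t -> dterm (fun e => fst_V (t e)).
Proof.
have H : definable (fun e => (exists a b, e 1 = opair a b /\ e 0 = a) \/
  (~ (exists a b, e 1 = opair a b /\ True)) /\ e 0 = e 1) by dfn.
have E x : (exists a b, x = opair a b /\ fst_V x = a) \/
    (~ (exists a b, x = opair a b /\ True)) /\ fst_V x = x.
  have [[a [b [-> _]]]|n] := pselect (exists a b, x = opair a b /\ True).
    by left; exists a, b; rewrite fst_pair.
  right; split=> //; rewrite /fst_V; case: xgetP => // y _ [b Eb].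
  by case: n; exists y, b.
apply: T_app1; split=> [e Me|].
  have [[a [b [E1 ->]]]|[_ ->]] := E (e 0); last exact: Me.
  by apply: (@M_fst _ a b (upair (e 0) (e 0))); [apply/in_upair; left|exact: M_upair].
apply: (D_ext H) => e _; split=> [|->]; last exact: E.
case: (E (e 1)) => [[a [b [-> ->]]]|[n ->]] [[a' [b' [E1 ->]]]|[n' E1]] //.
- by case/pair_inj: E1.
- by case: n'; exists a, b.
- by case: n; exists a', b'.
Qed.

Lemma T_snd t : dterm t -> dterm (fun e => snd_V (t e)).
Proof.
have H : definable (fun e => (exists a b, e 1 = opair a b /\ e 0 = b) \/
  (~ (exists a b, e 1 = opair a b /\ True)) /\ e 0 = e 1) by dfn.
have E x : (exists a b, x = opair a b /\ snd_V x = b) \/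
    (~ (exists a b, x = opair a b /\ True)) /\ snd_V x = x.
  have [[a [b [-> _]]]|n] := pselect (exists a b, x = opair a b /\ True).
    by left; exists a, b; rewrite snd_pair.
  right; split=> //; rewrite /snd_V; case: xgetP => // y _ [b Eb].
  by case: n; exists b, y.
apply: T_app1; split=> [e Me|].
  have [[a [b [E1 ->]]]|[_ ->]] := E (e 0); last exact: Me.
  by apply: (@M_snd _ a b (upair (e 0) (e 0))); [apply/in_upair; left|exact: M_upair].
apply: (D_ext H) => e _; split=> [|->]; last exact: E.
case: (E (e 1)) => [[a [b [-> ->]]]|[n ->]] [[a' [b' [E1 ->]]]|[n' E1]] //.
- by case/pair_inj: E1.
- by case: n'; exists a, b.
- by case: n; exists a', b'.
Qed.

End Ctm.

#[export] Hint Resolve T_img T_sep T_cup T_prod T_fst T_snd M_opair M_upair M_union M_prod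
  M_cup : dfn.

(** * Ranks and collection *)

(** Comparison of ranks, without introducing ordinals. *)
Inductive rle : V -> V -> Prop :=
  Rle x y : (forall w, w ∈ x -> exists z, z ∈ y /\ rle w z) -> rle x y.

Lemma rleP x y : rle x y <-> forall w, w ∈ x -> exists z, z ∈ y /\ rle w z.
Proof. by split=> [[]|]//; exact: Rle. Qed.

Lemma rle_refl x : rle x x.
Proof. by elim/V_ind: x => x IH; apply/rleP => w wx; exists w; split=> //; exact: IH. Qed.

Lemma rle_trans x y z : rle x y -> rle y z -> rle x z.
Proof.
elim/V_ind: x y z => x IH y z /rleP xy /rleP yz; apply/rleP => w wx.
have [w' [w'y ww']] := xy _ wx; have [w'' [w''z h]] := yz _ w'y.
by exists w''; split=> //; exact: IH ww' h.
Qed.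

Lemma rle_total x y : rle x y \/ exists z, z ∈ x /\ rle y z.
Proof.
elim/V_ind: x y => x IH y; apply: contrapT => /not_orP[nxy nyx].
apply: nxy; apply/rleP => w wx; apply: contrapT => h; apply: nyx; exists w; split=> //.
apply/rleP => v vy; have [wv|[z [zw vz]]] := IH _ wx v; last by exists z.
by case: h; exists v.
Qed.

Section Ctm.
Context {C : ctm}.

(** A level of the cumulative hierarchy of M, bounded by the rank of x. Levels serve Scott's trick
    in [M_collect]. *)
Definition is_level (x v : V) : Prop := forall z, z ∈ v <-> gM z /\ rle z x.

Definition level_graph (f : V) : Prop :=
  (forall w, w ∈ f -> exists x v, w = opair x v /\ is_level x v) /\
  (forall x v, opair x v ∈ f -> forall y, y ∈ x -> exists u, opair y u ∈ f).

(** The local form of [level_graph]: the level of x consists of the subsets of the union of the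
    levels of the elements of x. Only values recorded in f are mentioned, which makes it
    definable. *)
Definition level_graphD (f : V) : Prop :=
  (forall w, w ∈ f -> exists x v, w = opair x v /\ True) /\
  (forall x v, opair x v ∈ f ->
     (forall y, y ∈ x -> exists u, gM u /\ opair y u ∈ f) /\
     (forall z, gM z -> (z ∈ v <-> forall w, w ∈ z -> exists y, y ∈ x /\
        exists u, gM u /\ (opair y u ∈ f /\ w ∈ u)))).

Lemma level_graphE f : gM f -> level_graph f <-> level_graphD f.
Proof.
move=> Mf; split=> [[h1 h2]|[h1 h2]].
  have h3 x v : opair x v ∈ f -> is_level x v.
    by move=> /h1[x' [v' [/pair_inj[-> ->]]]].
  split=> [w /h1[x [v [-> _]]]|x v xv]; first by exists x, v.
  split=> [y /(h2 _ _ xv)[u yu]|z Mz].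
    by exists u; split=> //; exact: M_snd yu Mf.
  rewrite (h3 _ _ xv); split=> [[_ /rleP h] w wz|h].
    have [y [yx wy]] := h _ wz; exists y; split=> //.
    have [u yu] := h2 _ _ xv _ yx; exists u; split; first exact: M_snd yu Mf.
    by split=> //; apply/(h3 _ _ yu); split=> //; exact: M_trans wz Mz.
  split=> //; apply/rleP => w wz; have [y [yx [u [_ [yu wu]]]]] := h _ wz.
  by exists y; split=> //; have [] := (h3 _ _ yu w).1 wu.
have h3 x v : opair x v ∈ f -> is_level x v.
  elim/V_ind: x v => x IH v xv z; have [k1 k2] := h2 _ _ xv; split=> [zv|[Mz /rleP h]].
    have Mz : gM z by apply: M_trans zv _; exact: M_snd xv Mf.
    split=> //; apply/rleP => w wz; have [y [yx [u [_ [yu wu]]]]] := (k2 _ Mz).1 zv _ wz.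
    by exists y; split=> //; have [] := (IH _ yx _ yu w).1 wu.
  apply/(k2 _ Mz) => w wz; have [y [yx wy]] := h _ wz; exists y; split=> //.
  have [u [Mu yu]] := k1 _ yx; exists u; split=> //; split=> //.
  by apply/(IH _ yx _ yu); split=> //; exact: M_trans wz Mz.
split=> [w wf|x v xv y yx].
  have [x [v [E _]]] := h1 _ wf; exists x, v; split=> //.
  by apply: h3; rewrite -E.
by have [/(_ _ yx)[u [_ yu]] _] := h2 _ _ xv; exists u.
Qed.

Lemma D_level_graphD t : dterm t -> definable (fun e => level_graphD (t e)).
Proof. by apply: D_app1; rewrite /level_graphD; dfn. Qed.
#[local] Hint Resolve D_level_graphD : dfn.

Lemma level_unique x v v' : is_level x v -> is_level x v' -> v = v'.
Proof. by move=> h h'; apply: V_ext => z; rewrite h h'. Qed.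

(** By induction, graphs for the elements of x are united and the level of x is added. Collection is
    not yet available, so the graph for each y is made unique and Replacement applies. *)
Lemma level_ex x : gM x -> exists f v, [/\ gM f, level_graph f & opair x v ∈ f].
Proof.
elim/V_ind: x => x IH Mx.
pose (ok y f := level_graphD f /\ exists v, gM v /\ opair y v ∈ f).
have Dok t u : dterm t -> dterm u -> definable (fun e => ok (t e) (u e)).
  by apply: D_app2; rewrite /ok; dfn.
(* The least graph with y in its domain; being least makes it unique. *)
pose (R y g := (gM g /\ ok y g) /\ forall f, gM f -> ok y f -> rev_incl f g).
have R_ex y : y ∈ x -> exists g, R y g.
  move=> yx; have My := M_trans yx Mx; have [f0 [v0 [Mf0 lf0 yv0]]] := IH _ yx My.
  (* The intersection of all these graphs is again one of them, because graphs agree wherever they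
     are defined. *)
  pose (g := sepV f0 (fun w => forall f, gM f -> ok y f -> w ∈ f)).
  have Mg : gM g by apply: M_sep => //; typeclasses eauto with dfn.
  have hg w : w ∈ g <-> forall f, gM f -> ok y f -> w ∈ f.
    rewrite in_sepV; split=> [[]//|h]; split=> //; apply: h => //.
    split; first by apply/level_graphE.
    by exists v0; split=> //; exact: M_snd yv0 Mf0.
  have [k1 k2] := lf0.
  have k3 a v : opair a v ∈ f0 -> is_level a v.
    by move=> /k1[a' [v' [/pair_inj[-> ->]]]].
  exists g; split; last by move=> f Mf okf w /hg; exact.
  split=> //; split.
    apply/level_graphE => //; split=> [w /in_sepV[/k1]//|a v av b ba].
    have /in_sepV[av0 _] := av; have [u bu] := k2 _ _ av0 _ ba.
    exists u; apply/hg => f Mf okf; have [/(level_graphE Mf)[j1 j2] _] := okf.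
    have avf : opair a v ∈ f by apply: (hg _).1 av _ Mf okf.
    have [u' bu'] := j2 _ _ avf _ ba.
    suff <- : u' = u by [].
    apply: level_unique (k3 _ _ bu).
    by have [b' [w [/pair_inj[-> ->]]]] := j1 _ bu'.
  exists v0; split; first exact: M_snd yv0 Mf0.
  apply/hg => f Mf [/(level_graphE Mf)[j1 j2] [v [pushes yv]]].
  suff <- : v = v0 by [].
  apply: level_unique (k3 _ _ yv0).
  by have [b' [w [/pair_inj[-> ->]]]] := j1 _ yv.
have DR : definable (fun e => R (e 0) (e 1)) by rewrite /R; typeclasses eauto with dfn.
have [||F [MF hF]] := M_repl Mx DR.
- move=> y g g' _ [[Mg okg] mg] [[Mg' okg'] mg'].
  by apply: V_ext => z; split; [exact: (mg _ Mg' okg')|exact: (mg' _ Mg okg)].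
- by move=> y g _ [[]].
pose (f := unionV F); have Mf : gM f by exact: M_union.
have [f1 f2] : level_graph f.
  split=> [w /in_unionV[g [/hF[y [_ [[Mg [/(level_graphE Mg)[j1 j2] _]] _]]] wg]]|a v].
    exact: j1.
  move=> /in_unionV[g [gF av]] b ba.
  have /hF[y [_ [[Mg [/(level_graphE Mg)[j1 j2] _]] _]]] := gF.
  by have [u bu] := j2 _ _ av _ ba; exists u; apply/in_unionV; exists g.
have f3 y : y ∈ x -> exists u, opair y u ∈ f.
  move=> yx; have [g Rg] := R_ex _ yx; have [[Mg [_ [v [_ yv]]]] _] := Rg.
  by exists v; apply/in_unionV; exists g; split=> //; apply/hF; exists y.
have f4 a v : opair a v ∈ f -> is_level a v.
  by move=> /f1[a' [v' [/pair_inj[-> ->]]]].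
(* A level recorded in f belongs to the second union of f, so its elements belong to the third, and
   the new level is a set of subsets of that. *)
have [p [Mp hp]] := M_pow (M_union (M_union (M_union Mf))).
pose (L := sepV p (fun z => forall w, w ∈ z -> exists y, y ∈ x /\
   exists u, gM u /\ (opair y u ∈ f /\ w ∈ u))).
have ML : gM L by apply: M_sep => //; dfn.
have hL : is_level x L.
  move=> z; rewrite in_sepV hp; split=> [[[Mz _] h]|[Mz /rleP h]].
    split=> //; apply/rleP => w wz; have [y [yx [u [Mu [yu wu]]]]] := h _ wz.
    by exists y; split=> //; have [] := (f4 _ _ yu w).1 wu.
  have h' w : w ∈ z -> exists y, y ∈ x /\ exists u, gM u /\ (opair y u ∈ f /\ w ∈ u).
    move=> wz; have [y [yx wy]] := h _ wz; exists y; split=> //.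
    have [u yu] := f3 _ yx; exists u; split; first exact: M_snd yu Mf.
    by split=> //; apply/(f4 _ _ yu); split=> //; exact: M_trans wz Mz.
  split=> //; split=> // w wz; have [y [yx [u [_ [yu wu]]]]] := h' _ wz.
  apply/in_unionV; exists u; split=> //; apply/in_unionV; exists (upair y u).
  split; last by apply/in_upair; right.
  by apply/in_unionV; exists (opair y u); split=> //; apply/in_upair; right.
exists (cupV f (upair (opair x L) (opair x L))), L; split.
- by apply: M_cup => //; apply: M_upair; exact: M_opair.
- split=> [w /in_cupV[/f1//|/in_upair[]->]|a v]; [by exists x, L|by exists x, L|].
  move=> /in_cupV[av b /(f2 _ _ av)[u bu]|/in_upair E b ba].
    by exists u; apply/in_cupV; left.
  have Ea : a = x by case: E => /pair_inj[].
  by rewrite Ea in ba; have [u bu] := f3 _ ba; exists u; apply/in_cupV; left.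
- by apply/in_cupV; right; apply/in_upair; left.
Qed.

Definition levelD x v := exists f, gM f /\ (level_graphD f /\ opair x v ∈ f).

Lemma levelDE x v : gM x -> gM v -> levelD x v <-> is_level x v.
Proof.
move=> Mx pushes.
have key f w : gM f -> level_graph f -> opair x w ∈ f -> is_level x w.
  by move=> Mf [h _] /h[x' [v' [/pair_inj[-> ->]]]].
split=> [[f [Mf [/(level_graphE Mf) lf xv]]]|h]; first exact: key lf xv.
have [f [w [Mf lf xw]]] := level_ex Mx; exists f; split=> //.
split; first exact/level_graphE.
by rewrite (level_unique h (key _ _ Mf lf xw)).
Qed.

Lemma level_in x : gM x -> exists v, gM v /\ is_level x v.
Proof.
move=> Mx; have [f [v [Mf [h _] xv]]] := level_ex Mx.
exists v; split; first exact: M_snd xv Mf.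
by have [x' [v' [/pair_inj[-> ->]]]] := h _ xv.
Qed.

Lemma D_levelD t u : dterm t -> dterm u -> definable (fun e => levelD (t e) (u e)).
Proof. by apply: D_app2; rewrite /levelD; dfn. Qed.
#[local] Hint Resolve D_levelD : dfn.

Lemma rle_min (P : V -> Prop) y0 :
  P y0 -> exists y, P y /\ forall y', P y' -> rle y y'.
Proof.
move=> Py0; apply: contrapT => nm.
suff H y : forall z, rle z y -> ~ P z by exact: (H y0 y0 (rle_refl _) Py0).
elim/V_ind: y => y IH z zy Pz; apply: nm; exists z; split=> // y' Py'.
have [//|[w [wz y'w]]] := rle_total z y'.
have [v [vy wv]] := (rleP _ _).1 zy _ wz.
by case: (IH _ vy _ (rle_trans y'w wv) Py').
Qed.

(** Scott's trick: x is sent to the level of a witness of least rank. This level does not depend on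
    the witness, so Replacement collects the levels, and their union contains a witness for each x
    that has one. *)
Lemma M_collect a (R : V -> V -> Prop) : gM a -> definable (fun e => R (e 0) (e 1)) ->
  exists b, gM b /\ forall x, x ∈ a -> (exists y, gM y /\ R x y) ->
    exists y, y ∈ b /\ R x y.
Proof.
move=> Ma DR.
have DR2 t u : dterm t -> dterm u -> definable (fun e => R (t e) (u e)) by exact: D_app2.
pose (S x v := gM v /\ exists y, gM y /\ ((R x y /\ levelD y v) /\
  forall y', gM y' -> R x y' -> forall v', gM v' -> levelD y' v' -> y ∈ v')).
have DS : definable (fun e => S (e 0) (e 1)).
  by rewrite /S; typeclasses eauto with dfn.
have [||b [Mb hb]] := M_repl Ma DS.
- move=> x v v' _ [pushes [y [My [[Rxy lyv] h]]]] [Mv' [y' [My' [[Rxy' lyv'] h']]]].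
  have lv := (levelDE My pushes).1 lyv; have lv' := (levelDE My' Mv').1 lyv'.
  have [_ yy'] := (lv' _).1 (h _ My' Rxy' _ Mv' lyv').
  have [_ y'y] := (lv _).1 (h' _ My Rxy _ pushes lyv).
  by apply: V_ext => z; rewrite lv lv'; split=> -[? ?]; split=> //;
   [exact: rle_trans yy'|exact: rle_trans y'y].
- by move=> x v _ [].
exists (unionV b); split=> [|x xa [y0 [My0 Rxy0]]]; first exact: M_union.
have [y [[My Rxy] ymin]] := @rle_min (fun y => gM y /\ R x y) y0 (conj My0 Rxy0).
have [v [pushes lv]] := level_in My.
exists y; split=> //; apply/in_unionV; exists v; split; last first.
  by apply/lv; split=> //; exact: rle_refl.
apply/hb; exists x; split=> //; split=> //; exists y; split=> //.
split; first by split=> //; apply/levelDE.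
move=> y' My' Rxy' v' Mv' /(levelDE My' Mv') lv'; apply/lv'; split=> //.
exact: ymin.
Qed.

(** The axiom of choice is given for families of disjoint nonempty sets. The sets {a} × {y ∈ b | R a
    y} form such a family, where b collects enough witnesses. *)
Lemma M_choice A (R : V -> V -> Prop) : gM A -> definable (fun e => R (e 0) (e 1)) ->
  exists f, [/\ gM f,
    forall w, w ∈ f -> exists a y, [/\ w = opair a y, a ∈ A & R a y],
    forall a y y', opair a y ∈ f -> opair a y' ∈ f -> y = y' &
    forall a, a ∈ A -> (exists y, gM y /\ R a y) -> exists y, opair a y ∈ f].
Proof.
move=> MA DR; have [b [Mb hb]] := M_collect MA DR.
have DR2 t u : dterm t -> dterm u -> definable (fun e => R (t e) (u e)) by exact: D_app2.
pose (fam a := sepV (prodV (upair a a) b) (fun w => R (fst_V w) (snd_V w))).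
have Tfam t : dterm t -> dterm (fun e => fam (t e)).
  by apply: T_app1; rewrite /fam; typeclasses eauto with dfn.
have famE a y : opair a y ∈ fam a <-> y ∈ b /\ R a y.
  rewrite in_sepV pair_in_prodV in_upair fst_pair snd_pair.
  by split=> [[[]]|[]] //; split=> //; split=> //; left.
have famP a z : z ∈ fam a -> exists y, z = opair a y.
  move=> /in_sepV[/in_prodV[a' [y [/in_upair E _ ->]]] _]; exists y.
  by case: E => ->.
pose (F := imgV A (fun a => exists y, y ∈ b /\ R a y) fam).
have MF : gM F by apply: M_img => //; typeclasses eauto with dfn.
have [||c [Mc hc]] := zfc_choice M_zfc MF.
- move=> x Mx /in_imgV[a [aA [y [yb Ray]] E]]; exists (opair a y); split.
    by apply: M_opair; [exact: M_trans aA MA|exact: M_trans yb Mb].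
  by rewrite E; apply/famE.
- move=> x y _ _ /in_imgV[a [aA _ ->]] /in_imgV[a' [aA' _ ->]].
  by case=> z [_ /famP[u ->] /famP[u' /pair_inj[-> _]]].
exists (sepV (prodV A b) (fun w => w ∈ c /\ R (fst_V w) (snd_V w))); split.
- by apply: M_sep; [exact: M_prod|typeclasses eauto with dfn].
- move=> w /in_sepV[/in_prodV[a [y [aA yb ->]]] [_]]; rewrite fst_pair snd_pair.
  by exists a, y.
- move=> a y y' /in_sepV[/pair_in_prodV[aA yb] [yc]]; rewrite fst_pair snd_pair => Ry.
  move=> /in_sepV[/pair_in_prodV[_ yb'] [yc']]; rewrite fst_pair snd_pair => Ry'.
  have aF : fam a ∈ F by apply/in_imgV; exists a; split=> //; exists y.
  have [z [_ hz]] := hc _ (M_trans aF MF) aF.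
  have Ma := M_trans aA MA.
  have Ey : z = opair a y.
    apply: hz; split; [exact: M_opair Ma (M_trans yb Mb)|exact/famE|exact: yc].
  have Ey' : z = opair a y'.
    apply: hz; split; [exact: M_opair Ma (M_trans yb' Mb)|exact/famE|exact: yc'].
  by have [] := pair_inj (etrans (esym Ey) Ey').
- move=> a aA ex; have [y [yb Ray]] := hb _ aA ex.
  have aF : fam a ∈ F by apply/in_imgV; exists a; split=> //; exists y.
  have [z [[_ zf zc] _]] := hc _ (M_trans aF MF) aF.
  have [y' Ez] := famP _ _ zf; rewrite Ez in zf zc.
  have [y'b Ray'] := (famE _ _).1 zf.
  by exists y'; apply/in_sepV; rewrite fst_pair snd_pair pair_in_prodV.
Qed.

End Ctm.

(** * Recursion inside the model *)

Section Rec.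
Variables (A : V -> V -> V) (K : V -> V -> V -> Prop) (k : V -> V)
  (h : V -> V -> V -> V) (c : V).

(** The guard [tmem] lets the recursion be defined before anything is known about k; in the section
    [TRec] it follows from K by [Kt]. *)
Definition rec_step (x : V) (r : forall y, tmem y x -> V) : V :=
  vset (fun i : {i : idx (A c x) | K c x (el i) /\ tmem (k (el i)) x} =>
    h c (el (sval i)) (r _ (proj2 (svalP i)))).

Definition rec : V -> V := Fix tmem_wf (fun=> V) rec_step.

Lemma in_rec x z : z ∈ rec x <->
  exists a, [/\ a ∈ A c x, K c x a, tmem (k a) x & z = h c a (rec (k a))].
Proof.
rewrite /rec Fix_eq; last first.
  move=> y f g fg; rewrite /rec_step; congr vset.
  by apply/funext => i; rewrite fg.
rewrite in_vset; split=> [[[i [Ki ti]] <-]|[_ [[i <-] Ki ti ->]]].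
  by exists (el i); split=> //; exists i.
by exists (exist _ i (conj Ki ti)).
Qed.

End Rec.

Section TRec.
Context {C : ctm}.
Variables (A : V -> V -> V) (K : V -> V -> V -> Prop) (k : V -> V)
  (h : V -> V -> V -> V).
Hypothesis TA : dterm (fun e => A (e 0) (e 1)).
Hypothesis DK : definable (fun e => K (e 0) (e 1) (e 2)).
Hypothesis Tk : dterm (fun e => k (e 0)).
Hypothesis Th : dterm (fun e => h (e 0) (e 1) (e 2)).
Hypothesis Kt : forall c x a, a ∈ A c x -> K c x a -> tmem (k a) x.

#[local] Notation F := (rec A K k h).

Let TA' t u : dterm t -> dterm u -> dterm (fun e => A (t e) (u e)).
Proof. exact: T_app2. Qed.
Let DK' t u v : dterm t -> dterm u -> dterm v -> definable (fun e => K (t e) (u e) (v e)).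
Proof. exact: D_app3. Qed.
Let Tk' t : dterm t -> dterm (fun e => k (t e)).
Proof. exact: T_app1. Qed.
Let Th' t u v : dterm t -> dterm u -> dterm v -> dterm (fun e => h (t e) (u e) (v e)).
Proof. exact: T_app3. Qed.
#[local] Hint Resolve TA' DK' Tk' Th' : dfn.

Let M_A c x : gM c -> gM x -> gM (A c x).
Proof.
move=> Mc Mx; case: TA => /(_ (scons c (fun=> x))) + _; apply.
by apply: env_scons.
Qed.
Let M_h c a u : gM c -> gM a -> gM u -> gM (h c a u).
Proof.
move=> Mc Ma Mu; case: Th => /(_ (scons c (scons a (fun=> u)))) + _; apply.
by do 2!apply: env_scons => //.
Qed.

Definition rec_graph c f :=
  (forall w, w ∈ f -> exists x, w = opair x (F c x)) /\
  (forall x v, opair x v ∈ f -> forall a, a ∈ A c x -> K c x a ->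
     exists u, opair (k a) u ∈ f).

(** The local form of [rec_graph]: the recursion equation refers only to values recorded in f, hence
    is definable. *)
Definition rec_graphD c f :=
  (forall w, w ∈ f -> exists x v, w = opair x v /\ True) /\
  (forall x v, opair x v ∈ f ->
     (forall a, a ∈ A c x -> K c x a -> exists u, gM u /\ opair (k a) u ∈ f) /\
     (forall z, gM z -> (z ∈ v <-> exists a, a ∈ A c x /\ (K c x a /\
        exists u, gM u /\ (opair (k a) u ∈ f /\ z = h c a u))))).

Lemma rec_graphE c f : gM c -> gM f -> rec_graph c f <-> rec_graphD c f.
Proof.
move=> Mc Mf; split=> [[h1 h2]|[h1 h2]].
  have h3 x v : opair x v ∈ f -> v = F c x.
    by move=> /h1[x' /pair_inj[-> ->]].
  split=> [w /h1[x ->]|x v xv]; first by exists x, (F c x).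
  split=> [a aA Ka|z Mz].
    by have [u au] := h2 _ _ xv _ aA Ka; exists u; split=> //; exact: M_snd au Mf.
  rewrite (h3 _ _ xv) in_rec; split=> [[a [aA Ka _ ->]]|[a [aA [Ka [u [_ [au ->]]]]]]].
    exists a; split=> //; split=> //; have [u au] := h2 _ _ xv _ aA Ka.
    exists u; split; first exact: M_snd au Mf.
    by split=> //; rewrite (h3 _ _ au).
  by exists a; split=> //; [exact: Kt aA Ka|rewrite (h3 _ _ au)].
have h3 x v : opair x v ∈ f -> v = F c x.
  elim/tmem_ind: x v => x IH v xv; have [k1 k2] := h2 _ _ xv.
  have Mx := M_fst xv Mf; have pushes := M_snd xv Mf.
  apply: V_ext => z; rewrite in_rec; split=> [zv|[a [aA Ka ta ->]]].
    have [a [aA [Ka [u [_ [au ->]]]]]] := (k2 _ (M_trans zv pushes)).1 zv.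
    have ta := Kt aA Ka.
    by exists a; split=> //; rewrite (IH _ ta _ au).
  have [u [Mu au]] := k1 _ aA Ka.
  rewrite -(IH _ ta _ au); apply/k2; first exact: M_h Mc (M_trans aA (M_A Mc Mx)) Mu.
  by exists a; split=> //; split=> //; exists u.
split=> [w wf|x v xv a aA Ka].
  have [x [v [E _]]] := h1 _ wf; exists x; rewrite E.
  by rewrite (h3 x v) // -E.
by have [/(_ _ aA Ka)[u [_ au]] _] := h2 _ _ xv; exists u.
Qed.

Lemma D_rec_graphD t u : dterm t -> dterm u -> definable (fun e => rec_graphD (t e) (u e)).
Proof. by apply: D_app2; rewrite /rec_graphD; dfn. Qed.
#[local] Hint Resolve D_rec_graphD : dfn.

(** As in [level_ex], except that Collection now gathers approximations for all the arguments [k a];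
    correct approximations agree, so their union is one. *)
Lemma rec_graph_ex c x : gM c -> gM x ->
  exists f, [/\ gM f, rec_graph c f & opair x (F c x) ∈ f].
Proof.
move=> Mc; elim/tmem_ind: x => x IH Mx.
have MAx := M_A Mc Mx.
have [|b [Mb hb]] := M_collect
  (R := fun a f => rec_graphD c f /\ exists x v, opair x v ∈ f /\ x = k a) MAx; first by dfn.
pose (f := unionV (sepV b (fun f => rec_graphD c f))).
have Mf : gM f by apply/M_union/M_sep => //; dfn.
have hf w : w ∈ f <-> exists g, [/\ g ∈ b, gM g, rec_graph c g & w ∈ g].
  rewrite in_unionV; split=> [[g [/in_sepV[gb lg] wg]]|[g [gb Mg lg wg]]].
    by have Mg := M_trans gb Mb; exists g; split=> //; apply/rec_graphE.
  by exists g; split=> //; apply/in_sepV; split=> //; apply/rec_graphE.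
have [f1 f2] : rec_graph c f.
  split=> [w /hf[g [_ _ [g1 _] /g1//]]|y v /hf[g [gb Mg lg yv]] a aA Ka].
  have [_ g2] := lg; have [u au] := g2 _ _ yv _ aA Ka.
  by exists u; apply/hf; exists g.
have f0 y v : opair y v ∈ f -> v = F c y by move=> /f1[x' /pair_inj[-> ->]].
have f3 a : a ∈ A c x -> K c x a -> opair (k a) (F c (k a)) ∈ f.
  move=> aA Ka; have ta := Kt aA Ka.
  have Mka : gM (k a).
    by case: Tk => /(_ (fun=> a)) + _; apply=> _; exact: M_trans aA MAx.
  have [g [Mg lg xg]] := IH _ ta Mka.
  have [|g' [g'b [lg' [y [v [yv E]]]]]] := hb _ aA.
    exists g; split=> //; split; first exact/rec_graphE.
    by exists (k a), (F c (k a)).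
  have Mg' := M_trans g'b Mb.
  have hyv : opair (k a) v ∈ f.
    by apply/hf; exists g'; split=> //; [exact/rec_graphE|rewrite -E].
  by rewrite -(f0 _ _ hyv).
have [|||v [pushes hv]] := M_repl (A := A c x)
   (R := fun a z => K c x a /\ exists y u, opair y u ∈ f /\ (y = k a /\ z = h c a u)) MAx.
- by dfn.
- move=> a z z' _ [_ [y [u [yu [E ->]]]]] [_ [y' [u' [yu' [E' ->]]]]].
  by rewrite (f0 _ _ yu) (f0 _ _ yu') E E'.
- move=> a z aA [_ [y [u [yu [E ->]]]]].
  exact: M_h Mc (M_trans aA MAx) (M_snd yu Mf).
have Ev : F c x = v.
  apply: V_ext => z; rewrite hv in_rec; split.
    case=> a [aA Ka ta ->]; exists a; split=> //; split=> //.
    by exists (k a), (F c (k a)); split=> //; exact: f3.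
  case=> a [aA [Ka [y [u [yu [E ->]]]]]]; exists a; split=> //; first exact: Kt aA Ka.
  by rewrite (f0 _ _ yu) E.
exists (cupV f (upair (opair x v) (opair x v))); split.
- by apply: M_cup => //; apply: M_upair; exact: M_opair.
- split=> [w /in_cupV[/f1//|/in_upair[]->]|y u]; [by exists x; rewrite Ev|by exists x;
  rewrite Ev|].
  move=> /in_cupV[yu a aA Ka|/in_upair E a aA Ka].
    by have [w wf] := f2 _ _ yu _ aA Ka; exists w; apply/in_cupV; left.
  have Ey : y = x by case: E => /pair_inj[].
  rewrite Ey in aA Ka.
  by exists (F c (k a)); apply/in_cupV; left; exact: f3.
- by apply/in_cupV; right; apply/in_upair; left; rewrite Ev.
Qed.

(** The value is definable as the one recorded by some correct approximation in M. *)
Lemma T_rec t u : dterm t -> dterm u -> dterm (fun e => F (t e) (u e)).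
Proof.
apply: T_app2.
have MF c x : gM c -> gM x -> gM (F c x).
  move=> Mc Mx; have [f [Mf _ xf]] := rec_graph_ex Mc Mx; exact: M_snd xf Mf.
split=> [e Me|]; first exact: MF.
have H : definable (fun e => exists f,
  gM f /\ (rec_graphD (e 1) f /\ opair (e 2) (e 0) ∈ f)) by dfn.
apply: (D_ext H) => e Me; split=> [[f [Mf [lf xf]]]|->].
  have [f1 _] := (rec_graphE (Me 1) Mf).2 lf.
  by have [x /pair_inj[-> ->]] := f1 _ xf.
have [f [Mf lf xf]] := rec_graph_ex (Me 1) (Me 2).
by exists f; split=> //; split=> //; apply/rec_graphE.
Qed.

End TRec.

(** * Finite sets of conditions *)

Notation pr b i j := (opair (num i) (num j) ∈ b).

Lemma bit_inj n k v n' k' v' :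
  bit n k v = bit n' k' v' -> [/\ n = n', k = k' & v = v'].
Proof.
move=> /pair_inj[/pair_inj[/num_inj -> /num_inj ->] /num_inj E]; split=> //.
by case: v v' E => [] [].
Qed.

(** The code in M of a condition in Inj(ω, X): the pair (i, j) of indices stands for (i, x_j), and
    [cond_of] decodes it. *)
Definition PInj (b : V) : Prop :=
  [/\ finite_set (elts b),
      forall z, z ∈ b -> exists i j, z = opair (num i) (num j),
      forall i j k, pr b i j -> pr b i k -> j = k &
      forall i j k, pr b i k -> pr b j k -> i = j].

Section Ctm.
Context {C : ctm}.

Lemma M_num0 : gM (num 0).
Proof.
have [x [Mx [o [Mo _ ho]] _]] := zfc_infinity M_zfc.
suff <- : o = num 0 by [].
apply: V_ext => z; split=> [zo|/in_num0//].
by case: (ho _ (M_trans zo Mo) zo).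
Qed.

Lemma numS n : num n.+1 = succ_V (num n).
Proof. by []. Qed.

Lemma succE x : succ_V x = cupV x (upair x x).
Proof.
by apply: V_ext => z; rewrite in_succ in_cupV in_upair; split=> -[|]; auto; case; auto.
Qed.

Lemma M_succ x : gM x -> gM (succ_V x).
Proof. by move=> Mx; rewrite succE; dfn. Qed.

Lemma M_num n : gM (num n).
Proof. by elim: n => [|n IH]; [exact: M_num0|exact: M_succ]. Qed.

Lemma M_omega : gM omega.
Proof.
have [x [Mx [o [Mo ox ho]] hx]] := zfc_infinity M_zfc.
have E : o = num 0.
  apply: V_ext => z; split=> [zo|/in_num0//].
  by case: (ho _ (M_trans zo Mo) zo).
pose (ind I := num 0 ∈ I /\ forall y, y ∈ I -> cupV y (upair y y) ∈ I).
have M0 := M_num0.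
have Dind t : dterm t -> definable (fun e => ind (t e)) by apply: D_app1; rewrite /ind; dfn.
have indx : ind x.
  split=> [|y yx]; first by rewrite -E.
  have My := M_trans yx Mx; have [s [Ms sx hs]] := hx _ My yx.
  suff <- : s = cupV y (upair y y) by [].
  apply: V_ext => z; rewrite in_cupV in_upair; split=> [zs|zz].
    by have [|] := (hs _ (M_trans zs Ms)).1 zs; auto.
  apply/hs; last by case: zz; auto; case; auto.
  by case: zz => [zy|[]->//]; exact: M_trans zy My.
(* The least inductive set of M. Keeping only 0 and the successors of its elements leaves it
   inductive, so it contains nothing else and an induction on membership finds the numerals. *)
pose (W := sepV x (fun z => forall I, gM I -> ind I -> z ∈ I)).
have MW : gM W by apply: M_sep => //; typeclasses eauto with dfn.
have hW z : z ∈ W <-> forall I, gM I -> ind I -> z ∈ I.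
  by rewrite in_sepV; split=> [[]//|H]; split=> //; exact: H.
have indW : ind W.
  split; first by apply/hW => I _ [].
  by move=> y /hW H; apply/hW => I MI iI; have [_] := iI; apply; exact: H.
suff -> : omega = W by [].
apply: V_ext => z; rewrite in_omega; split=> [[n ->]|].
  elim: n => [|n IH]; first by case: indW.
  by rewrite numS succE; case: indW => _; apply.
elim/V_ind: z => z IH zW.
pose (J := sepV W (fun z => z = num 0 \/ exists y, y ∈ W /\ z = cupV y (upair y y))).
have MJ : gM J by apply: M_sep => //; dfn.
have indJ : ind J.
  have [W0 WS] := indW.
  split=> [|y /in_sepV[yW _]]; apply/in_sepV; split=> //; [by left|exact: WS|].
  by right; exists y.
have /in_sepV[_ [->|[y [yW Ez]]]] := (hW z).1 zW _ MJ indJ; first by exists 0.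
have [|n En] := IH y _ yW.
  by rewrite Ez; apply/in_cupV; right; apply/in_upair; left.
by exists n.+1; rewrite numS succE Ez En.
Qed.
#[local] Hint Resolve M_num M_omega : dfn.

Lemma D_alln (P : V -> (nat -> V) -> Prop) :
  definable (fun e => P (e 0) (fun n => e n.+1)) -> definable (fun e => forall n, P (num n) e).
Proof.
move=> DP; have H := D_allin (T_const M_omega) DP.
apply: (D_ext H) => e _; split=> [h n|h x /in_omega[n ->]//].
by apply: h; apply/in_omega; exists n.
Qed.

Lemma D_exn (P : V -> (nat -> V) -> Prop) :
  definable (fun e => P (e 0) (fun n => e n.+1)) -> definable (fun e => exists n, P (num n) e).
Proof.
move=> DP; have H := D_exin (T_const M_omega) DP.
apply: (D_ext H) => e _; split=> [[x [/in_omega[n ->] h]]|[n h]]; first by exists n.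
by exists (num n); split=> //; apply/in_omega; exists n.
Qed.

Lemma D_allb (P : V -> (nat -> V) -> Prop) :
  definable (fun e => P (e 0) (fun n => e n.+1)) ->
  definable (fun e => forall v : bool, P (num v) e).
Proof.
move=> DP; have H := D_allin (T_const (M_upair (M_num 0) (M_num 1))) DP.
apply: (D_ext H) => e _; split=> [h [] |h x /in_upair[]->]; first by apply: h; apply/in_upair;
  right.
- by apply: h; apply/in_upair; left.
- exact: (h false).
- exact: (h true).
Qed.

Lemma finite_coll (s : seq V) : (forall a, a \in s -> gM a) ->
  exists n f, [/\ gM f, forall j a, opair j a ∈ f -> j ∈ num n,
    forall j a a', opair j a ∈ f -> opair j a' ∈ f -> a = a' &
    forall a, a \in s -> exists j, j ∈ num n /\ opair j a ∈ f].
Proof.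
elim: s => [|a s IH] Ms.
  by exists 0, (num 0); split=> // [|j a|j a a']; [exact: M_num|move/in_num0..].
have [|n [f [Mf f1 f2 f3]]] := IH.
  by move=> x xs; apply: Ms; rewrite inE xs orbT.
have Ma : gM a by apply: Ms; rewrite inE eqxx.
exists n.+1, (cupV f (upair (opair (num n) a) (opair (num n) a))).
have g j x : opair j x ∈ cupV f (upair (opair (num n) a) (opair (num n) a)) <->
    opair j x ∈ f \/ j = num n /\ x = a.
  rewrite in_cupV in_upair; split=> [[|[]/pair_inj]|[|[-> ->]]]; by auto.
split.
- by apply: M_cup => //; have := M_num n; dfn.
- move=> j x /g[/f1|[-> _]]; rewrite numS in_succ; by auto.
- move=> j x x' /g[jx|[-> ->]] /g[jx'|[E ->]] //.
  + exact: f2 jx jx'.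
  + by rewrite E in jx; case: (mem_irr (f1 _ _ jx)).
  + by case: (mem_irr (f1 _ _ jx')).
- move=> x; rewrite inE => /orP[/eqP->|xs].
    exists (num n); rewrite g; split; [|by right].
    by rewrite numS in_succ; right.
  have [j [jn jx]] := f3 _ xs; exists j; rewrite g; split; last by left.
  by rewrite numS in_succ; left.
Qed.

(** Finiteness is absolute: by [finite_coll] a finite set of elements of M is covered, inside M, by
    a function on a numeral, and conversely such a function bounds the set. *)
Lemma M_finite A : gM A ->
  exists y, gM y /\ forall z, z ∈ y <-> rev_incl A z /\ finite_set (elts z).
Proof.
move=> MA; have [p [Mp hp]] := M_pow MA.
pose (fin z := exists n, n ∈ omega /\ exists f, gM f /\
  ((forall a, a ∈ z -> exists j, j ∈ n /\ opair j a ∈ f) /\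
   forall j a, opair j a ∈ f -> forall a', gM a' -> opair j a' ∈ f -> a = a')).
exists (sepV p fin); split; first by apply: M_sep => //; rewrite /fin; dfn.
move=> z; rewrite in_sepV hp; split.
  case=> -[Mz zA] [_ [/in_omega[n ->] [f [Mf [f1 f2]]]]]; split=> //.
  apply: (@sub_finite_set _ _ ((fun j => xget z [set a | opair (num j) a ∈ f]) @` `I_n));
    last exact/finite_image/finite_II.
  move=> a /f1[_ [/in_num[j jn ->] ja]]; exists j => //.
  case: xgetP => [y _ /= jy|/(_ a)//]; apply: (f2 _ _ jy _ _ ja).
  exact: M_snd ja Mf.
case=> zA fz; have [s Es] := (finite_seqP _).1 fz.
have hs a : a ∈ z <-> a \in s by rewrite -[a ∈ z]/(elts z a) Es.
have [|n [f [Mf f1 f2 f3]]] := @finite_coll s.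
  by move=> a /hs /zA aA; exact: M_trans aA MA.
have Ms : forall a, a \in s -> gM a by move=> a /hs /zA aA; exact: M_trans aA MA.
have Mz : gM z.
  have H : forall s : seq V, (forall a, a \in s -> gM a) ->
      exists y, gM y /\ forall a, a ∈ y <-> a \in s.
    elim=> [|a s' IH] Ms'.
      by exists (num 0); split=> [|a]; [exact: M_num|split=> // /in_num0].
    have [|y [My hy]] := IH; first by move=> x xs; apply: Ms'; rewrite inE xs orbT.
    have Ma : gM a by apply: Ms'; rewrite inE eqxx.
    exists (cupV y (upair a a)); split; first by dfn.
    move=> x; rewrite in_cupV in_upair hy inE; split=> [[->|[]->]|/orP[/eqP|]];
      rewrite ?eqxx ?orbT //; by auto.
  have [y [My hy]] := H s Ms; suff -> : z = y by [].
  by apply: V_ext => a; rewrite hs hy.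
split=> //; exists (num n); split; first by apply/in_omega; exists n.
exists f; split=> //; split=> [a /hs/f3//|j a ja a' _]; exact: f2.
Qed.

Lemma Fn_coll : exists y, gM y /\ forall z, z ∈ y <-> Fn z.
Proof.
have [|p [Mp hp]] := @M_finite (prodV (prodV omega omega) (upair (num 0) (num 1))).
  by typeclasses eauto with dfn.
exists (sepV p (fun p => forall u i, opair u i ∈ p -> forall j, gM j -> opair u j ∈ p -> i = j)).
have Mq : gM (sepV p (fun p => forall u i, opair u i ∈ p -> forall j, gM j ->
    opair u j ∈ p -> i = j)) by apply: M_sep => //; dfn.
split=> // z; rewrite in_sepV hp; split=> [[[zA fz] zf]|[fz z1 z2]].
  have hz w : w ∈ z -> exists n k b, w = bit n k b.
    move=> /zA /in_prodV[u [v [/in_prodV[_ [_ [/in_omega[n ->] /in_omega[k ->] ->]]]]]].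
    by case/in_upair => -> ->; [exists n, k, false|exists n, k, true].
  split=> // n k b c nb nc; have := zf _ _ nb (num c) (M_num c) nc.
  by move=> /num_inj; case: b c {nb nc} => [] [].
split; [split=> //|] => [w /z1[n [k [b ->]]]|u i ui j _ uj].
  apply/pair_in_prodV; split; last by apply/in_upair; case: b; auto.
  by apply/pair_in_prodV; split; apply/in_omega; [exists n|exists k].
have [n [k [b E]]] := z1 _ ui; have [n' [k' [b' E']]] := z1 _ uj.
have [Eu Ei] := pair_inj E; have [Eu' Ej] := pair_inj E'.
rewrite Ei Ej; congr (num (nat_of_bool _)); apply: (z2 n k); first by rewrite -E.
have [/num_inj En /num_inj Ek] := pair_inj (etrans (esym Eu) Eu').
by rewrite En Ek -E'.
Qed.

Definition FnV : V := sval (cid Fn_coll).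

Lemma M_FnV : gM FnV.
Proof. by rewrite /FnV; case: cid => y [h _] /=. Qed.

Lemma in_FnV z : z ∈ FnV <-> Fn z.
Proof. by rewrite /FnV; case: cid => y [_ h] /=; exact: h. Qed.

Lemma PInj_coll : exists y, gM y /\ forall z, z ∈ y <-> PInj z.
Proof.
have [|p [Mp hp]] := @M_finite (prodV omega omega); first by typeclasses eauto with dfn.
pose (good p := (forall u i, opair u i ∈ p -> forall j, gM j -> opair u j ∈ p -> i = j) /\
  (forall i u, opair i u ∈ p -> forall j, gM j -> opair j u ∈ p -> i = j)).
have Mq : gM (sepV p good) by apply: M_sep => //; rewrite /good; dfn.
exists (sepV p good); split=> // z; rewrite in_sepV hp; split=> [[[zA fz] [zf zi]]|[fz z1 z2 z3]].
  split=> //.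
  - by move=> w /zA /in_prodV[_ [_ [/in_omega[n ->] /in_omega[k ->] ->]]]; exists n, k.
  - by move=> i j k ij ik; apply/num_inj/(zf _ _ ij) => //; exact: M_num.
  - by move=> i j k ij ik; apply/num_inj/(zi _ _ ij) => //; exact: M_num.
split; [split=> //|split] => [w /z1[n [k ->]]|u i ui j _ uj|i u ui j _ uj].
- by apply/pair_in_prodV; split; apply/in_omega; [exists n|exists k].
- have [n [k E]] := z1 _ ui; have [n' [k' E']] := z1 _ uj.
  have [[Eu Ei] [_ Ej]] := (pair_inj E, pair_inj E').
  rewrite Ei Ej; congr num; apply: (z2 n); first by rewrite -Eu -Ei.
  by rewrite -Eu -Ej.
- have [k [n E]] := z1 _ ui; have [k' [n' E']] := z1 _ uj.
  have [[Ei Eu] [Ej _]] := (pair_inj E, pair_inj E').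
  rewrite Ei Ej; congr num; apply: (z3 _ _ n); first by rewrite -Eu -Ei.
  by rewrite -Eu -Ej.
Qed.

Definition PInjV : V := sval (cid PInj_coll).

Lemma M_PInjV : gM PInjV.
Proof. by rewrite /PInjV; case: cid => y [h _] /=. Qed.

Lemma in_PInjV z : z ∈ PInjV <-> PInj z.
Proof. by rewrite /PInjV; case: cid => y [_ h] /=; exact: h. Qed.

End Ctm.

#[export] Hint Resolve M_num M_omega M_FnV M_PInjV : dfn.

(** * Forcing over an arbitrary poset ordered by reverse inclusion *)

Lemma incl_refl x : rev_incl x x.
Proof. by []. Qed.

Lemma incl_trans y x z : rev_incl x y -> rev_incl y z -> rev_incl x z.
Proof. by move=> xy yz w wz; apply/xy/yz. Qed.

Arguments incl_refl x : clear implicits.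
Arguments incl_trans {y x z} _ _.

#[export] Hint Resolve incl_refl : core.

(** A bound on the free variables: only finitely many parameters matter, so those of an instance
    have a common support. *)
Fixpoint free_bound (phi : form) : nat :=
  match phi with
  | fMem i j | fEq i j => maxn i.+1 j.+1
  | fNot phi => free_bound phi
  | fAnd phi psi => maxn (free_bound phi) (free_bound psi)
  | fEx phi => (free_bound phi).-1
  end.

Section Forcing.
Variable Q : set V.
Notation feq := (forces_eq Q rev_incl).
Notation fmem := (forces_mem Q rev_incl).

(** Forced inclusion with [forces_mem] unfolded. It turns the mutual clauses for atomic formulas
    into a recursion on [forces_eq] alone. *)
Definition forced_sub (E : V -> V -> V -> Prop) p a b : Prop :=
  forall q s c, Q q -> rev_incl q p -> opair s c ∈ a -> rev_incl q s ->
    exists r s' d, [/\ Q r, rev_incl r q, opair s' d ∈ b, rev_incl r s' & E r c d].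

Lemma feq_forced_sub p a b : feq p a b <-> forced_sub feq p a b /\ forced_sub feq p b a.
Proof.
have key x y : (forall q s c, Q q -> rev_incl q p -> opair s c ∈ x -> rev_incl q s ->
    fmem q c y) <-> forced_sub feq p x y.
  split=> h q s c Qq qp sx qs.
    by have [r [s' [d [? ? ? ? ?]]]] := (forces_memP _ _ _ _ _).1 (h _ _ _ Qq qp sx qs)
      q Qq (incl_refl _); exists r, s', d.
  apply/forces_memP => q' Qq' q'q; apply: (h q' s c) => //; exact: incl_trans q'q _.
by rewrite forces_eqP !key.
Qed.

Lemma feq_sym p a b : feq p a b -> feq p b a.
Proof. by rewrite !feq_forced_sub => -[]. Qed.

Lemma forced_sub_mono E p q a b : forced_sub E p a b -> rev_incl q p -> forced_sub E q a b.
Proof. by move=> h qp r s c Qr rq; apply: h => //; exact: incl_trans rq qp. Qed.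

Lemma feq_mono p q a b : feq p a b -> rev_incl q p -> feq q a b.
Proof.
by rewrite !feq_forced_sub => -[h1 h2] qp; split; apply: forced_sub_mono; eauto.
Qed.

Lemma fmem_mono p q a b : fmem p a b -> rev_incl q p -> fmem q a b.
Proof.
rewrite !forces_memP => h qp r Qr rq; apply: h => //; exact: incl_trans rq qp.
Qed.

Lemma feq_refl p a : feq p a a.
Proof.
elim/tmem_ind: a p => a IH p; have h : forced_sub feq p a a.
  by move=> q s c Qq qp sc qs; exists q, s, c; split=> //; exact/IH/tmem_snd/sc.
exact/feq_forced_sub.
Qed.

Lemma feq_trans p a b c : feq p a b -> feq p b c -> feq p a c.
Proof.
elim/tmem_ind: a p b c => a IH p b c /feq_forced_sub[ab ba] /feq_forced_sub[bc cb].
apply/feq_forced_sub; split=> q s x Qq qp sx qs.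
  have [r [s' [y [Qr rq s'y rs' xy]]]] := ab _ _ _ Qq qp sx qs.
  have [r' [s'' [z [Qr' r'r s''z rs'' yz]]]] := bc _ _ _ Qr (incl_trans rq qp) s'y rs'.
  exists r', s'', z; split=> //; first exact: incl_trans r'r rq.
  exact: IH (tmem_snd sx) _ _ _ (feq_mono xy r'r) yz.
have [r [s' [y [Qr rq s'y rs' xy]]]] := cb _ _ _ Qq qp sx qs.
have [r' [s'' [z [Qr' r'r s''z rs'' yz]]]] := ba _ _ _ Qr (incl_trans rq qp) s'y rs'.
exists r', s'', z; split=> //; first exact: incl_trans r'r rq.
apply: feq_sym; apply: IH (tmem_snd s''z) _ _ _ (feq_sym yz) _.
exact: feq_mono (feq_sym xy) r'r.
Qed.

Lemma fmem_cong p a b a' b' :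
  fmem p a b -> feq p a a' -> feq p b b' -> fmem p a' b'.
Proof.
move=> /forces_memP h aa' /feq_forced_sub[bb' _]; apply/forces_memP => q Qq qp.
have [r [s [c [Qr rq sc rs ac]]]] := h _ Qq qp.
have rp := incl_trans rq qp.
have [r' [s' [d [Qr' r'r s'd r's' cd]]]] := bb' _ _ _ Qr rp sc rs.
exists r', s', d; split=> //; first exact: incl_trans r'r rq.
apply: feq_trans cd; apply: feq_trans (feq_mono ac r'r).
by apply/feq_sym/(feq_mono aa')/(incl_trans r'r).
Qed.

Lemma feq_dens p a b :
  (forall q, Q q -> rev_incl q p -> exists r, [/\ Q r, rev_incl r q & feq r a b]) ->
  feq p a b.
Proof.
move=> h; apply/feq_forced_sub; split=> q s c Qq qp sc qs;
  have [r [Qr rq /feq_forced_sub[h1 h2]]] := h _ Qq qp.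
- have [r' [s' [d [? r'r ? ? ?]]]] := h1 _ _ _ Qr (incl_refl _) sc (incl_trans rq qs).
  by exists r', s', d; split=> //; exact: incl_trans r'r rq.
- have [r' [s' [d [? r'r ? ? ?]]]] := h2 _ _ _ Qr (incl_refl _) sc (incl_trans rq qs).
  by exists r', s', d; split=> //; exact: incl_trans r'r rq.
Qed.

Variable N : set V.
Notation frc := (forces Q rev_incl N).

Lemma forces_mono p q e phi : frc p e phi -> rev_incl q p -> frc q e phi.
Proof.
elim: phi e => [i j|i j|phi IH|phi IH psi IH'|phi IH] e /= h qp.
- exact: fmem_mono h qp.
- exact: feq_mono h qp.
- by move=> r Qr rq; apply: h => //; exact: incl_trans rq qp.
- by case: h => h1 h2; split; [exact: IH|exact: IH'].
- by move=> r Qr rq; apply: h => //; exact: incl_trans rq qp.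
Qed.

Lemma forces_dens p e phi :
  (forall q, Q q -> rev_incl q p -> exists r, [/\ Q r, rev_incl r q & frc r e phi]) ->
  frc p e phi.
Proof.
elim: phi e p => [i j|i j|phi IH|phi IH psi IH'|phi IH] e p /= h.
- apply/forces_memP => q Qq qp; have [r [Qr rq /forces_memP h']] := h _ Qq qp.
  have [r' [s [c [? r'r ? ? ?]]]] := h' _ Qr (incl_refl _).
  by exists r', s, c; split=> //; exact: incl_trans r'r rq.
- exact: feq_dens.
- move=> q Qq qp hq; have [r [Qr rq hr]] := h _ Qq qp.
  by apply: (hr r) => //; exact: forces_mono hq rq.
- split; [apply: IH|apply: IH'] => q Qq qp;
  by have [r [Qr rq [h1 h2]]] := h _ Qq qp; exists r.
- move=> q Qq qp; have [r [Qr rq hr]] := h _ Qq qp.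
  have [r' [Qr' r'r h']] := hr _ Qr (incl_refl _).
  by exists r'; split=> //; exact: incl_trans r'r rq.
Qed.

Lemma forces_cong p e e' phi : (forall n, n < free_bound phi -> feq p (e n) (e' n)) ->
  frc p e phi -> frc p e' phi.
Proof.
elim: phi e e' p => [i j|i j|phi IH|phi IH psi IH'|phi IH] e e' p /= E.
- move=> h; apply: (fmem_cong h); apply: E; rewrite leq_max ltnSn ?orbT //.
- move=> h; apply: feq_trans (E j _); last by rewrite leq_max ltnSn orbT.
  by apply: feq_trans h; apply/feq_sym/E; rewrite leq_max ltnSn.
- move=> h q Qq qp hq; apply: (h _ Qq qp); apply: IH hq => n hn.
  by apply/feq_sym/(feq_mono _ qp)/E.
- case=> h1 h2; split.
    by apply: IH h1 => n hn; apply: E; rewrite leq_max hn.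
  by apply: IH' h2 => n hn; apply: E; rewrite leq_max hn orbT.
- move=> h q Qq qp; have [r [Qr rq [t [Nt nt ht]]]] := h _ Qq qp.
  exists r; split=> //; exists t; split=> //; apply: IH ht => -[|n] hn /=.
    exact: feq_refl.
  apply: (feq_mono (p := p)); last exact: incl_trans rq qp.
  by apply: E; rewrite -ltnS (leq_trans hn) // leqSpred.
Qed.

End Forcing.

(** * Definability of Cohen forcing over the ground model *)

Notation feqM := (forces_eq Fn rev_incl).
Notation fmemM := (forces_mem Fn rev_incl).

Section Ctm.
Context {C : ctm}.

(** A half of the clause for equality, with a set R of triples in place of [forces_eq]. The variant
    [closed_bwd] handles the reverse inclusion but looks up triples in the same order of names, so
    that the induction in [feq_closedP] always descends along a. *)
Definition closed_fwd (R p a b : V) : Prop :=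
  forall q, q ∈ FnV -> rev_incl q p -> forall s c, opair s c ∈ a -> rev_incl q s ->
    exists r, r ∈ FnV /\ (rev_incl r q /\ exists s' d, opair s' d ∈ b /\
      (rev_incl r s' /\ opair r (opair c d) ∈ R)).

Definition closed_bwd (R p a b : V) : Prop :=
  forall q, q ∈ FnV -> rev_incl q p -> forall s c, opair s c ∈ a -> rev_incl q s ->
    exists r, r ∈ FnV /\ (rev_incl r q /\ exists s' d, opair s' d ∈ b /\
      (rev_incl r s' /\ opair r (opair d c) ∈ R)).

Lemma D_closed_fwd t u v w : dterm t -> dterm u -> dterm v -> dterm w -> definable (fun e =>
  closed_fwd (t e) (u e) (v e) (w e)).
Proof. by apply: D_app4; rewrite /closed_fwd; dfn. Qed.

Lemma D_closed_bwd t u v w : dterm t -> dterm u -> dterm v -> dterm w -> definable (fun e =>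
  closed_bwd (t e) (u e) (v e) (w e)).
Proof. by apply: D_app4; rewrite /closed_bwd; dfn. Qed.
#[local] Hint Resolve D_closed_fwd D_closed_bwd : dfn.

(** R justifies each of its triples by triples of R. As names are well founded, all triples of such
    a set are correct, and equality is forced iff some set of this kind in M says so. *)
Definition feq_closed (R : V) : Prop :=
  forall w, w ∈ R -> exists p x, w = opair p x /\ exists a b, x = opair a b /\
    (closed_fwd R p a b /\ closed_bwd R p b a).

Lemma D_feq_closed t : dterm t -> definable (fun e => feq_closed (t e)).
Proof. by apply: D_app1; rewrite /feq_closed; dfn. Qed.
#[local] Hint Resolve D_feq_closed : dfn.

Lemma feq_closedP R p a b : feq_closed R -> opair p (opair a b) ∈ R -> feqM p a b.
Proof.
move=> cR; elim/tmem_ind: a b p => a IH b p pR.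
have [p' [x [/pair_inj[Ep Ex] [a' [b' [Eab [h1 h2]]]]]]] := cR _ pR.
rewrite -{}Ex in Eab; case/pair_inj: Eab => Ea Eb.
rewrite -{}Ep -{}Ea -{}Eb in h1 h2.
apply/feq_forced_sub; split=> q s c Qq qp sc qs.
  have [r [/in_FnV Fr [rq [s' [d [s'd [rs' rR]]]]]]] :=
    h1 _ ((in_FnV _).2 Qq) qp _ _ sc qs.
  by exists r, s', d; split=> //; exact: IH (tmem_snd sc) _ _ rR.
have [r [/in_FnV Fr [rq [s' [d [s'd [rs' rR]]]]]]] :=
  h2 _ ((in_FnV _).2 Qq) qp _ _ sc qs.
by exists r, s', d; split=> //; apply: feq_sym; exact: IH (tmem_snd s'd) _ _ rR.
Qed.

(** Closed sets for all correct triples of a condition, a subname of a and a subname of b are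
    collected and united, and the new triple is added. *)
Lemma feq_closed_ex p a b : gM p -> gM a -> gM b -> feqM p a b ->
  exists R, [/\ gM R, feq_closed R & opair p (opair a b) ∈ R].
Proof.
move=> + Ma; elim/tmem_ind: a Ma p b => a IH Ma p b Mp Mb pab.
have [||B [MB hB]] := M_collect (a := prodV FnV (prodV (unionV (unionV a)) (unionV (unionV b))))
  (R := fun w R => feq_closed R /\ w ∈ R).
- by typeclasses eauto with dfn.
- by dfn.
pose (R0 := unionV (sepV B feq_closed)).
have MR0 : gM R0 by apply/M_union/M_sep => //; dfn.
have hR0 w : w ∈ R0 <-> exists R, [/\ R ∈ B, feq_closed R & w ∈ R].
  rewrite in_unionV; split=> [[R [/in_sepV[]]]|[R [? ? ?]]]; exists R => //.
  by split=> //; apply/in_sepV.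
pose (R1 := cupV R0 (upair (opair p (opair a b)) (opair p (opair a b)))).
have M1 : gM R1 by typeclasses eauto with dfn.
have inUU x s c : opair s c ∈ x -> c ∈ unionV (unionV x).
  move=> sx; apply/in_unionV; exists (upair s c); split; last by apply/in_upair; right.
  by apply/in_unionV; exists (opair s c); split=> //; apply/in_upair; right.
have key r s c s' d : Fn r -> opair s c ∈ a -> opair s' d ∈ b -> feqM r c d ->
    opair r (opair c d) ∈ R0.
  move=> Fr sc s'd E.
  have Fr' : r ∈ FnV by apply/in_FnV.
  have Mr := M_trans Fr' M_FnV.
  have [R [MR cR rR]] := IH _ (tmem_snd sc) (M_snd sc Ma) r d Mr (M_snd s'd Mb) E.
  have [|R' [R'B [cR' rR']]] := hB (opair r (opair c d)) _ (ex_intro _ R (conj MR (conj cR rR))).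
    by do 2!(apply/pair_in_prodV; split=> //); [exact: inUU sc|exact: inUU s'd].
  by apply/hR0; exists R'.
exists R1; split=> //; last by apply/in_cupV; right; apply/in_upair; left.
have R01 w : w ∈ R0 -> w ∈ R1 by move=> ?; apply/in_cupV; left.
move=> w /in_cupV[/hR0[R [RB cR wR]]|Ew].
  have [p' [x [-> [a' [b' [-> [h1 h2]]]]]]] := cR _ wR.
  have RR1 z : z ∈ R -> z ∈ R1 by move=> zR; apply/R01/hR0; exists R.
  exists p', (opair a' b'); split=> //; exists a', b'; split=> //; split.
    move=> q Fq qp s c sc qs; have [r [? [? [s' [d [? [? ?]]]]]]] := h1 _ Fq qp _ _ sc qs.
    by exists r; split=> //; split=> //; exists s', d; split=> //; split=> //; exact: RR1.
  move=> q Fq qp s c sc qs; have [r [? [? [s' [d [? [? ?]]]]]]] := h2 _ Fq qp _ _ sc qs.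
  by exists r; split=> //; split=> //; exists s', d; split=> //; split=> //; exact: RR1.
have -> : w = opair p (opair a b) by case/in_upair: Ew.
exists p, (opair a b); split=> //; exists a, b; split=> //.
move/feq_forced_sub: pab => [h1 h2]; split=> q /in_FnV Fq qp s c sc qs.
  have [r [s' [d [Fr rq s'd rs' E]]]] := h1 _ _ _ Fq qp sc qs.
  exists r; split; first exact/in_FnV; split=> //; exists s', d; do 2!split=> //.
  by apply: R01; exact: (key _ _ _ _ _ Fr sc s'd E).
have [r [s' [d [Fr rq s'd rs' E]]]] := h2 _ _ _ Fq qp sc qs.
exists r; split; first exact/in_FnV; split=> //; exists s', d; do 2!split=> //.
by apply: R01; exact: (key _ _ _ _ _ Fr s'd sc (feq_sym E)).
Qed.

Lemma D_feqM t u v : dterm t -> dterm u -> dterm v -> definable (fun e => feqM (t e) (u e) (v e)).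
Proof.
apply: D_app3.
have H : definable (fun e => exists R, gM R /\ (feq_closed R /\
  opair (e 0) (opair (e 1) (e 2)) ∈ R)) by dfn.
apply: (D_ext H) => e Me; split=> [[R [_ []]]|]; first exact: feq_closedP.
by move=> /feq_closed_ex[|||R [? ? ?]] //; exists R.
Qed.
#[local] Hint Resolve D_feqM : dfn.

Lemma D_fmemM t u v : dterm t -> dterm u -> dterm v -> definable (fun e => fmemM (t e) (u e) (v
  e)).
Proof.
apply: D_app3.
have H : definable (fun e => forall q, q ∈ FnV -> rev_incl q (e 0) -> exists r, r ∈ FnV /\
  (rev_incl r q /\ exists s c, opair s c ∈ e 2 /\ (rev_incl r s /\ feqM r (e 1) c))) by dfn.
apply: (D_ext H) => e Me; rewrite forces_memP; split=> h q Fq qp.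
  have [r [/in_FnV Fr [rq [s [c [sc [rs E]]]]]]] := h _ ((in_FnV q).2 Fq) qp.
  by exists r, s, c.
have [r [s [c [Fr rq sc rs E]]]] := h _ ((in_FnV q).1 Fq) qp.
exists r; split; first exact/in_FnV.
by split=> //; exists s, c.
Qed.
#[local] Hint Resolve D_fmemM : dfn.

(** Such a p forces that x is not included in y. In both directions, and together with the
    conditions that force equality, these conditions are dense by [feqM_unmatched]. *)
Definition unmatched (x y p : V) : Prop := exists s c, opair s c ∈ x /\ (rev_incl p s /\
  forall r, r ∈ FnV -> rev_incl r p -> forall s' d, opair s' d ∈ y -> rev_incl r s' ->
    ~ feqM r c d).

Lemma D_unmatched t u v : dterm t -> dterm u -> dterm v ->
  definable (fun e => unmatched (t e) (u e) (v e)).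
Proof. by apply: D_app3; rewrite /unmatched; dfn. Qed.

Lemma feqM_unmatched p a b : Fn p ->
  (forall q, Fn q -> rev_incl q p -> ~ unmatched a b q /\ ~ unmatched b a q) -> feqM p a b.
Proof.
move=> Fp.
have key x y : (forall q, Fn q -> rev_incl q p -> ~ unmatched x y q) ->
    forced_sub Fn feqM p x y.
  move=> nu q s c Fq qp sc qs; apply: contrapT => H; apply: (nu q Fq qp).
  exists s, c; split=> //; split=> // r /in_FnV Fr rq s' d s'd rs' E.
  by apply: H; exists r, s', d.
by move=> h; apply/feq_forced_sub; split; apply: key => q Fq qp; have [] := h q Fq qp.
Qed.

(* Names are not required to satisfy [is_name]: the atomic clauses only look at
   the pairs whose first component lies in Fn. *)
Fixpoint forcesM (p : V) (e : nat -> V) (phi : form) : Prop :=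
  match phi with
  | fMem i j => fmemM p (e i) (e j)
  | fEq i j => feqM p (e i) (e j)
  | fNot phi => forall q, q ∈ FnV -> rev_incl q p -> ~ forcesM q e phi
  | fAnd phi psi => forcesM p e phi /\ forcesM p e psi
  | fEx phi => forall q, q ∈ FnV -> rev_incl q p -> exists r, r ∈ FnV /\
      (rev_incl r q /\ exists t, gM t /\ forcesM r (scons t e) phi)
  end.

Lemma D_forcesM phi t (u : nat -> (nat -> V) -> V) : dterm t -> (forall n, dterm (u n)) ->
  definable (fun e => forcesM (t e) (fun n => u n e) phi).
Proof.
elim: phi t u => [i j|i j|phi IH|phi IH psi IH'|phi IH] t u Tt Tu /=.
- exact: D_fmemM.
- exact: D_feqM.
- have Tu' n : dterm (fun e => u n (fun n => e n.+1)) by exact: T_shift.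
  have := IH _ _ (T_var 0) Tu' => H.
  apply: D_allin; first exact: T_const M_FnV.
  by apply: D_imp; [exact: D_rev_incl (T_var 0) (T_shift Tt)|exact: D_not].
- by apply: D_and; [exact: IH|exact: IH'].
(* The three bound variables q, r and t separate the outer environment from the inner formula, whose
   new variable 0 is t. *)
- pose (u' n (e : nat -> V) := if n is m.+1 then u m (fun n => e n.+3) else e 0).
  have Tu' n : dterm (u' n).
    case: n => [|n]; first exact: T_var.
    exact: (T_shift (T_shift (T_shift (Tu n)))).
  apply: D_allin; first exact: T_const M_FnV.
  apply: D_imp; first exact: D_rev_incl (T_var 0) (T_shift Tt).
  apply: D_exin; first exact: T_const M_FnV.
  apply: D_and; first exact: D_rev_incl (T_var 0) (T_var 1).
  apply: D_exM; apply: (D_ext (IH _ _ (T_var 1) Tu')) => e _.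
  have -> // : (fun n => u' n e) = scons (e 0) (fun n => u n (fun n0 => e n0.+3)).
  by apply/funext => -[].
Qed.

Lemma forcesM_mono p q e phi : forcesM p e phi -> rev_incl q p -> forcesM q e phi.
Proof.
elim: phi e => [i j|i j|phi IH|phi IH psi IH'|phi IH] e /= h qp.
- exact: fmem_mono h qp.
- exact: feq_mono h qp.
- by move=> r Qr rq; apply: h => //; exact: incl_trans rq qp.
- by case: h => h1 h2; split; [exact: IH|exact: IH'].
- by move=> r Qr rq; apply: h => //; exact: incl_trans rq qp.
Qed.

End Ctm.

#[export] Hint Resolve D_feqM D_fmemM D_unmatched : dfn.

(** * Finite conditions *)

Lemma finite_cup x y :
  finite_set (elts x) -> finite_set (elts y) -> finite_set (elts (cupV x y)).
Proof.
move=> fx fy; apply: (@sub_finite_set _ _ (elts x `|` elts y)).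
  by move=> z /in_cupV.
by rewrite finite_setU.
Qed.

Lemma finite_upair x y : finite_set (elts (upair x y)).
Proof.
apply: (@sub_finite_set _ _ ([set x] `|` [set y])); first by move=> z /in_upair.
by rewrite finite_setU; split; exact: finite_set1.
Qed.

Lemma finite_img x P h : finite_set (elts x) -> finite_set (elts (imgV x P h)).
Proof.
move=> fx; apply: (@sub_finite_set _ _ (h @` elts x)); last exact: finite_image.
by move=> z /in_imgV[a [ax _ ->]]; exists a.
Qed.

Lemma finite_bound (A : set V) (P : V -> nat -> Prop) : finite_set A ->
  (forall z n m, P z n -> P z m -> n = m) ->
  exists L, forall z n, A z -> P z n -> n < L.
Proof.
move=> /finite_seqP[s ->] Pf; elim: s => [|a s [L hL]]; first by exists 0 => z n; rewrite /= inE.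
have [[n an]|na] := pselect (exists n, P a n).
  exists (maxn L n.+1) => z m; rewrite /= inE => /orP[/eqP->|zs] zm; rewrite leq_max.
    by rewrite (Pf _ _ _ zm an) ltnSn orbT.
  by rewrite (hL z).
exists L => z m; rewrite /= inE => /orP[/eqP->|zs] zm; last exact: hL zm.
by case: na; exists m.
Qed.

Lemma Fn_bound p : Fn p -> exists L, forall n k v, bit n k v ∈ p -> n < L /\ k < L.
Proof.
move=> [fp _ _].
have [|L1 h1] := finite_bound (P := fun z n => exists k v, z = bit n k v) fp.
  by move=> z n m [k [v ->]] [k' [v' /bit_inj[]]].
have [|L2 h2] := finite_bound (P := fun z k => exists n v, z = bit n k v) fp.
  by move=> z n m [k [v ->]] [k' [v' /bit_inj[]]].
exists (maxn L1 L2) => n k v np; rewrite !leq_max.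
have -> : n < L1 by apply: (h1 _ _ np); exists k, v.
have -> : k < L2 by apply: (h2 _ _ np); exists n, v.
by rewrite orbT.
Qed.

Lemma Fn0 : Fn (num 0).
Proof.
split=> [|z /in_num0//|n k b c /in_num0//].
by apply: (@sub_finite_set _ _ set0) => // z /in_num0.
Qed.

Lemma Fn_sub p q : Fn p -> rev_incl p q -> Fn q.
Proof.
move=> [fp p1 p2] pq; split=> [|z /pq/p1//|n k b c /pq nb /pq nc].
  exact: sub_finite_set pq fp.
exact: p2 nb nc.
Qed.

Lemma Fn_cup p q : Fn p -> Fn q ->
  (forall n k b c, bit n k b ∈ p -> bit n k c ∈ q -> b = c) -> Fn (cupV p q).
Proof.
move=> [fp p1 p2] [fq q1 q2] h; split; first exact: finite_cup.
  by move=> z /in_cupV[/p1|/q1].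
move=> n k b c /in_cupV[nb|nb] /in_cupV[nc|nc];
  [exact: p2 nb nc|exact: h nb nc| |exact: q2 nb nc].
exact/esym/(h _ _ _ _ nc nb).
Qed.

Lemma Fn_bit n k v : Fn (upair (bit n k v) (bit n k v)).
Proof.
split; first exact: finite_upair.
  by move=> z /in_upair[] ->; exists n, k, v.
by move=> n' k' b c /in_upair[]/bit_inj[_ _ ->] /in_upair[]/bit_inj[_ _ ->].
Qed.

Lemma Fn_incl p q : Fn p -> (forall n k v, bit n k v ∈ p -> bit n k v ∈ q) -> rev_incl q p.
Proof. by move=> [_ p1 _] h z zp; have [n [k [v E]]] := p1 _ zp; rewrite E in zp *; exact: h. Qed.

(** Renames and restricts at once: columns of p outside the range of rho are dropped, which [decide]
    uses to keep only what a condition says about the listed reals. *)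
Lemma Fn_map (rho : nat -> nat -> Prop) p : Fn p ->
  (forall i j j', rho i j -> rho i j' -> j = j') ->
  (forall i i' j, rho i j -> rho i' j -> i = i') ->
  exists q, Fn q /\ forall n k v, bit n k v ∈ q <-> exists n', rho n n' /\ bit n' k v ∈ p.
Proof.
move=> [fp p1 p2] r1 r2.
pose (im z w := exists n k v n', [/\ z = bit n' k v, rho n n' & w = bit n k v]).
have imf z w w' : im z w -> im z w' -> w = w'.
  move=> [n [k [v [n' [-> nn' ->]]]]] [m [k' [v' [m' [/bit_inj[E <- <-] mm' ->]]]]].
  by rewrite -E in mm'; rewrite (r2 _ _ _ nn' mm').
pose (q := imgV p (fun z => exists w, im z w) (fun z => xget z (im z))).
have hq w : w ∈ q <-> exists z, z ∈ p /\ im z w.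
  rewrite in_imgV; split=> [[z [zp [w' zw'] ->]]|[z [zp zw]]].
    by exists z; split=> //; apply: xgetPex; exists w'.
  exists z; split=> //; first by exists w.
  exact: (imf _ _ _ zw (@xgetPex _ z (im z) (ex_intro _ w zw))).
have hb n k v : bit n k v ∈ q <-> exists n', rho n n' /\ bit n' k v ∈ p.
  rewrite hq; split=> [[z [zp [m [k' [v' [n' [Ez mn' /bit_inj[En Ek Ev]]]]]]]]|[n' [nn' np]]].
    by exists n'; rewrite En Ek Ev -Ez.
  by exists (bit n' k v); split=> //; exists n, k, v, n'.
exists q; split=> //; split; first exact: finite_img.
  by move=> w /hq[z [_ [n [k [v [n' [_ _ ->]]]]]]]; exists n, k, v.
move=> n k b c /hb[n' [nn' bp]] /hb[n'' [nn'' cp]].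
by rewrite (r1 _ _ _ nn'' nn') in cp; exact: p2 bp cp.
Qed.

Lemma PInj_bound b : PInj b -> exists L, forall i j, pr b i j -> i < L /\ j < L.
Proof.
move=> [fb _ _ _].
have [|L1 h1] := finite_bound (P := fun z i => exists j, z = opair (num i) (num j)) fb.
  by move=> z n m [k ->] [k' /pair_inj[/num_inj]].
have [|L2 h2] := finite_bound (P := fun z j => exists i, z = opair (num i) (num j)) fb.
  by move=> z n m [k ->] [k' /pair_inj[_ /num_inj]].
exists (maxn L1 L2) => i j ij; rewrite !leq_max.
have -> : i < L1 by apply: (h1 _ _ ij); exists j.
have -> : j < L2 by apply: (h2 _ _ ij); exists i.
by rewrite orbT.
Qed.

Lemma PInj_incl b b' : PInj b -> (forall i j, pr b i j -> pr b' i j) -> rev_incl b' b.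
Proof. by move=> [_ p1 _ _] h z zp; have [i [j E]] := p1 _ zp; rewrite E in zp *; exact: h. Qed.

Lemma PInj_inv b : PInj b -> exists b', PInj b' /\ forall i j, pr b' i j <-> pr b j i.
Proof.
move=> [fb b1 b2 b3].
pose (b' := imgV b (fun=> True) (fun z => opair (snd_V z) (fst_V z))).
have hb' i j : pr b' i j <-> pr b j i.
  rewrite in_imgV; split=> [[z [zb _ E]]|ji].
    have [i' [j' Ez]] := b1 _ zb; move: zb E; rewrite Ez fst_pair snd_pair => zb.
    by case/pair_inj => -> ->.
  by exists (opair (num j) (num i)); split=> //; rewrite fst_pair snd_pair.
exists b'; split=> //; split; first exact: finite_img.
- move=> z; rewrite /b' in_imgV => -[w [/b1[i [j ->]] _ ->]].
  by rewrite fst_pair snd_pair; exists j, i.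
- by move=> i j k /hb' ji /hb' ki; exact: b3 ji ki.
- by move=> i j k /hb' ki /hb' kj; exact: b2 ki kj.
Qed.

Lemma PInj_add b i j : PInj b -> (forall j', ~ pr b i j') -> (forall i', ~ pr b i' j) ->
  exists b', PInj b' /\ forall k l, pr b' k l <-> pr b k l \/ k = i /\ l = j.
Proof.
move=> [fb b1 b2 b3] ni nj.
pose (b' := cupV b (upair (opair (num i) (num j)) (opair (num i) (num j)))).
have hb' k l : pr b' k l <-> pr b k l \/ k = i /\ l = j.
  rewrite in_cupV in_upair; split=> [[|[]/pair_inj[/num_inj-> /num_inj->]]|[|[-> ->]]]; auto.
exists b'; split=> //; split.
- by apply: finite_cup => //; exact: finite_upair.
- by move=> z /in_cupV[/b1//|/in_upair[]->]; exists i, j.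
- move=> k l m /hb'[kl|[-> ->]] /hb'[km|[E ->]] //; first exact: b2 kl km.
    by rewrite E in kl; case: (ni _ kl).
  by case: (ni _ km).
- move=> k l m /hb'[kl|[-> ->]] /hb'[km|[-> E]] //; first exact: b3 kl km.
    by rewrite E in kl; case: (nj _ kl).
  by case: (nj _ km).
Qed.

(** New values are taken from L on, so that they can be columns about which a given condition says
    nothing. *)
Lemma ext_dom b m L : PInj b -> exists b', [/\ PInj b', rev_incl b' b,
  forall i, i < m -> exists j, pr b' i j &
  forall i j, pr b' i j -> pr b i j \/ L <= j].
Proof.
move=> Pb; elim: m => [|m [b' [Pb' b'b h1 h2]]].
  by exists b; split=> // i j; left.
have [[j mj]|nj] := pselect (exists j, pr b' m j).
  exists b'; split=> // i; rewrite ltnS leq_eqVlt => /orP[/eqP->|/h1//]; by exists j.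
have [K hK] := PInj_bound Pb'.
have [||b'' [Pb'' hb'']] := PInj_add (i := m) (j := maxn K L) Pb'.
- by move=> j mj; apply: nj; exists j.
- by move=> i /hK[_]; rewrite ltnNge leq_maxl.
exists b''; split=> //.
- by apply: (incl_trans _ b'b); apply: PInj_incl => // i j ij; apply/hb''; left.
- move=> i; rewrite ltnS leq_eqVlt => /orP[/eqP->|/h1[j ij]].
    by exists (maxn K L); apply/hb''; right.
  by exists j; apply/hb''; left.
- by move=> i j /hb''[/h2//|[_ ->]]; right; exact: leq_maxr.
Qed.

Lemma ext_ran b m : PInj b -> exists b', [/\ PInj b', rev_incl b' b &
  forall j, j < m -> exists i, pr b' i j].
Proof.
move=> Pb; have [c [Pc hc]] := PInj_inv Pb.
have [c' [Pc' c'c h _]] := ext_dom m 0 Pc.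
have [b' [Pb' hb']] := PInj_inv Pc'; exists b'; split=> // [|j /h[i ji]].
  by apply: PInj_incl => // i j /hc /c'c ?; apply/hb'.
by exists i; apply/hb'.
Qed.

(** * The generic filter *)

Class gen {C : ctm} := Gen { gG : set V; genP : generic gM Fn rev_incl gG }.

(** p' contains the image of p when position n is read as column b(n); in particular b is defined on
    all columns of p. Written without [bit] so that the numerals can be abstracted in [D_pushes]. *)
Definition pushes (b p p' : V) : Prop :=
  forall n k (v : bool), opair (opair (num n) (num k)) (num v) ∈ p ->
    exists n', pr b n n' /\ opair (opair (num n') (num k)) (num v) ∈ p'.

Lemma D_pushes {C : ctm} t u v : dterm t -> dterm u -> dterm v -> definable (fun e => pushes (t
  e) (u e) (v e)).
Proof.
apply: D_app3; rewrite /pushes.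
apply: (D_alln (P := fun n e => forall k (v : bool), opair (opair n (num k)) (num v) ∈ e 1 ->
  exists n', opair n (num n') ∈ e 0 /\ opair (opair (num n') (num k)) (num v) ∈ e 2)).
apply: (D_alln (P := fun k e => forall (v : bool), opair (opair (e 0) k) (num v) ∈ e 2 ->
  exists n', opair (e 0) (num n') ∈ e 1 /\ opair (opair (num n') k) (num v) ∈ e 3)).
apply: (D_allb (P := fun v e => opair (opair (e 1) (e 0)) v ∈ e 3 ->
  exists n', opair (e 1) (num n') ∈ e 2 /\ opair (opair (num n') (e 0)) v ∈ e 4)).
apply: D_imp; first by dfn.
apply: (D_exn (P := fun n' e =>
  opair (e 2) n' ∈ e 3 /\ opair (opair n' (e 1)) (e 0) ∈ e 5)); dfn.
Qed.
#[export] Hint Resolve D_pushes : dfn.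

Section Gen.
Context {C : ctm} {g : gen}.

Lemma G_Fn p : gG p -> Fn p.
Proof. by case: genP => h _ _ _ _ /h. Qed.

Lemma G_up p q : gG q -> Fn p -> rev_incl q p -> gG p.
Proof. by case: genP => _ _ h _ _; exact: h. Qed.

Lemma G_dir p q : gG p -> gG q -> exists r, [/\ gG r, rev_incl r p & rev_incl r q].
Proof. by case: genP => _ _ _ h _; exact: h. Qed.

Lemma G_meet (P : V -> Prop) : definable (fun e => P (e 0)) ->
  (forall p, Fn p -> exists q, [/\ Fn q, rev_incl q p & P q]) -> exists p, gG p /\ P p.
Proof.
move=> DP h; case: genP => _ _ _ _ /(_ (sepV FnV P)) [|||p [Gp /in_sepV[_ Pp]]].
- by apply: M_sep => //; exact: M_FnV.
- by move=> p /in_sepV[/in_FnV].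
- move=> p /h[q [Fq qp Pq]]; exists q; split=> //.
  by apply/in_sepV; split=> //; apply/in_FnV.
- by exists p.
Qed.

(** The conditions that satisfy P or are incompatible with q are dense, and G contains none of the
    second kind. *)
Lemma G_below (P : V -> Prop) q : gG q -> definable (fun e => P (e 0)) ->
  (forall p, Fn p -> rev_incl p q -> exists r, [/\ Fn r, rev_incl r p & P r]) ->
  exists p, gG p /\ P p.
Proof.
move=> Gq DP h; have Mq : gM q by apply: M_trans M_FnV; apply/in_FnV/G_Fn.
have DP' t : dterm t -> definable (fun e => P (t e)) by exact: D_app1.
have [||p [Gp [//|np]]] := G_meet (P := fun p => P p \/
   ~ exists r, r ∈ FnV /\ (rev_incl r p /\ rev_incl r q)).
- by typeclasses eauto with dfn.
- move=> p Fp.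
  have [[r [/in_FnV Fr [rp rq]]]|n] :=
    pselect (exists r, r ∈ FnV /\ (rev_incl r p /\ rev_incl r q)).
    have [r' [Fr' r'r Pr]] := h _ Fr rq.
    by exists r'; split=> //; [exact: incl_trans r'r rp|left].
  by exists p; split=> //; right.
- by exists p.
- have [r [Gr rp rq]] := G_dir Gp Gq; case: np; exists r; split=> //.
  by apply/in_FnV/G_Fn.
Qed.

Lemma G0 : gG (num 0).
Proof.
case: genP => _ [p Gp] _ _ _; apply: G_up Gp Fn0 _.
by move=> z /in_num0.
Qed.

Notation val := (name_val gG).

Lemma in_val t z : z ∈ val t <-> exists p s, [/\ opair p s ∈ t, gG p & z = val s].
Proof. exact: in_name_rec. Qed.

Lemma val_eq_of p a b : gM a -> gM b -> gG p -> feqM p a b -> val a = val b.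
Proof.
move=> Ma; elim/tmem_ind: a Ma p b => a IH Ma p b Mb Gp /feq_forced_sub[h1 h2].
apply: V_ext => z; rewrite !in_val; split=> -[s [c [sc Gs ->]]].
  have [q [Gq qp qs]] := G_dir Gp Gs.
  have Mc := M_snd sc Ma.
  have [||r [Gr [s' [d [s'd [rs' E]]]]]] := G_below (P := fun r => exists s' d,
     opair s' d ∈ b /\ (rev_incl r s' /\ feqM r c d)) Gq.
  - by typeclasses eauto with dfn.
  - move=> r Fr rq; have [r' [s' [d [? ? ? ? ?]]]] :=
      h1 _ _ _ Fr (incl_trans rq qp) sc (incl_trans rq qs).
    by exists r'; split=> //; exists s', d.
  exists s', d; split=> //; last exact: IH (tmem_snd sc) Mc _ _ (M_snd s'd Mb) Gr E.
  exact: G_up Gr (Fn_sub (G_Fn Gr) rs') rs'.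
have [q [Gq qp qs]] := G_dir Gp Gs.
have Mc := M_snd sc Mb.
have [||r [Gr [s' [d [s'd [rs' E]]]]]] := G_below (P := fun r => exists s' d,
   opair s' d ∈ a /\ (rev_incl r s' /\ feqM r d c)) Gq.
- by typeclasses eauto with dfn.
- move=> r Fr rq; have [r' [s' [d [? ? ? ? E]]]] :=
    h2 _ _ _ Fr (incl_trans rq qp) sc (incl_trans rq qs).
  by exists r'; split=> //; exists s', d; split=> //; split=> //; exact: feq_sym.
exists s', d; split=> //; last first.
  by rewrite (IH _ (tmem_snd s'd) (M_snd s'd Ma) _ _ Mc Gr E).
exact: G_up Gr (Fn_sub (G_Fn Gr) rs') rs'.
Qed.

(** Some p in G forces equality or leaves a subname unmatched. In the second case equal values would
    give a match of subnames, which by induction is forced by a condition in G, a contradiction. *)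
Lemma val_eq_forced a b : gM a -> gM b -> val a = val b -> exists p, gG p /\ feqM p a b.
Proof.
move=> Ma; elim/tmem_ind: a Ma b => a IH Ma b Mb E.
have [||p [Gp [h|[]]]] := G_meet (P := fun p => feqM p a b \/
  (unmatched a b p \/ unmatched b a p)).
- by dfn.
- move=> p Fp; apply: contrapT => H; apply: (H); exists p; split=> //; left.
  apply: feqM_unmatched => // q Fq qp.
  by split=> u; apply: H; exists q; split=> //; right; [left|right].
- by exists p.
- move=> [s [c [sc [ps H]]]].
  have Gs : gG s by exact: G_up Gp (Fn_sub (G_Fn Gp) ps) ps.
  have : val c ∈ val a by apply/in_val; exists s, c.
  rewrite E => /in_val[s' [d [s'd Gs' Ecd]]].
  have [q [Gq cd]] := IH _ (tmem_snd sc) (M_snd sc Ma) _ (M_snd s'd Mb) Ecd.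
  have [r [Gr rq rs']] := G_dir Gq Gs'; have [r' [Gr' r'r r'p]] := G_dir Gr Gp.
  case: (H r' _ r'p _ _ s'd (incl_trans r'r rs')); first exact/in_FnV/G_Fn.
  exact: feq_mono cd (incl_trans r'r rq).
- move=> [s [c [sc [ps H]]]].
  have Gs : gG s by exact: G_up Gp (Fn_sub (G_Fn Gp) ps) ps.
  have : val c ∈ val b by apply/in_val; exists s, c.
  rewrite -E => /in_val[s' [d [s'd Gs' Ecd]]].
  have [q [Gq cd]] := IH _ (tmem_snd s'd) (M_snd s'd Ma) _ (M_snd sc Mb) (esym Ecd).
  have [r [Gr rq rs']] := G_dir Gq Gs'; have [r' [Gr' r'r r'p]] := G_dir Gr Gp.
  case: (H r' _ r'p _ _ s'd (incl_trans r'r rs')); first exact/in_FnV/G_Fn.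
  exact: feq_mono (feq_sym cd) (incl_trans r'r rq).
Qed.

Lemma val_mem_of p a b : gM a -> gM b -> gG p -> fmemM p a b -> val a ∈ val b.
Proof.
move=> Ma Mb Gp /forces_memP h.
have [||r [Gr [s' [d [s'd [rs' E]]]]]] := G_below (P := fun r => exists s' d,
   opair s' d ∈ b /\ (rev_incl r s' /\ feqM r a d)) Gp.
- by typeclasses eauto with dfn.
- move=> r Fr rp; have [r' [s' [d [? ? ? ? ?]]]] := h _ Fr rp.
  by exists r'; split=> //; exists s', d.
apply/in_val; exists s', d; split=> //; last exact: val_eq_of Ma (M_snd s'd Mb) Gr E.
exact: G_up Gr (Fn_sub (G_Fn Gr) rs') rs'.
Qed.

Lemma val_mem_forced a b : gM a -> gM b -> val a ∈ val b -> exists p, gG p /\ fmemM p a b.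
Proof.
move=> Ma Mb /in_val[s [c [sc Gs E]]].
have [p [Gp h]] := val_eq_forced Ma (M_snd sc Mb) E.
have [r [Gr rp rs]] := G_dir Gp Gs; exists r; split=> //; apply/forces_memP => q Fq qr.
exists q, s, c; split=> //; first exact: incl_trans qr rs.
exact: feq_mono h (incl_trans qr rp).
Qed.

Notation xr := (cohen_real gG).

Lemma in_xr n z : z ∈ xr n <-> exists k, (exists p, gG p /\ bit n k true ∈ p) /\ z = num k.
Proof.
rewrite in_vset; split=> [[[k h] /= <-]|[k [h ->]]]; first by exists k.
by exists (exist _ k h).
Qed.

Definition true_bit n k (v : bool) : Prop := num k ∈ xr n <-> v.

Lemma true_bit_uniq n k v v' : true_bit n k v -> true_bit n k v' -> v = v'.
Proof. by move=> [h1 h2] [h3 h4]; apply/idP/idP => [/h2/h3|/h4/h1].  Qed.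

Lemma G_true_bit p n k v : gG p -> bit n k v ∈ p -> true_bit n k v.
Proof.
move=> Gp np; split=> [/in_xr[k' [[q [Gq nq]] /num_inj E]]|v1]; last first.
  by apply/in_xr; exists k; split=> //; exists p; split=> //; rewrite v1 in np.
rewrite -E in nq; have [r [Gr rp rq]] := G_dir Gp Gq.
by have [_ _ h] := G_Fn Gr; rewrite (h _ _ _ _ (rp _ np) (rq _ nq)).
Qed.

Lemma Fn_M p : Fn p -> gM p.
Proof. by move=> /in_FnV h; exact: M_trans h M_FnV. Qed.

(** G is determined by its reals: some q in G decides every bit that p mentions, and what q decides
    is true, so q contains p. *)
Lemma G_true p : Fn p -> (forall n k v, bit n k v ∈ p -> true_bit n k v) -> gG p.
Proof.
move=> Fp hp; have Mp := Fn_M Fp.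
have [||q [Gq h]] := G_meet (P := fun q => forall u v, opair u v ∈ p ->
   exists u' v', opair u' v' ∈ q /\ u' = u).
- by dfn.
- move=> q Fq; have [_ p1 p2] := Fp.
  (* The part of p at the places where q is undefined. *)
  pose (q' := sepV p (fun z => forall n k v v', z = bit n k v -> ~ bit n k v' ∈ q)).
  have hq' n k v : bit n k v ∈ q' -> bit n k v ∈ p /\ forall v', ~ bit n k v' ∈ q.
    by move=> /in_sepV[? H]; split=> // v'; exact: (H _ _ _ v' erefl).
  exists (cupV q q'); split.
  + apply: Fn_cup => //; first by apply: Fn_sub Fp _ => z /in_sepV[].
    by move=> n k b c nb /hq'[_ /(_ b)].
  + by move=> z zq; apply/in_cupV; left.
  move=> u v uv; have [n [k [v0 E]]] := p1 _ uv; have [Eu Ev] := pair_inj E.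
  have [[v' nv']|nv] := pselect (exists v', bit n k v' ∈ q).
    by exists u, (num v'); split=> //; apply/in_cupV; left; rewrite Eu.
  exists u, v; split=> //; apply/in_cupV; right; apply/in_sepV; split=> //.
  move=> n1 k1 v1 v' E1 h; apply: nv; exists v'.
  by have [-> -> _] := bit_inj (etrans (esym E) E1).
apply: (G_up Gq Fp); apply: Fn_incl => // n k v np.
have [u' [v' [uq E]]] := h _ _ np; rewrite {}E in uq.
have [_ q1 _] := G_Fn Gq; have [n1 [k1 [v1 /pair_inj[_ E]]]] := q1 _ uq.
rewrite {}E in uq; by rewrite (true_bit_uniq (hp _ _ _ np) (G_true_bit Gq uq)).
Qed.

Lemma xr_inj : injective xr.
Proof.
move=> n m E; apply: contrapT => nm.
have [||q [Gq [_ [/in_omega[k ->] [h1 h2]]]]] := G_meet (P := fun q => exists k, k ∈ omega /\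
  (opair (opair (num n) k) (num 1) ∈ q /\ opair (opair (num m) k) (num 0) ∈ q)).
- by dfn.
- move=> p Fp; have [L hL] := Fn_bound Fp.
  (* Row L lies above everything p mentions, so the two columns can be made to differ there. *)
  pose (q := cupV (upair (bit n L true) (bit n L true)) (upair (bit m L false) (bit m L false))).
  exists (cupV p q); split.
  + apply: Fn_cup => //.
      apply: Fn_cup; [exact: Fn_bit|exact: Fn_bit|].
      by move=> n' k b c /in_upair[]/bit_inj[-> _ _] /in_upair[]/bit_inj[/nm].
    move=> n' k b c /hL[_ kL] /in_cupV[] /in_upair[] /bit_inj[_ Ek _];
      by rewrite Ek ltnn in kL.
  + by move=> z zp; apply/in_cupV; left.
  exists (num L); split; first by apply/in_omega; exists L.
  split; apply/in_cupV; right; apply/in_cupV; [left|right]; apply/in_upair; by left.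
have [t1 t2] := (G_true_bit (v := true) Gq h1, G_true_bit (v := false) Gq h2).
by rewrite /true_bit E in t1; have := true_bit_uniq t1 t2.
Qed.

(* p is true of the sequence of reals that lists x_j at position i for each
   pair (i, j) in b. *)
Definition hold (p b : V) : Prop :=
  forall n k v, bit n k v ∈ p -> exists n', pr b n n' /\ true_bit n' k v.

(** Expresses truth along b by a condition in G and a definable relation, which opens it to density
    arguments in M. *)
Lemma hold_pushes p b : Fn p -> PInj b -> hold p b <-> exists p', gG p' /\ pushes b p p'.
Proof.
move=> Fp [_ _ b2 b3]; split=> [h|[p' [Gp' h]] n k v np]; last first.
  by have [n' [? ?]] := h _ _ _ np; exists n'; split=> //; exact: G_true_bit Gp' _.
have [||p' [Fp' hp']] := @Fn_map (fun n' n => pr b n n') p Fp.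
- by move=> i j j' h1 h2; exact: b3 h1 h2.
- by move=> i i' j h1 h2; exact: b2 h1 h2.
exists p'; split=> [|n k v np].
  apply: G_true => // n k v /hp'[n' [n'n np]].
  by have [n1 [n'n1 t1]] := h _ _ _ np; rewrite (b2 _ _ _ n'n n'n1).
have [n' [nn' _]] := h _ _ _ np; exists n'; split=> //.
by apply/hp'; exists n.
Qed.

Lemma hold_ext p b b' : hold p b -> rev_incl b' b -> hold p b'.
Proof. by move=> h bb' n k v /h[n' [/bb' ? ?]]; exists n'. Qed.

Lemma hold_sub p q b : hold p b -> rev_incl p q -> hold q b.
Proof. by move=> h pq n k v /pq/h. Qed.

(** Both conditions describe the same actual reals, so they agree wherever both are defined. *)
Lemma hold_cup p q b : PInj b -> Fn p -> Fn q -> hold p b -> hold q b ->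
  Fn (cupV p q) /\ hold (cupV p q) b.
Proof.
move=> [_ _ b2 _] Fp Fq hp hq; split; last by move=> n k v /in_cupV[/hp|/hq].
apply: Fn_cup => // n k v v' /hp[i [ni ti]] /hq[j [nj tj]].
by rewrite (b2 _ _ _ ni nj) in ti; exact: true_bit_uniq ti tj.
Qed.

Lemma M_PInj b : PInj b -> gM b.
Proof. by move=> /in_PInjV h; exact: M_trans h M_PInjV. Qed.

(* Genericity of the reals listed by b, over the poset of conditions on the
   columns in the domain of b and its extensions. *)
Lemma decide (P : V -> Prop) b : definable (fun e => P (e 0)) -> PInj b ->
  (exists p, [/\ Fn p, hold p b & forall q, Fn q -> P q -> ~ rev_incl q p]) \/
  (exists b' p, [/\ PInj b', rev_incl b' b, Fn p, P p & hold p b']).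
Proof.
move=> DP Pb; have Mb := M_PInj Pb.
have DP' t : dterm t -> definable (fun e => P (t e)) by exact: D_app1.
have [||r [Gr [[p [/in_FnV Fp [m h]]]|[b' [/in_PInjV Pb' [bb' [p [/in_FnV Fp [Pp m]]]]]]]]] :=
  G_meet (P := fun r =>
  (exists p, p ∈ FnV /\ (pushes b p r /\ forall q, q ∈ FnV -> P q -> ~ rev_incl q p)) \/
  (exists b', b' ∈ PInjV /\ (rev_incl b' b /\ exists p, p ∈ FnV /\ (P p /\ pushes b' p r)))).
- by typeclasses eauto with dfn.
- move=> r Fr; have [_ _ b2 b3] := Pb.
  (* p is what r says about the reals listed by b, moved to their positions. *)
  have [||p [Fp hp]] := @Fn_map (fun n n' => pr b n n') r Fr.
  + by move=> i j j' h1 h2; exact: b2 h1 h2.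
  + by move=> i i' j h1 h2; exact: b3 h1 h2.
  have [[q [Fq Pq qp]]|nq] := pselect (exists q, [/\ Fn q, P q & rev_incl q p]); last first.
    exists r; split=> //; left; exists p; split; first exact/in_FnV.
    split; first by move=> n k v /hp.
    by move=> q /in_FnV Fq Pq qp; apply: nq; exists q.
  have [m hm] := Fn_bound Fq; have [L hL] := Fn_bound Fr.
  (* Every position used by q now has a column, either one listed by b or one from L on. The image
     r' of q under b' is compatible with r: on the old columns q extends p, which came from r, and r
     does not mention the new ones. *)
  have [b' [Pb' b'b d1 d2]] := ext_dom m L Pb.
  have [_ _ b2' b3'] := Pb'.
  have [||r' [Fr' hr']] := @Fn_map (fun n' n => pr b' n n') q Fq.
  + by move=> i j j' h1 h2; exact: b3' h1 h2.
  + by move=> i i' j h1 h2; exact: b2' h1 h2.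
  exists (cupV r r'); split.
  + apply: Fn_cup => // n k v v' nv /hr'[n' [n'n n'v']].
    have [n'n0|Ln] := d2 _ _ n'n.
      have /qp n'v : bit n' k v ∈ p by apply/hp; exists n.
      by have [_ _ q2] := Fq; exact: q2 n'v n'v'.
    by have [] := hL _ _ _ nv; rewrite ltnNge Ln.
  + by move=> z zr; apply/in_cupV; left.
  right; exists b'; split; first exact/in_PInjV.
  split=> //; exists q; split; first exact/in_FnV.
  split=> // n k v nq; have [nm _] := hm _ _ _ nq; have [n' nn'] := d1 _ nm.
  by exists n'; split=> //; apply/in_cupV; right; apply/hr'; exists n.
- left; exists p; split=> //; first by apply/hold_pushes => //; exists r.
  by move=> q /in_FnV Fq; exact: h.
- by right; exists b', p; split=> //; apply/hold_pushes => //; exists r.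
Qed.

End Gen.

(** * Permutations acting on names *)

Lemma swapK i j : cancel (swap i j) (swap i j).
Proof.
move=> k; rewrite /swap; case: (eqVneq k i) => [->|ki].
  by case: (eqVneq j i) => [->|_] //; rewrite eqxx.
by case: (eqVneq k j) => [->|kj]; rewrite ?eqxx // (negbTE ki) (negbTE kj).
Qed.

Lemma cohen_inv f : cohen_group f ->
  exists g, [/\ cohen_group g, cancel f g & cancel g f].
Proof.
elim=> [i j ij||h h' _ [g [? fg gf]] _ [g' [? fg' gf']]|h h' Gh [g [Gg hg gh]] hh' h'h].
- by exists (swap i j); split; [exact: cohen_group_gen|exact: swapK|exact: swapK].
- by exists id; split=> //; exact: cohen_group_id.
- exists (g' \o g); split; first exact: cohen_group_comp.
    exact: can_comp.
  exact: can_comp.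
- by exists h.
Qed.

(** One value is corrected at a time: the transposition of f m and c m repairs the value at m and
    moves no earlier value, because f and c are injective there. *)
Lemma group_ext (c : nat -> nat) m :
  (forall i j, i < m -> j < m -> c i = c j -> i = j) ->
  exists f, cohen_group f /\ forall i, i < m -> f i = c i.
Proof.
elim: m => [|m IH] ci; first by exists id; split=> //; exact: cohen_group_id.
have [|f [Gf hf]] := IH.
  by move=> i j im jm; apply: ci; exact: ltnW.
have [g [_ fg gf]] := cohen_inv Gf.
have [E|E] := eqVneq (f m) (c m).
  by exists f; split=> // i; rewrite ltnS leq_eqVlt => /orP[/eqP->|/hf].
pose s := swap (f m) (c m).
have Gs : cohen_group s.
  case: (ltngtP (f m) (c m)) => [h|h|/eqP]; [exact: cohen_group_gen| |by rewrite (negbTE E)].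
  suff -> : s = swap (c m) (f m) by exact: cohen_group_gen.
  apply/funext => k; rewrite /s /swap; case: (eqVneq k (f m)) => [->|//].
  by rewrite (negbTE E).
exists (s \o f); split; first exact: cohen_group_comp.
move=> i; rewrite ltnS leq_eqVlt => /orP[/eqP->|im]; first by rewrite /= /s /swap eqxx.
rewrite /= /s /swap ifF; last first.
  by apply/eqP => /(can_inj fg) E'; rewrite E' ltnn in im.
rewrite (hf _ im) ifF //; apply/eqP => /ci E'.
by have := E' (ltnW im) (ltnSn m) => E''; rewrite E'' ltnn in im.
Qed.

Section Act.
Variables f g : nat -> nat.
Hypotheses (fg : cancel f g) (gf : cancel g f).

Lemma in_act_cond h p z :
  z ∈ act_cond h p <-> exists n k v, bit n k v ∈ p /\ z = bit (h n) k v.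
Proof.
rewrite in_vset; split=> [[[[[n k] v] /= H] <-]|[n [k [v [H ->]]]]]; first by exists n, k, v.
by exists (exist _ ((n, k), v) H).
Qed.

Lemma bit_act n k v p : bit n k v ∈ act_cond f p <-> bit (g n) k v ∈ p.
Proof.
rewrite in_act_cond; split=> [[n' [k' [v' [h /bit_inj[-> -> ->]]]]]|h]; first by rewrite fg.
by exists (g n), k, v; rewrite gf.
Qed.

Lemma Fn_act p : Fn p -> Fn (act_cond f p).
Proof.
move=> Fp; have [||q [Fq hq]] := @Fn_map (fun n n' => n = f n') p Fp.
- by move=> i j j' -> /(can_inj fg).
- by move=> i i' j -> ->.
suff -> : act_cond f p = q by [].
have [_ q1 _] := Fq; apply: V_ext => z; rewrite in_act_cond; split.
  by move=> [n [k [v [h ->]]]]; apply/hq; exists n.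
move=> zq; have [n [k [v E]]] := q1 _ zq; rewrite E in zq *.
by have [n' [-> h]] := (hq _ _ _).1 zq; exists n', k, v.
Qed.

Lemma act_condK p : Fn p -> act_cond g (act_cond f p) = p.
Proof.
move=> [_ p1 _]; apply: V_ext => z; rewrite in_act_cond; split.
  by move=> [n [k [v [/bit_act h ->]]]].
move=> zp; have [n [k [v E]]] := p1 _ zp; exists (f n), k, v.
by rewrite bit_act fg -E.
Qed.

Lemma act_cond0 : act_cond f (num 0) = num 0.
Proof.
by apply: V_ext => z; rewrite in_act_cond; split=> [[n [k [v [/in_num0]]]]|/in_num0].
Qed.

Lemma in_act h t z :
  z ∈ act_name h t <-> exists p s, opair p s ∈ t /\ z = opair (act_cond h p) (act_name h s).
Proof.
rewrite /act_name in_name_rec; split=> [[p [s [? _ ?]]]|[p [s [? ?]]]]; by exists p, s.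
Qed.

Lemma act_incl p q : rev_incl q p -> rev_incl (act_cond f q) (act_cond f p).
Proof.
by move=> qp z /in_act_cond[n [k [v [h ->]]]]; apply/in_act_cond; exists n, k, v; split=> //;
  exact: qp.
Qed.

Lemma is_name_pair t z : is_name Fn t -> z ∈ t ->
  exists p s, [/\ z = opair p s, Fn p & is_name Fn s].
Proof. by case=> {}t h /h. Qed.

Lemma is_name_sub t p s : is_name Fn t -> opair p s ∈ t -> Fn p /\ is_name Fn s.
Proof. by move=> nt /(is_name_pair nt)[p' [s' [/pair_inj[-> ->]]]]. Qed.

Lemma is_name_act t : is_name Fn t -> is_name Fn (act_name f t).
Proof.
elim/tmem_ind: t => t IH nt; constructor=> z /in_act[p [s [ps ->]]].
have [Fp ns] := is_name_sub nt ps.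
by exists (act_cond f p), (act_name f s); split=> //; [exact: Fn_act|exact: IH (tmem_snd ps) ns].
Qed.

Lemma actK t : is_name Fn t -> act_name g (act_name f t) = t.
Proof.
elim/tmem_ind: t => t IH nt; apply: V_ext => z; rewrite in_act; split.
  move=> [p [s [/in_act[p' [s' [ps /pair_inj[-> ->]]]] ->]]].
  have [Fp ns] := is_name_sub nt ps.
  by rewrite act_condK // IH //; exact: tmem_snd ps.
move=> zt; have [p [s [E Fp ns]]] := is_name_pair nt zt.
exists (act_cond f p), (act_name f s); rewrite E in zt *; split.
  by apply/in_act; exists p, s.
by rewrite act_condK // IH //; exact: tmem_snd zt.
Qed.

Lemma act_comp h t : is_name Fn t -> act_name f (act_name h t) = act_name (f \o h) t.
Proof.
have E p : act_cond f (act_cond h p) = act_cond (f \o h) p.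
  apply: V_ext => z; rewrite !in_act_cond; split.
    move=> [n [k [v [/in_act_cond[n' [k' [v' [hp /bit_inj[-> -> ->]]]]] ->]]]].
    by exists n', k', v'.
  move=> [n [k [v [hp ->]]]]; exists (h n), k, v; split=> //.
  by apply/in_act_cond; exists n, k, v.
elim/tmem_ind: t => t IH nt; apply: V_ext => z; rewrite !in_act; split.
  move=> [p [s [/in_act[p' [s' [ps /pair_inj[-> ->]]]] ->]]]; exists p', s'; split=> //.
  by rewrite E IH //; [exact: tmem_snd ps|have [] := is_name_sub nt ps].
move=> [p [s [ps ->]]]; exists (act_cond h p), (act_name h s); split.
  by apply/in_act; exists p, s.
by rewrite E IH //; [exact: tmem_snd ps|have [] := is_name_sub nt ps].
Qed.

End Act.

Lemma act_id t : is_name Fn t -> act_name id t = t.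
Proof.
have E p : Fn p -> act_cond id p = p.
  move=> [_ p1 _]; apply: V_ext => z; rewrite in_act_cond; split=> [[n [k [v [h ->]]]]//|zp].
  by have [n [k [v E]]] := p1 _ zp; exists n, k, v; rewrite -E.
elim/tmem_ind: t => t IH nt; apply: V_ext => z; rewrite in_act; split.
  move=> [p [s [ps ->]]]; have [Fp ns] := is_name_sub nt ps.
  by rewrite E // IH //; exact: tmem_snd ps.
move=> zt; have [p [s [Ez Fp ns]]] := is_name_pair nt zt; exists p, s.
by rewrite Ez in zt *; rewrite E // IH //; exact: tmem_snd zt.
Qed.

Lemma act_le f g p q : cancel f g -> cancel g f -> Fn p ->
  rev_incl q (act_cond f p) -> rev_incl (act_cond g q) p.
Proof.
by move=> fg gf Fp qp; rewrite -(act_condK fg gf Fp); apply: act_incl => //; exact: (Fn_act fg).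
Qed.

(** The symmetry lemma: a condition below [act_cond f p] is pulled back by the inverse g, the
    hypothesis is applied, and its answer is moved forward by f. *)
Lemma feq_act f g p a b : cancel f g -> cancel g f ->
  Fn p -> is_name Fn a -> is_name Fn b -> feqM p a b ->
  feqM (act_cond f p) (act_name f a) (act_name f b).
Proof.
move=> fg gf.
have key p0 x y : Fn p0 -> is_name Fn x -> is_name Fn y ->
    (forall r c d, Fn r -> tmem c x -> tmem d y -> is_name Fn c -> is_name Fn d ->
       feqM r c d -> feqM (act_cond f r) (act_name f c) (act_name f d)) ->
    forced_sub Fn feqM p0 x y ->
    forced_sub Fn feqM (act_cond f p0) (act_name f x) (act_name f y).
  move=> Fp0 nx ny IH h q s c Fq qp /in_act[s' [c' [sc' /pair_inj[-> ->]]]] qs.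
  have [Fs' nc'] := is_name_sub nx sc'.
  have Fgq : Fn (act_cond g q) by exact: Fn_act Fq.
  have [r [s'' [d [Fr rq s''d rs'' E]]]] :=
    h _ _ _ Fgq (act_le fg gf Fp0 qp) sc' (act_le fg gf Fs' qs).
  have [Fs'' nd] := is_name_sub ny s''d.
  exists (act_cond f r), (act_cond f s''), (act_name f d); split.
  - exact: Fn_act Fr.
  - by rewrite -(act_condK gf fg Fq); apply: act_incl.
  - by apply/in_act; exists s'', d.
  - exact: act_incl.
  - exact: IH Fr (tmem_snd sc') (tmem_snd s''d) _ _ E.
elim/tmem_ind: a p b => a IH p b Fp na nb /feq_forced_sub[ab ba].
apply/feq_forced_sub; split; apply: key => // r c d Fr ca db nc nd E.
  exact: IH ca _ _ Fr nc nd E.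
by apply: feq_sym; apply: IH db _ _ Fr nd nc _; exact: feq_sym.
Qed.

Lemma fmem_act f g p a b : cancel f g -> cancel g f ->
  Fn p -> is_name Fn a -> is_name Fn b -> fmemM p a b ->
  fmemM (act_cond f p) (act_name f a) (act_name f b).
Proof.
move=> fg gf Fp na nb /forces_memP h; apply/forces_memP => q Fq qp.
have Fgq : Fn (act_cond g q) by exact: Fn_act Fq.
have [r [s [c [Fr rq sc rs E]]]] := h _ Fgq (act_le fg gf Fp qp).
have [Fs nc] := is_name_sub nb sc.
exists (act_cond f r), (act_cond f s), (act_name f c); split.
- exact: Fn_act Fr.
- by rewrite -(act_condK gf fg Fq); apply: act_incl.
- by apply/in_act; exists s, c.
- exact: act_incl.
- exact: (feq_act fg gf).
Qed.

(** * Names for conditions and evaluation *)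

(** [num 0] is the empty set, that is, the weakest Cohen condition; it lies in G, so pair names
    always take the expected value. *)
Definition upn (u v : V) : V := upair (opair (num 0) u) (opair (num 0) v).

Definition opn (u v : V) : V := upn (upn u u) (upn u v).

Definition chk : V -> V :=
  rec (fun _ x => x) (fun _ _ _ => True) id (fun _ _ u => opair (num 0) u) (num 0).

Lemma in_chk x z : z ∈ chk x <-> exists y, y ∈ x /\ z = opair (num 0) (chk y).
Proof.
rewrite in_rec; split=> [[y [yx _ _ ->]]|[y [yx ->]]]; exists y; split=> //.
exact: t_step.
Qed.

Lemma in_upn u v p s : opair p s ∈ upn u v <-> p = num 0 /\ (s = u \/ s = v).
Proof.
rewrite in_upair; split=> [[]/pair_inj[-> ->]|[-> [->|->]]]; auto.
Qed.

Section Names.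
Context {C : ctm}.

(** The canonical name of the Cohen real whose index is the numeral v; v is a set so that this is a
    definable term. *)
Definition xdot (v : V) : V :=
  imgV (prodV FnV omega) (fun w => opair (opair v (snd_V w)) (num 1) ∈ fst_V w)
    (fun w => opair (fst_V w) (chk (snd_V w))).

Lemma in_xdot n z : z ∈ xdot (num n) <->
  exists p k, [/\ Fn p, bit n k true ∈ p & z = opair p (chk (num k))].
Proof.
rewrite in_imgV; split.
  case=> w [/in_prodV[p [_ [/in_FnV Fp /in_omega[k ->] ->]]]]; rewrite fst_pair snd_pair.
  by move=> h ->; exists p, k.
move=> [p [k [Fp h ->]]]; exists (opair p (num k)); rewrite fst_pair snd_pair.
by split=> //; apply/pair_in_prodV; split; [exact/in_FnV|apply/in_omega; exists k].
Qed.

(** The canonical name of {(i, x_j) | (i, j) ∈ b}. *)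
Definition rdot (b : V) : V :=
  imgV b (fun=> True) (fun w => opair (num 0) (opn (chk (fst_V w)) (xdot (snd_V w)))).

Lemma in_rdot b z : PInj b -> z ∈ rdot b <->
  exists i j, pr b i j /\ z = opair (num 0) (opn (chk (num i)) (xdot (num j))).
Proof.
move=> [_ b1 _ _]; rewrite in_imgV; split.
  move=> [w [wb _ ->]]; have [i [j E]] := b1 _ wb.
  by exists i, j; move: wb; rewrite E fst_pair snd_pair.
move=> [i [j [ij ->]]]; exists (opair (num i) (num j)); split=> //.
by rewrite fst_pair snd_pair.
Qed.

(** Here a codes ((p, s), (b, p')): an element of the name, a placement, and a condition p' that
    makes p true along b. *)
Definition starK (a : V) : Prop := exists p s, fst_V a = opair p s /\
  (p ∈ FnV /\ pushes (fst_V (snd_V a)) p (snd_V (snd_V a))).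

(* A Cohen name s becomes a name for the Inj(ω,X)-name that evaluates s at the
   generic enumeration of X. *)
Definition sname : V -> V :=
  rec (fun _ x => prodV x (prodV PInjV FnV)) (fun _ x a => starK a)
    (fun a => snd_V (fst_V a))
    (fun _ a u => opair (snd_V (snd_V a)) (opn (rdot (fst_V (snd_V a))) u)) (num 0).

Lemma in_sname x z : z ∈ sname x <-> exists p s b p',
  [/\ opair p s ∈ x, Fn p, PInj b, Fn p' & pushes b p p' /\
    z = opair p' (opn (rdot b) (sname s))].
Proof.
rewrite in_rec; split.
  move=> [_ [/in_prodV[c [d [cx /in_prodV[b [p' [/in_PInjV Pb /in_FnV Fp' ->]]] ->]]]]].
  rewrite /starK !(fst_pair, snd_pair) => -[p [s [E [/in_FnV Fp m]]]] _ ->.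
  by exists p, s, b, p'; rewrite E snd_pair -E.
move=> [p [s [b [p' [ps Fp Pb Fp' [m ->]]]]]].
exists (opair (opair p s) (opair b p')); rewrite /starK !(fst_pair, snd_pair); split=> //.
- by do 2!(apply/pair_in_prodV; split=> //); [exact/in_PInjV|exact/in_FnV].
- by exists p, s; split=> //; split=> //; exact/in_FnV.
- exact: tmem_snd ps.
Qed.

Lemma T_chk t : dterm t -> dterm (fun e => chk (t e)).
Proof.
move=> Tt; apply: (T_rec (A := fun _ x => x) (K := fun _ _ _ => True) (k := id)
  (h := fun _ _ u => opair (num 0) u)) => //; try by dfn.
by move=> c x a ax _; exact: t_step.
Qed.
#[local] Hint Resolve T_chk : dfn.

Lemma T_upn t u : dterm t -> dterm u -> dterm (fun e => upn (t e) (u e)).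
Proof. by move=> ? ?; rewrite /upn; dfn. Qed.
#[local] Hint Resolve T_upn : dfn.

Lemma T_opn t u : dterm t -> dterm u -> dterm (fun e => opn (t e) (u e)).
Proof. by move=> ? ?; rewrite /opn; dfn. Qed.
#[local] Hint Resolve T_opn : dfn.

Lemma T_xdot t : dterm t -> dterm (fun e => xdot (t e)).
Proof. by apply: T_app1; rewrite /xdot; dfn. Qed.
#[local] Hint Resolve T_xdot : dfn.

Lemma T_rdot t : dterm t -> dterm (fun e => rdot (t e)).
Proof. by apply: T_app1; rewrite /rdot; dfn. Qed.
#[local] Hint Resolve T_rdot : dfn.

Lemma T_sname t : dterm t -> dterm (fun e => sname (t e)).
Proof.
move=> Tt; apply: T_rec => //; try by rewrite /starK; dfn.
move=> c x a /in_prodV[d [d' [dx _ ->]]]; rewrite /starK fst_pair => -[p [s [E _]]].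
by rewrite E snd_pair; apply: (@tmem_snd p); rewrite -E.
Qed.

Lemma is_name_upn u v : is_name Fn u -> is_name Fn v -> is_name Fn (upn u v).
Proof.
move=> nu nv; constructor=> z /in_upair[]->; [exists (num 0), u|exists (num 0), v];
  split=> //; exact: Fn0.
Qed.

Lemma is_name_opn u v : is_name Fn u -> is_name Fn v -> is_name Fn (opn u v).
Proof. by move=> nu nv; do 2?[apply: is_name_upn] => //; apply: is_name_upn. Qed.

Lemma is_name_chk x : is_name Fn (chk x).
Proof.
elim/V_ind: x => x IH; constructor=> z /in_chk[y [yx ->]].
by exists (num 0), (chk y); split=> //; [exact: Fn0|exact: IH].
Qed.

Lemma is_name_xdot n : is_name Fn (xdot (num n)).
Proof.
constructor=> z /in_xdot[p [k [Fp _ ->]]]; exists p, (chk (num k)); split=> //.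
exact: is_name_chk.
Qed.

Lemma is_name_rdot b : PInj b -> is_name Fn (rdot b).
Proof.
move=> Pb; constructor=> z /(in_rdot _ Pb)[i [j [_ ->]]].
exists (num 0), (opn (chk (num i)) (xdot (num j))); split=> //; first exact: Fn0.
by apply: is_name_opn; [exact: is_name_chk|exact: is_name_xdot].
Qed.

Lemma is_name_sname x : is_name Fn (sname x).
Proof.
elim/tmem_ind: x => x IH; constructor=> z /in_sname[p [s [b [p' [ps _ Pb Fp' [_ ->]]]]]].
exists p', (opn (rdot b) (sname s)); split=> //.
by apply: is_name_opn; [exact: is_name_rdot|exact: IH (tmem_snd ps)].
Qed.

Section Act.
Variables f g : nat -> nat.
Hypotheses (fg : cancel f g) (gf : cancel g f).

Lemma act_upn u v : act_name f (upn u v) = upn (act_name f u) (act_name f v).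
Proof.
apply: V_ext => z; rewrite in_act in_upair; split.
  move=> [p [s [/in_upn[-> h] ->]]]; rewrite act_cond0.
  by case: h => ->; [left|right].
case=> ->; [exists (num 0), u|exists (num 0), v]; rewrite act_cond0 in_upn; auto.
Qed.

Lemma act_opn u v : act_name f (opn u v) = opn (act_name f u) (act_name f v).
Proof. by rewrite /opn !act_upn. Qed.

Lemma act_chk x : act_name f (chk x) = chk x.
Proof.
elim/V_ind: x => x IH; apply: V_ext => z; rewrite in_act in_chk; split.
  move=> [p [s [/in_chk[y [yx /pair_inj[-> ->]]] ->]]].
  by exists y; split=> //; rewrite act_cond0 IH.
move=> [y [yx ->]]; exists (num 0), (chk y); rewrite act_cond0 IH //; split=> //.
by apply/in_chk; exists y.
Qed.

Lemma act_xdot n : act_name f (xdot (num n)) = xdot (num (f n)).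
Proof.
apply: V_ext => z; rewrite in_act in_xdot; split.
  move=> [p [s [/in_xdot[q [k [Fq h /pair_inj[-> ->]]]] ->]]].
  exists (act_cond f q), k; rewrite act_chk; split=> //; first exact: Fn_act.
  by apply/(bit_act fg gf); rewrite fg.
move=> [p [k [Fp h ->]]]; exists (act_cond g p), (chk (num k)).
rewrite (act_condK gf fg) // act_chk; split=> //; apply/in_xdot.
exists (act_cond g p), k; split=> //; first exact: Fn_act.
exact/(bit_act gf fg).
Qed.

(** Permuting the columns replaces x_j by x_(f j), so the placement b becomes f ∘ b. *)
Lemma PInj_act b : PInj b -> exists b', [/\ PInj b',
  forall i j, pr b' i j <-> pr b i (g j) & act_name f (rdot b) = rdot b'].
Proof.
move=> Pb; have [fb b1 b2 b3] := Pb.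
pose im z w := exists i j, z = opair (num i) (num j) /\ w = opair (num i) (num (f j)).
have imf z w w' : im z w -> im z w' -> w = w'.
  by move=> [i [j [-> ->]]] [i' [j' [/pair_inj[/num_inj -> /num_inj ->] ->]]].
pose b' := imgV b (fun=> True) (fun z => xget z (im z)).
have hb' w : w ∈ b' <-> exists z, z ∈ b /\ im z w.
  rewrite in_imgV; split=> [[z [zb _ ->]]|[z [zb zw]]].
    exists z; split=> //; have [i [j ->]] := b1 _ zb.
    by apply: (@xgetPex _ _ (im _)); exists (opair (num i) (num (f j))), i, j.
  exists z; split=> //.
  exact: (imf _ _ _ zw (@xgetPex _ z (im z) (ex_intro _ w zw))).
have hp i j : pr b' i j <-> pr b i (g j).
  rewrite hb'; split=> [[z [zb [i' [j' [Ez /pair_inj[/num_inj -> /num_inj ->]]]]]]|ij].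
    by rewrite fg -Ez.
  by exists (opair (num i) (num (g j))); split=> //; exists i, (g j); rewrite gf.
have Pb' : PInj b'.
  split; first exact: finite_img.
  - by move=> w /hb'[z [_ [i [j [_ ->]]]]]; exists i, (f j).
  - by move=> i j k /hp ij /hp ik; apply: (can_inj gf); exact: b2 ij ik.
  - by move=> i j k /hp ik /hp jk; exact: b3 ik jk.
exists b'; split=> //.
apply: V_ext => z; rewrite in_act (in_rdot _ Pb'); split.
  move=> [p [s [/(in_rdot _ Pb)[i [j [ij /pair_inj[-> ->]]]] ->]]].
  by exists i, (f j); rewrite hp fg act_cond0 act_opn act_chk act_xdot.
move=> [i [j [/hp ij ->]]]; exists (num 0), (opn (chk (num i)) (xdot (num (g j)))).
rewrite act_cond0 act_opn act_chk act_xdot gf; split=> //.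
by apply/(in_rdot _ Pb); exists i, (g j).
Qed.

Lemma pushes_act b b' p p' : (forall i j, pr b' i j <-> pr b i (g j)) ->
  pushes b p p' -> pushes b' p (act_cond f p').
Proof.
move=> hb h n k v np; have [n' [nn' n'p]] := h _ _ _ np.
exists (f n'); rewrite hb fg; split=> //.
by apply/(bit_act fg gf); rewrite fg.
Qed.

End Act.

Lemma PInj_ext b b' : PInj b -> PInj b' -> (forall i j, pr b i j <-> pr b' i j) -> b = b'.
Proof.
move=> [_ b1 _ _] [_ b1' _ _] h; apply: V_ext => z; split=> zb.
  by have [i [j E]] := b1 _ zb; rewrite E in zb *; apply/h.
by have [i [j E]] := b1' _ zb; rewrite E in zb *; apply/h.
Qed.

(** Columns enter the name only through the pairs (b, p'), and f permutes these pairs among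
    themselves: [pushes b p p'] is preserved when b is followed by f and p' is moved by f. *)
Lemma act_sname f g x : cancel f g -> cancel g f -> act_name f (sname x) = sname x.
Proof.
move=> fg gf; elim/tmem_ind: x => x IH; apply: V_ext => z; rewrite in_act; split.
  move=> [q [t [/in_sname[p [s [b [p' [ps Fp Pb Fp' [m /pair_inj[-> ->]]]]]]] ->]]].
  have [b' [Pb' hb' E]] := PInj_act fg gf Pb.
  apply/in_sname; exists p, s, b', (act_cond f p'); split=> //; first exact: Fn_act.
  split; first exact: pushes_act hb' m.
  by rewrite act_opn E IH //; exact: tmem_snd ps.
move=> /in_sname[p [s [b [p' [ps Fp Pb Fp' [m ->]]]]]].
have [b' [Pb' hb' E]] := PInj_act gf fg Pb.
have [b'' [Pb'' hb'' E']] := PInj_act fg gf Pb'.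
exists (act_cond g p'), (opn (rdot b') (sname s)); split.
  apply/in_sname; exists p, s, b', (act_cond g p'); split=> //; first exact: Fn_act.
  by split=> //; exact: pushes_act hb' m.
rewrite (act_condK gf fg) // act_opn E' IH; last exact: tmem_snd ps.
suff -> : b'' = b by [].
by apply: PInj_ext => // i j; rewrite hb'' hb' gf.
Qed.

Lemma hs_sub t p s : hereditarily_symmetric t -> opair p s ∈ t -> hereditarily_symmetric s.
Proof. by case=> {}t _ h /h. Qed.

Lemma hs_chk x : hereditarily_symmetric (chk x).
Proof.
elim/V_ind: x => x IH; constructor.
  by exists 0 => f _; exact: act_chk.
by move=> p s /in_chk[y [yx /pair_inj[_ ->]]]; exact: IH.
Qed.

Lemma hs_upn u v : hereditarily_symmetric u -> hereditarily_symmetric v ->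
  hereditarily_symmetric (upn u v).
Proof.
move=> hu hv; constructor; last by move=> p s /in_upn[_ [->|->]].
case: hu hv => {}u [m hm] _ [{}v [n hn] _].
exists (maxn m n) => f [Gf hf].
rewrite act_upn // hm ?hn //; split=> // k h; apply: hf; rewrite leq_max h ?orbT //.
Qed.

Lemma hs_opn u v : hereditarily_symmetric u -> hereditarily_symmetric v ->
  hereditarily_symmetric (opn u v).
Proof. by move=> hu hv; apply: hs_upn; apply: hs_upn. Qed.

Lemma hs_xdot n : hereditarily_symmetric (xdot (num n)).
Proof.
constructor; last by move=> p s /in_xdot[q [k [_ _ /pair_inj[_ ->]]]]; exact: hs_chk.
exists n.+1 => f [/cohen_inv[g [_ fg gf]] hf].
by rewrite (act_xdot fg gf) hf.
Qed.

Lemma hs_rdot b : PInj b -> hereditarily_symmetric (rdot b).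
Proof.
move=> Pb; constructor; last first.
  move=> p s /(in_rdot _ Pb)[i [j [_ /pair_inj[_ ->]]]].
  by apply: hs_opn; [exact: hs_chk|exact: hs_xdot].
have [L hL] := PInj_bound Pb; exists L => f [/cohen_inv[g [_ fg gf]] hf].
have [b' [Pb' hb' ->]] := PInj_act fg gf Pb; congr rdot; apply: PInj_ext => // i j.
rewrite hb'; split=> h; have [_ jL] := hL _ _ h.
  by move: (hf _ jL); rewrite gf => Ej; rewrite -Ej in h.
by rewrite -(hf _ jL) fg.
Qed.

Lemma hs_sname x : hereditarily_symmetric (sname x).
Proof.
elim/tmem_ind: x => x IH; constructor.
  by exists 0 => f [/cohen_inv[g [_ fg gf]] _]; exact: act_sname fg gf.
move=> p s /in_sname[q [t [b [q' [qt _ Pb _ [_ /pair_inj[_ ->]]]]]]].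
by apply: hs_opn; [exact: hs_rdot|exact: IH (tmem_snd qt)].
Qed.

End Names.

#[export] Hint Resolve T_chk T_upn T_opn T_xdot T_rdot T_sname : dfn.

(** * The symmetric model and the poset Inj(ω, X) *)

Section Gen.
Context {C : ctm} {g : gen}.

Notation val := (name_val gG).
Notation xr := (cohen_real gG).

Lemma val_upn u v : val (upn u v) = upair (val u) (val v).
Proof.
apply: V_ext => z; rewrite in_val in_upair; split.
  by move=> [p [s [/in_upn[_ [->|->]] _ ->]]]; auto.
by case=> ->; exists (num 0); [exists u|exists v]; split; rewrite ?in_upn; auto; exact: G0.
Qed.

Lemma val_opn u v : val (opn u v) = opair (val u) (val v).
Proof. by rewrite /opn !val_upn. Qed.

Lemma val_chk x : val (chk x) = x.
Proof.
elim/V_ind: x => x IH; apply: V_ext => z; rewrite in_val; split.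
  by move=> [p [s [/in_chk[y [yx /pair_inj[_ ->]]] _ ->]]]; rewrite IH.
move=> zx; exists (num 0), (chk z); rewrite IH //; split=> //; last exact: G0.
by apply/in_chk; exists z.
Qed.

Lemma val_xdot n : val (xdot (num n)) = xr n.
Proof.
apply: V_ext => z; rewrite in_val in_xr; split.
  move=> [p [s [/in_xdot[q [k [_ h /pair_inj[-> ->]]]] Gq ->]]].
  by exists k; rewrite val_chk; split=> //; exists q.
move=> [k [[p [Gp h]] ->]]; exists p, (chk (num k)); rewrite val_chk; split=> //.
by apply/in_xdot; exists p, k; split=> //; exact: G_Fn.
Qed.

Definition cond_of (b : V) : V := val (rdot b).

Lemma in_cond_of b z : PInj b -> z ∈ cond_of b <-> exists i j,
  pr b i j /\ z = opair (num i) (xr j).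
Proof.
move=> Pb; rewrite in_val; split.
  move=> [p [s [/(in_rdot _ Pb)[i [j [ij /pair_inj[_ ->]]]] _ ->]]].
  by exists i, j; rewrite val_opn val_chk val_xdot.
move=> [i [j [ij ->]]]; exists (num 0), (opn (chk (num i)) (xdot (num j))).
rewrite val_opn val_chk val_xdot; split=> //; last exact: G0.
by apply/(in_rdot _ Pb); exists i, j.
Qed.

Lemma pr_cond_of b i j : PInj b -> opair (num i) (xr j) ∈ cond_of b <-> pr b i j.
Proof.
move=> Pb; rewrite in_cond_of //; split=> [[i' [j' [h /pair_inj[/num_inj -> /xr_inj ->]]]]//|h].
by exists i, j.
Qed.

Lemma cond_of_le b b' : PInj b -> PInj b' -> rev_incl (cond_of b') (cond_of b) <-> rev_incl b' b.
Proof.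
move=> Pb Pb'; split=> [h|h z];
  first by apply: PInj_incl => // i j /(pr_cond_of _ _ Pb)/h/(pr_cond_of _ _ Pb').
by rewrite !in_cond_of // => -[i [j [/h ij ->]]]; exists i, j.
Qed.

Notation N := (cohen_model gM gG).
Notation Q := (N `&` Inj omega (cohen_X gG)).
Notation feqQ := (forces_eq Q rev_incl).
Notation fmemQ := (forces_mem Q rev_incl).

Lemma M_rdot b : PInj b -> gM (rdot b).
Proof.
move=> Pb; have [h _] := T_rdot (T_const (M_PInj Pb)).
by apply: (h (fun=> num 0)) => n; exact: M_num.
Qed.

Lemma Q_cond_of b : PInj b -> Q (cond_of b).
Proof.
move=> Pb; split.
  exists (rdot b); split; [exact: M_rdot|exact: is_name_rdot|exact: hs_rdot|exact: erefl].
have [fb b1 b2 b3] := Pb; split.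
- apply: (@sub_finite_set _ _ ((fun w => val (snd_V w)) @` elts (rdot b))).
    move=> z /in_val[p [s [ps _ ->]]]; exists (opair p s) => //.
    by rewrite snd_pair.
  by apply/finite_image/finite_img.
- move=> z; rewrite in_cond_of // => -[i [j [ij ->]]]; exists (num i), (xr j); split=> //.
    by apply/in_omega; exists i.
  by apply/in_vset; exists j.
- move=> u v w; rewrite !in_cond_of // => -[i [j [ij /pair_inj[-> ->]]]].
  by move=> [i' [j' [ij' /pair_inj[/num_inj E ->]]]]; rewrite -E in ij';
    rewrite (b2 _ _ _ ij ij').
- move=> u v w; rewrite !in_cond_of // => -[i [j [ij /pair_inj[-> ->]]]].
  by move=> [i' [j' [ij' /pair_inj[-> /xr_inj E]]]]; rewrite -E in ij'; rewrite (b3 _ _ _ ij ij').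
Qed.

(** Turns quantification over conditions of Q into quantification over codes in M; it works because
    n ↦ x_n is injective and conditions are finite. *)
Lemma Q_inv r : Q r -> exists b, PInj b /\ r = cond_of b.
Proof.
case=> _ [fr r1 r2 r3].
have hr z : z ∈ r -> exists i j, z = opair (num i) (xr j).
  by move=> /r1[_ [_ [-> /in_omega[i ->] /in_vset[j <-]]]]; exists i, j.
pose (im z w := exists i j, z = opair (num i) (xr j) /\ w = opair (num i) (num j)).
have imf z w w' : im z w -> im z w' -> w = w'.
  by move=> [i [j [-> ->]]] [i' [j' [/pair_inj[/num_inj -> /xr_inj ->] ->]]].
pose (b := imgV r (fun=> True) (fun z => xget z (im z))).
have hb w : w ∈ b <-> exists z, z ∈ r /\ im z w.
  rewrite in_imgV; split=> [[z [zr _ ->]]|[z [zr zw]]].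
    exists z; split=> //; have [i [j ->]] := hr _ zr.
    by apply: (@xgetPex _ _ (im _)); exists (opair (num i) (num j)), i, j.
  exists z; split=> //.
  exact: (imf _ _ _ zw (@xgetPex _ z (im z) (ex_intro _ w zw))).
have hp i j : pr b i j <-> opair (num i) (xr j) ∈ r.
  rewrite hb; split=> [[z [zr [i' [j' [Ez /pair_inj[/num_inj -> /num_inj ->]]]]]]|ij].
    by rewrite -Ez.
  by exists (opair (num i) (xr j)); split=> //; exists i, j.
have Pb : PInj b.
  split; first exact: finite_img.
  - by move=> w /hb[z [_ [i [j [_ ->]]]]]; exists i, j.
  - by move=> i j k /hp ij /hp ik; apply: xr_inj; exact: r2 ij ik.
  - by move=> i j k /hp ik /hp jk; apply: num_inj; exact: r3 ik jk.
exists b; split=> //; apply: V_ext => z; rewrite in_cond_of //; split=> [zr|[i [j [/hp h ->]]]//].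
by have [i [j E]] := hr _ zr; exists i, j; rewrite hp -E.
Qed.

Definition star (s : V) : V := val (sname s).

Lemma in_star x z : z ∈ star x <-> exists p s b,
  [/\ opair p s ∈ x, Fn p, PInj b, hold p b & z = opair (cond_of b) (star s)].
Proof.
rewrite in_val; split.
  move=> [q [t [/in_sname[p [s [b [p' [ps Fp Pb Fp' [m /pair_inj[-> ->]]]]]]] Gp' ->]]].
  exists p, s, b; split=> //; last by rewrite val_opn.
  by apply/hold_pushes => //; exists p'.
move=> [p [s [b [ps Fp Pb /(hold_pushes Fp Pb)[p' [Gp' m]] ->]]]].
exists p', (opn (rdot b) (sname s)); rewrite val_opn; split=> //.
by apply/in_sname; exists p, s, b, p'; split=> //; exact: G_Fn.
Qed.

Lemma in_star_pair x r t : opair r t ∈ star x <-> exists p s b,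
  [/\ opair p s ∈ x, Fn p, PInj b, hold p b & r = cond_of b /\ t = star s].
Proof.
rewrite in_star; split=> [[p [s [b [? ? ? ? /pair_inj[-> ->]]]]]|[p [s [b [? ? ? ? [-> ->]]]]]];
  by exists p, s, b.
Qed.

Lemma N_star x : gM x -> N (star x).
Proof.
move=> Mx; exists (sname x); split; [|exact: is_name_sname|exact: hs_sname|exact: erefl].
have [h _] := T_sname (T_const Mx).
by apply: (h (fun=> num 0)) => n; exact: M_num.
Qed.

Lemma is_name_star x : is_name Q (star x).
Proof.
elim/tmem_ind: x => x IH; constructor=> z /in_star[p [s [b [ps Fp Pb hp ->]]]].
by exists (cond_of b), (star s); split=> //; [exact: Q_cond_of|exact: IH (tmem_snd ps)].
Qed.

(** By [decide] along an extension c1 of c, either a true condition rules out every match, against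
    the hypothesis applied to its union with the other true conditions, or a match is true along
    some extension of c1. *)
Lemma feq_star_of p a b c : gM a -> gM b -> PInj c -> Fn p -> hold p c ->
  feqM p a b -> feqQ (cond_of c) (star a) (star b).
Proof.
have key p0 x y c0 : gM x -> gM y -> PInj c0 -> Fn p0 -> hold p0 c0 ->
    (forall r s d c', tmem s x -> tmem d y -> gM s -> gM d -> PInj c' -> Fn r -> hold r c' ->
       feqM r s d -> feqQ (cond_of c') (star s) (star d)) ->
    forced_sub Fn feqM p0 x y -> forced_sub Q feqQ (cond_of c0) (star x) (star y).
  move=> Mx My Pc0 Fp0 hp0 IH h q r1 t /Q_inv[c1 [Pc1 ->]] /(cond_of_le Pc0 Pc1) c10.
  move=> /in_star_pair[p1 [s [c2 [p1s Fp1 Pc2 hp1 [-> ->]]]]] /(cond_of_le Pc2 Pc1) c12.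
  have [Fp2 hp2] := hold_cup Pc1 Fp0 Fp1 (hold_ext hp0 c10) (hold_ext hp1 c12).
  have Ms := M_snd p1s Mx.
  have [|[p3 [Fp3 hp3 np3]]|[c3 [p4 [Pc3 c31 Fp4 [s' [d [s'd [p4s' E]]]] hp4]]]] :=
    @decide _ _ (fun r => exists s' d,
    opair s' d ∈ y /\ (rev_incl r s' /\ feqM r s d)) c1 _ Pc1.
  - by dfn.
  - have [Fp4 hp4] := hold_cup Pc1 Fp2 Fp3 hp2 hp3.
    have [||r [s' [d [Fr rq s'd rs' E]]]] := h (cupV (cupV p0 p1) p3) p1 s Fp4 _ p1s.
    + by move=> z z0; apply/in_cupV; left; apply/in_cupV; left.
    + by move=> z z0; apply/in_cupV; left; apply/in_cupV; right.
    case: (np3 r Fr); first by exists s', d.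
    by apply: incl_trans rq _ => z z3; apply/in_cupV; right.
  - have Md := M_snd s'd My.
    exists (cond_of c3), (cond_of c3), (star d); split=> //.
    + exact: Q_cond_of.
    + exact/cond_of_le.
    + apply/in_star_pair; exists s', d, c3; split=> //; first exact: Fn_sub Fp4 p4s'.
      exact: hold_sub hp4 p4s'.
    + exact: IH (tmem_snd p1s) (tmem_snd s'd) Ms Md Pc3 Fp4 hp4 E.
move=> Ma; elim/tmem_ind: a Ma p b c => a IH Ma p b c Mb Pc Fp hp /feq_forced_sub[ab ba].
apply/feq_forced_sub; split; apply: key Fp hp _ _ => // r s d c' sa db Ms Md Pc' Fr hr E.
  exact: (IH _ sa Ms r).
by apply: feq_sym; apply: (IH _ db Md r) => //; exact: feq_sym.
Qed.

(** By [decide], either some true p has no unmatched extension, and so forces equality, or an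
    unmatched condition is true along an extension of c. In the second case the forced equality of
    the stars yields a match, which by induction is forced by a true condition. *)
Lemma feq_star_forced a b c : gM a -> gM b -> PInj c ->
  feqQ (cond_of c) (star a) (star b) -> exists p, [/\ Fn p, hold p c & feqM p a b].
Proof.
have key x y c0 c1 p : gM x -> gM y -> PInj c0 -> PInj c1 -> rev_incl c1 c0 ->
    (forall s d c', tmem s x -> tmem d y -> gM s -> gM d -> PInj c' ->
       feqQ (cond_of c') (star s) (star d) -> exists p, [/\ Fn p, hold p c' & feqM p s d]) ->
    forced_sub Q feqQ (cond_of c0) (star x) (star y) -> Fn p -> hold p c1 -> ~ unmatched x y p.
  move=> Mx My Pc0 Pc1 c10 IH h Fp hp [s [t [st [ps nu]]]].
  have Fs := Fn_sub Fp ps.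
  have [||||r [s' [t' [/Q_inv[c2 [Pc2 ->]] c21 s't' rs' E]]]] :=
    h (cond_of c1) (cond_of c1) (star t).
  - exact: Q_cond_of.
  - exact/cond_of_le.
  - by apply/in_star_pair; exists s, t, c1; split=> //; exact: hold_sub hp ps.
  - by [].
  move: c21 => /(cond_of_le Pc1 Pc2) c21.
  move: s't' rs' E => /in_star_pair[s1 [d [c3 [s1d Fs1 Pc3 hs1 [-> ->]]]]] /(cond_of_le Pc3
    Pc2) c23 E.
  have [p4 [Fp4 hp4 E4]] := IH _ _ _ (tmem_snd st) (tmem_snd s1d) (M_snd st Mx) (M_snd s1d My)
    Pc2 E.
  have [Fp5 hp5] := hold_cup Pc2 Fp4 Fs1 hp4 (hold_ext hs1 c23).
  have [Fp6 hp6] := hold_cup Pc2 Fp5 Fp hp5 (hold_ext hp c21).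
  apply: (nu (cupV (cupV p4 s1) p) _ _ _ _ s1d).
  - exact/in_FnV.
  - by move=> z z0; apply/in_cupV; right.
  - by move=> z z0; apply/in_cupV; left; apply/in_cupV; right.
  - by apply: feq_mono E4 _ => z z0; apply/in_cupV; left; apply/in_cupV; left.
move=> Ma; elim/tmem_ind: a Ma b c => a IH Ma b c Mb Pc /feq_forced_sub[ab ba].
have [|[p [Fp hp np]]|[c1 [p [Pc1 c1c Fp u hp]]]] :=
  @decide _ _ (fun r => unmatched a b r \/ unmatched b a r) c _ Pc.
- by dfn.
- exists p; split=> //; apply: feqM_unmatched => // q Fq qp.
  by split=> u; apply: (np q Fq _ qp); [left|right].
- have IHa s d c' : tmem s a -> tmem d b -> gM s -> gM d -> PInj c' ->
       feqQ (cond_of c') (star s) (star d) -> exists p, [/\ Fn p, hold p c' & feqM p s d].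
    by move=> sa _ Ms Md Pc'; exact: IH.
  have IHb s d c' : tmem s b -> tmem d a -> gM s -> gM d -> PInj c' ->
       feqQ (cond_of c') (star s) (star d) -> exists p, [/\ Fn p, hold p c' & feqM p s d].
    move=> _ da Ms Md Pc' /feq_sym E; have [q [? ? ?]] := IH _ da Md _ _ Ms Pc' E.
    by exists q; split=> //; exact: feq_sym.
  case: u => u; first by case: (key _ _ _ _ _ Ma Mb Pc Pc1 c1c IHa ab Fp hp u).
  by case: (key _ _ _ _ _ Mb Ma Pc Pc1 c1c IHb ba Fp hp u).
Qed.

Lemma fmem_star_of p a b c : gM a -> gM b -> PInj c -> Fn p -> hold p c ->
  fmemM p a b -> fmemQ (cond_of c) (star a) (star b).
Proof.
move=> Ma Mb Pc Fp hp /forces_memP h;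
  apply/forces_memP => q /Q_inv[c1 [Pc1 ->]] /(cond_of_le Pc Pc1) c1c.
have [|[p3 [Fp3 hp3 np3]]|[c3 [p4 [Pc3 c31 Fp4 [s' [d [s'd [p4s' E]]]] hp4]]]] :=
  @decide _ _ (fun r => exists s' d,
    opair s' d ∈ b /\ (rev_incl r s' /\ feqM r a d)) c1 _ Pc1.
- by dfn.
- have [Fp4 hp4] := hold_cup Pc1 Fp Fp3 (hold_ext hp c1c) hp3.
  have [|r [s' [d [Fr rq s'd rs' E]]]] := h _ Fp4.
    by move=> z z0; apply/in_cupV; left.
  case: (np3 r Fr); first by exists s', d.
  by apply: incl_trans rq _ => z z3; apply/in_cupV; right.
- exists (cond_of c3), (cond_of c3), (star d); split=> //.
  + exact: Q_cond_of.
  + exact/cond_of_le.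
  + apply/in_star_pair; exists s', d, c3; split=> //; first exact: Fn_sub Fp4 p4s'.
    exact: hold_sub hp4 p4s'.
  + exact: feq_star_of Ma (M_snd s'd Mb) Pc3 Fp4 hp4 E.
Qed.

Lemma fmem_star_forced a b c : gM a -> gM b -> PInj c ->
  fmemQ (cond_of c) (star a) (star b) -> exists p, [/\ Fn p, hold p c & fmemM p a b].
Proof.
move=> Ma Mb Pc /forces_memP h.
have [|[p [Fp hp np]]|[c1 [p [Pc1 c1c Fp u hp]]]] := @decide _ _ (fun r =>
   forall r', r' ∈ FnV -> rev_incl r' r -> ~ exists s' d,
    opair s' d ∈ b /\ (rev_incl r' s' /\ feqM r' a d)) c _ Pc.
- by dfn.
- exists p; split=> //; apply/forces_memP => q Fq qp; apply: contrapT => H.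
  apply: (np q Fq _ qp) => r /in_FnV Fr rq [s [d [sd [rs E]]]].
  by apply: H; exists r, s, d.
have [|r [s' [t' [/Q_inv[c2 [Pc2 ->]] /(cond_of_le Pc1 Pc2) c21]]]] :=
  h (cond_of c1) (Q_cond_of Pc1).
  exact/cond_of_le.
move=> /in_star_pair[s1 [d [c3 [s1d Fs1 Pc3 hs1 [-> ->]]]]] /(cond_of_le Pc3 Pc2) c23 E.
have [p4 [Fp4 hp4 E4]] := feq_star_forced Ma (M_snd s1d Mb) Pc2 E.
have [Fp5 hp5] := hold_cup Pc2 Fp4 Fs1 hp4 (hold_ext hs1 c23).
have [Fp6 hp6] := hold_cup Pc2 Fp5 Fp hp5 (hold_ext hp c21).
case: (u (cupV (cupV p4 s1) p)).
- exact/in_FnV.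
- by move=> z z0; apply/in_cupV; right.
- exists s1, d; split=> //; split.
    by move=> z z0; apply/in_cupV; left; apply/in_cupV; right.
  by apply: feq_mono E4 _ => z z0; apply/in_cupV; left; apply/in_cupV; left.
Qed.

End Gen.

(** * Reading a name of the symmetric model along an enumeration *)

(** An element of the value of t that is a pair (r, s) is a Kuratowski set, and its name need not
    have the form [opn]. A name of s is therefore found three levels below t. *)
Definition sub3 (x t : V) : Prop := exists p1 z1, opair p1 z1 ∈ t /\
  exists p2 z2, opair p2 z2 ∈ z1 /\ exists p3 y, opair p3 y ∈ z2 /\ y = x.

Lemma sub3_tmem x t : sub3 x t -> tmem x t.
Proof.
move=> [p1 [z1 [h1 [p2 [z2 [h2 [p3 [y [h3 <-]]]]]]]]].
apply: (t_trans _ _ _ z2); first exact: tmem_snd h3.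
by apply: (t_trans _ _ _ z1); [exact: tmem_snd h2|exact: tmem_snd h1].
Qed.

Lemma sub3_name x t : sub3 x t -> is_name Fn t -> is_name Fn x.
Proof.
move=> [p1 [z1 [h1 [p2 [z2 [h2 [p3 [y [h3 <-]]]]]]]]] nt.
have [_ n1] := is_name_sub nt h1; have [_ n2] := is_name_sub n1 h2.
by have [] := is_name_sub n2 h3.
Qed.

Lemma sub3_hs x t : sub3 x t -> hereditarily_symmetric t -> hereditarily_symmetric x.
Proof.
move=> [p1 [z1 [h1 [p2 [z2 [h2 [p3 [y [h3 <-]]]]]]]]] ht.
exact: (hs_sub (hs_sub (hs_sub ht h1) h2) h3).
Qed.

Lemma sub3_act f x t : sub3 x t -> sub3 (act_name f x) (act_name f t).
Proof.
move=> [p1 [z1 [h1 [p2 [z2 [h2 [p3 [y [h3 <-]]]]]]]]].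
exists (act_cond f p1), (act_name f z1); split; first by apply/in_act; exists p1, z1.
exists (act_cond f p2), (act_name f z2); split; first by apply/in_act; exists p2, z2.
by exists (act_cond f p3), (act_name f y); split=> //; apply/in_act; exists p3, y.
Qed.

Lemma sub3_act_inv f y t : sub3 y (act_name f t) -> exists x, sub3 x t /\ y = act_name f x.
Proof.
move=> [p1 [z1 [/in_act[p1' [z1' [h1 /pair_inj[_ ->]]]] [p2 [z2 [/in_act[p2' [z2' [h2
  /pair_inj[_ ->]]]]
  [p3 [_ [/in_act[p3' [x [h3 /pair_inj[_ ->]]]] <-]]]]]]]]].
exists x; split=> //; exists p1', z1'; split=> //; exists p2', z2'; split=> //.
by exists p3', x.
Qed.

(** The converse of [pushes]: what p says about column w(n') is said by p' about position n'. *)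
Definition pulls (w p p' : V) : Prop :=
  forall n k (v : bool), opair (opair (num n) (num k)) (num v) ∈ p ->
    exists n', pr w n' n /\ opair (opair (num n') (num k)) (num v) ∈ p'.

Definition graph (f : nat -> nat) : V := vset (fun n => opair (num n) (num (f n))).

Lemma pr_graph f i j : pr (graph f) i j <-> j = f i.
Proof.
rewrite in_vset; split=> [[n /pair_inj[/num_inj -> /num_inj ->]]//|->].
by exists i.
Qed.

Lemma bounded_image (h : nat -> nat) L : exists B, forall c, c < L -> h c < B.
Proof.
elim: L => [|L [B hB]]; first by exists 0.
exists (maxn B (h L).+1) => c; rewrite ltnS leq_eqVlt leq_max => /orP[/eqP->|/hB->//].
by rewrite ltnSn orbT.
Qed.

(** The inverse of f' after f fixes every index below m, hence fixes the name. *)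
Lemma act_agree f f' m t : cohen_group f -> cohen_group f' ->
  (forall i, i < m -> f i = f' i) -> is_name Fn t ->
  (forall h, cohen_H m h -> act_name h t = t) -> act_name f t = act_name f' t.
Proof.
move=> Gf Gf' ff' nt ht; have [g' [Gg' fg gf]] := cohen_inv Gf'.
have E : act_name (g' \o f) t = t.
  apply: ht; split; first exact: cohen_group_comp.
  by move=> k km /=; rewrite ff'.
rewrite -{2}E act_comp //.
suff -> : f' \o (g' \o f) = f by [].
by apply/funext => i /=; rewrite gf.
Qed.

Section Ctm.
Context {C : ctm}.

Lemma D_pulls t u v : dterm t -> dterm u -> dterm v -> definable (fun e => pulls (t e) (u e) (v
  e)).
Proof.
apply: D_app3; rewrite /pulls.
apply: (D_alln (P := fun n e => forall k (v : bool), opair (opair n (num k)) (num v) ∈ e 1 ->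
  exists n', opair (num n') n ∈ e 0 /\ opair (opair (num n') (num k)) (num v) ∈ e 2)).
apply: (D_alln (P := fun k e => forall (v : bool), opair (opair (e 0) k) (num v) ∈ e 2 ->
  exists n', opair (num n') (e 0) ∈ e 1 /\ opair (opair (num n') k) (num v) ∈ e 3)).
apply: (D_allb (P := fun v e => opair (opair (e 1) (e 0)) v ∈ e 3 ->
  exists n', opair (num n') (e 1) ∈ e 2 /\ opair (opair (num n') (e 0)) v ∈ e 4)).
apply: D_imp; first by dfn.
apply: (D_exn (P := fun n' e =>
  opair n' (e 2) ∈ e 3 /\ opair (opair n' (e 1)) (e 0) ∈ e 5)); dfn.
Qed.
#[local] Hint Resolve D_pulls : dfn.

Lemma D_sub3 t u : dterm t -> dterm u -> definable (fun e => sub3 (t e) (u e)).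
Proof. by apply: D_app2; rewrite /sub3; dfn. Qed.
#[local] Hint Resolve D_sub3 : dfn.

(** Here a is a pair (p', y). In the enumeration coded by w the generic filter consists of the
    finite parts d of w, so y contributes when some p forces (d, y) into x for such a d, and p' is p
    moved from columns to positions. *)
Definition trK (w x a : V) : Prop := sub3 (snd_V a) x /\ exists p, p ∈ FnV /\
  exists d, d ∈ PInjV /\ (rev_incl w d /\ (fmemM p (opn (rdot d) (snd_V a)) x /\
    pulls w p (fst_V a))).

Lemma D_trK t u v : dterm t -> dterm u -> dterm v -> definable (fun e => trK (t e) (u e) (v e)).
Proof. by apply: D_app3; rewrite /trK; dfn. Qed.
#[local] Hint Resolve D_trK : dfn.

(** Two unions lead from a name to its subnames when the start is the name itself, and three from a
    set of names: 2 + 3 + 3 = 8 for [sub3]. *)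
Definition union8 (x : V) : V := iter 8 unionV x.

(* If x names an Inj(ω,X)-name, [tr w x] is a Cohen name for the evaluation of
   that name at the generic enumeration y of X, computed in the Cohen extension
   by y with columns permuted by w. *)
Definition tr (w : V) : V -> V :=
  rec (fun _ x => prodV FnV (union8 x)) trK snd_V (fun _ a u => opair (fst_V a) u) w.

Lemma sub3_union8 x t : sub3 x t -> x ∈ union8 t.
Proof.
have U n a b c : c ∈ iter n unionV t -> opair a b ∈ c -> b ∈ iter n.+3 unionV t.
  move=> ct h; apply/in_unionV; exists (upair a b); split; last by apply/in_upair; right.
  apply/in_unionV; exists (opair a b); split; last by apply/in_upair; right.
  by apply/in_unionV; exists c.
move=> [p1 [z1 [h1 [p2 [z2 [h2 [p3 [y [h3 <-]]]]]]]]].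
have k1 : z1 ∈ iter 2 unionV t.
  apply/in_unionV; exists (upair p1 z1); split; last by apply/in_upair; right.
  by apply/in_unionV; exists (opair p1 z1); split=> //; apply/in_upair; right.
exact: U (U _ _ _ _ k1 h2) h3.
Qed.

Lemma in_tr w x z : z ∈ tr w x <-> exists p' y p d,
  [/\ [/\ Fn p', sub3 y x, Fn p, PInj d & rev_incl w d],
      fmemM p (opn (rdot d) y) x, pulls w p p' & z = opair p' (tr w y)].
Proof.
rewrite in_rec; split.
  move=> [_ [/in_prodV[p' [y [/in_FnV Fp' _ ->]]]]]; rewrite /trK fst_pair snd_pair.
  move=> [s3 [p [/in_FnV Fp [d [/in_PInjV Pd [dw [h m]]]]]]] _ ->.
  by exists p', y, p, d.
move=> [p' [y [p [d [[Fp' s3 Fp Pd dw] h m ->]]]]].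
exists (opair p' y); rewrite /trK fst_pair snd_pair; split=> //.
- by apply/pair_in_prodV; split; [exact/in_FnV|exact: sub3_union8].
- split=> //; exists p; split; first exact/in_FnV.
  by exists d; split; first exact/in_PInjV.
- exact: sub3_tmem.
Qed.

Lemma T_tr t u : dterm t -> dterm u -> dterm (fun e => tr (t e) (u e)).
Proof.
apply: T_rec; try by rewrite /union8 /=; dfn.
move=> c x a _ [s3 _]; exact: sub3_tmem.
Qed.

Lemma M_graph_of f (R : V -> V -> Prop) : definable (fun e => R (e 0) (e 1)) ->
  (forall n m, R (num n) (num m) <-> m = f n) -> gM (graph f).
Proof.
move=> DR hR; have DR2 t u : dterm t -> dterm u -> definable (fun e => R (t e) (u e)) by exact:
  D_app2.
have -> : graph f = sepV (prodV omega omega) (fun z => R (fst_V z) (snd_V z)).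
  apply: V_ext => z; rewrite in_vset in_sepV in_prodV; split.
    move=> [n <-]; rewrite fst_pair snd_pair hR; split=> //.
    by exists (num n), (num (f n)); split=> //; apply/in_omega; [exists n|exists (f n)].
  move=> [[_ [_ [/in_omega[n ->] /in_omega[m ->] ->]]]]; rewrite fst_pair snd_pair hR => ->.
  by exists n.
apply: M_sep; typeclasses eauto with dfn.
Qed.

Lemma M_graph f : cohen_group f -> gM (graph f).
Proof.
elim=> [i j ij||h h' _ Mh _ Mh'|h h' _ Mh hh' h'h].
- apply: (M_graph_of (R := fun x y => (x = num i /\ y = num j) \/
    (~ x = num i /\ ((x = num j /\ y = num i) \/ (~ x = num j /\ y = x))))); first by dfn.
  move=> n m; rewrite /swap; split.
    move=> [[/num_inj -> /num_inj ->]|[ni [[/num_inj -> /num_inj ->]|[nj /num_inj ->]]]].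
    + by rewrite eqxx.
    + by rewrite eqxx; case: eqP => // E; case: ni; rewrite E.
    + by case: eqP => [E|_]; [case: ni; rewrite E|case: eqP => // E; case: nj; rewrite E].
  case: eqP => [-> ->|ni]; first by left.
  case: eqP => [E ->|nj ->]; right.
    by split; [move/num_inj|left; rewrite E].
  by split; [move/num_inj|right; split=> // /num_inj].
- apply: (M_graph_of (R := fun x y => y = x)); first by dfn.
  by move=> n m; split=> [/num_inj|->].
- apply: (M_graph_of (R := fun x y => exists z, z ∈ omega /\
    (opair x z ∈ graph h' /\ opair z y ∈ graph h))); first by dfn.
  move=> n m; split=> [[_ [/in_omega[k ->] [/pr_graph -> /pr_graph ->]]]//|->].
  exists (num (h' n)); split; first by apply/in_omega; exists (h' n).
  by split; apply/pr_graph.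
- apply: (M_graph_of (R := fun x y => opair y x ∈ graph h)); first by dfn.
  by move=> n m; rewrite pr_graph; split=> [->|->].
Qed.

Lemma T_act_cond f t : cohen_group f -> dterm t -> dterm (fun e => act_cond f (t e)).
Proof.
move=> Gf; have MG := M_graph Gf; apply: (T_app1 (F := act_cond f)).
pose (F p := sepV (prodV (prodV omega omega) (upair (num 0) (num 1)))
  (fun z => exists n, n ∈ omega /\ exists k, k ∈ omega /\
    exists v, v ∈ upair (num 0) (num 1) /\ (opair (opair n k) v ∈ p /\
    exists n', n' ∈ omega /\ (opair n n' ∈ graph f /\ z = opair (opair n' k) v)))).
have -> : act_cond f = F; last by rewrite /F; typeclasses eauto with dfn.
apply/funext => p; apply: V_ext => z; rewrite in_act_cond in_sepV; split.
  move=> [n [k [v [np ->]]]].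
  have on j : num j ∈ omega by apply/in_omega; exists j.
  have bv : num v ∈ upair (num 0) (num 1) by apply/in_upair; case: (v); auto.
  split; first by do 2!(apply/pair_in_prodV; split=> //).
  exists (num n); split=> //; exists (num k); split=> //; exists (num v); split=> //.
  by split=> //; exists (num (f n)); split=> //; split=> //; apply/pr_graph.
move=> [_ [_ [/in_omega[n ->] [_ [/in_omega[k ->] [v0 [hv [np
  [_ [/in_omega[n' ->] [/pr_graph -> ->]]]]]]]]]]].
have [v Ev] : exists v : bool, v0 = num v.
  by case/in_upair: hv => ->; [exists false|exists true].
by exists n, k, v; rewrite /bit -Ev.
Qed.

(** [act_name] is a recursion carried out in V; rewriting it as an instance of [rec] brings it under
    [T_rec]. *)
Lemma M_act f t : cohen_group f -> gM t -> gM (act_name f t).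
Proof.
move=> Gf Mt.
have Ta t' : dterm t' -> dterm (fun e => act_cond f (t' e)) by exact: T_act_cond.
pose (F := rec (fun _ x => x) (fun _ _ a => exists p s, a = opair p s /\ True) snd_V
  (fun _ a u => opair (act_cond f (fst_V a)) u)).
have [h _] : dterm (fun _ : nat -> V => F (num 0) t).
  apply: T_rec; try by typeclasses eauto with dfn.
  by move=> c x a ax [p [s [E _]]]; rewrite E snd_pair; rewrite E in ax; exact: tmem_snd ax.
have -> : act_name f t = F (num 0) t; last by apply: (h (fun=> num 0)) => n; exact: M_num.
elim/tmem_ind: t {Mt h} => x IH; apply: V_ext => z; rewrite in_act in_rec; split.
  move=> [p [s [ps ->]]]; exists (opair p s); rewrite fst_pair snd_pair IH;
    last exact: tmem_snd ps.
  by split=> //; [exists p, s|exact: tmem_snd ps].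
move=> [a [ax [p [s [E _]]] _ ->]]; exists p, s; rewrite E fst_pair snd_pair.
by rewrite E in ax; split=> //; rewrite IH //; exact: tmem_snd ax.
Qed.

End Ctm.

#[export] Hint Resolve D_pulls T_tr : dfn.

Section Gen.
Context {C : ctm} {g : gen}.

Notation val := (name_val gG).
Notation xr := (cohen_real gG).
Notation N := (cohen_model gM gG).
Notation Q := (N `&` Inj omega (cohen_X gG)).
Notation feqQ := (forces_eq Q rev_incl).

Lemma sub3_M x t : sub3 x t -> gM t -> gM x.
Proof.
move=> [p1 [z1 [h1 [p2 [z2 [h2 [p3 [y [h3 <-]]]]]]]]] Mt.
exact: M_snd h3 (M_snd h2 (M_snd h1 Mt)).
Qed.

Lemma val_pair_sub3 r t x : opair r t ∈ val x -> exists y, sub3 y x /\ t = val y.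
Proof.
move=> /in_val[p1 [z1 [h1 _ E1]]].
have : upair r t ∈ val z1 by rewrite -E1; apply/in_upair; right.
move=> /in_val[p2 [z2 [h2 _ E2]]].
have : t ∈ val z2 by rewrite -E2; apply/in_upair; right.
move=> /in_val[p3 [y [h3 _ E3]]].
by exists y; split=> //; exists p1, z1; split=> //; exists p2, z2; split=> //; exists p3, y.
Qed.

Lemma M_opn u v : gM u -> gM v -> gM (opn u v).
Proof. by move=> Mu pushes; rewrite /opn /upn; have := M_num 0; dfn. Qed.

Definition perm_graph (w : V) : Prop := exists s s' : nat -> nat,
  [/\ cancel s s', cancel s' s & forall i j, pr w i j <-> j = s i].

(* The induction needs the two permutations a and c: elements of a symmetric
   name are only symmetric with larger support, and enlarging the support
   changes the permutation matching the two enumerations. *)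
Lemma tr_correct x : is_name Fn x -> hereditarily_symmetric x -> gM x ->
  forall m a c w b, (forall f, cohen_H m f -> act_name f x = x) ->
  cohen_group a -> cohen_group c -> perm_graph w -> PInj b ->
  (forall i, i < m -> exists j, pr w j (c i) /\ pr b j (a i)) ->
  is_name Q (val (act_name a x)) ->
  feqQ (cond_of b) (val (act_name a x)) (star (tr w (act_name c x))).
Proof.
elim/tmem_ind: x => x IH nx hx Mx m a c w b sx Ga Gc Pw Pb hb nQ.
have [s [s' [ss' s's hw]]] := Pw; have [_ _ b2 b3] := Pb.
have [a' [Ga' aa' a'a]] := cohen_inv Ga; have [c' [Gc' cc' c'c]] := cohen_inv Gc.
have [nax ncx] : is_name Fn (act_name a x) /\ is_name Fn (act_name c x).
  by split; [exact: is_name_act aa' _ nx|exact: is_name_act cc' _ nx].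
have [Max Mcx] : gM (act_name a x) /\ gM (act_name c x) by split; exact: M_act.
have nQpair r t : opair r t ∈ val (act_name a x) -> Q r /\ is_name Q t.
  case: nQ => {}t' h /h[r' [t'' [/pair_inj[-> ->]]]].
  by [].
apply/feq_forced_sub; split=> q q1 t /Q_inv[b1 [Pb1 ->]] /(cond_of_le Pb Pb1) b1b.
- move=> q1t; have [Qq1 nt] := nQpair _ _ q1t.
  have [d [Pd Ed]] := Q_inv Qq1; rewrite {}Ed in q1t * => /(cond_of_le Pd Pb1) b1d.
  have [y1 [s3 Et]] := val_pair_sub3 q1t.
  have [y [s3y Ey1]] := sub3_act_inv s3.
  have [p [Gp fp]] : exists p, gG p /\ fmemM p (opn (rdot d) y1) (act_name a x).
    apply: val_mem_forced => //; first by apply: M_opn; [exact: M_rdot|exact: sub3_M s3 Max].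
    by rewrite val_opn -Et.
  have Fp := G_Fn Gp.
  have [ny hy My] := And3 (sub3_name s3y nx) (sub3_hs s3y hx) (sub3_M s3y Mx).
  have [my smy] : symmetric_name y by case: hy.
  have [Lp hLp] := Fn_bound Fp; have [Ld hLd] := PInj_bound Pd.
  have [B hB] := bounded_image a' (maxn Lp Ld).
  (* mm bounds the supports of x and y and the preimages under a of all columns mentioned by p and
     d. *)
  pose mm := maxn (maxn m my) B.
  have mmm i : i < m -> i < mm by move=> im; rewrite !leq_max im.
  have mmy i : i < my -> i < mm by move=> im; rewrite !leq_max im orbT.
  have mmL l : l < Lp \/ l < Ld -> a' l < mm.
    by move=> h; rewrite !leq_max hB ?orbT // leq_max; case: h => ->; rewrite ?orbT.
  have [K hK] := bounded_image a mm.
  have [b2' [Pb2 b21 cov]] := ext_ran K Pb1.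
  (* jf i is the position at which b2' lists column a i. *)
  have [jf hjf] : {jf : nat -> nat & forall i, i < mm -> pr b2' (jf i) (a i)}.
    apply: (@choice _ _ (fun i j => i < mm -> pr b2' j (a i))) => i.
    have [im|im] := boolP (i < mm); last by exists 0.
    by have [j hj] := cov _ (hK _ im); exists j.
  have [_ _ b22 b23] := Pb2.
  (* e sends i to the column that w puts at that position. It agrees with c below m, and below mm it
     also serves y, p and d. *)
  have [e [Ge he]] : exists f, cohen_group f /\ forall i, i < mm -> f i = s (jf i).
    apply: group_ext => i j im jm /(can_inj ss') E.
    apply: (can_inj aa'); apply: b22 (hjf _ im) _; rewrite E; exact: hjf.
  have [e' [Ge' ee' e'e]] := cohen_inv Ge.
  have ec i : i < m -> e i = c i.
    move=> im; rewrite he ?mmm //; have [j [/hw -> bj]] := hb _ im; congr s.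
    exact: b23 (hjf _ (mmm _ im)) (b21 _ (b1b _ bj)).
  have Ee : act_name e x = act_name c x by exact: act_agree ec nx sx.
  (* f moves column a i to column e i, so it turns the forced statement about names moved by a into
     one about names moved by e. *)
  pose f := e \o a'; pose f' := a \o e'.
  have ff' : cancel f f' by exact: can_comp.
  have f'f : cancel f' f by exact: can_comp.
  have actf z : is_name Fn z -> act_name f (act_name a z) = act_name e z.
    move=> nz; rewrite act_comp //; suff -> : f \o a = e by [].
    by apply/funext => i; rewrite /f /= aa'.
  have ny1 : is_name Fn y1 by exact: sub3_name s3 nax.
  have [d' [Pd' hd' Ed']] := PInj_act ff' f'f Pd.
  have := fmem_act ff' f'f Fp (is_name_opn (is_name_rdot Pd) ny1) nax fp.
  rewrite act_opn Ed' Ey1 !actf // Ee => fp'.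
  have Fp1 := Fn_act ff' Fp.
  have [||p' [Fp' hp']] := @Fn_map (fun n' n => pr w n' n) _ Fp1.
  + by move=> i j j' /hw -> /hw ->.
  + by move=> i i' j /hw -> /hw /(can_inj ss').
  (* d is part of b2', and b2' followed by f agrees with w at the positions involved. *)
  have dw : rev_incl w d'.
    apply: PInj_incl => // i j /hd' dij; apply/hw.
    have [_ jL] := hLd _ _ dij; have im : e' j < mm by rewrite -(aa' (e' j)); apply: mmL; right.
    have := hjf _ im; have /b1d/b21 h1 := dij => h2.
    by rewrite (b23 _ _ _ h1 h2) -he // e'e.
  have hp'b : hold p' b2'.
    move=> n k v /hp'[n1 [/hw -> /(bit_act ff' f'f) np]].
    have [nL _] := hLp _ _ _ np.
    have im : e' (s n) < mm by rewrite -(aa' (e' (s n))); apply: mmL; left.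
    have Es : s n = s (jf (e' (s n))) by rewrite -he // e'e.
    exists (a (e' (s n))); split; last exact: G_true_bit Gp np.
    by rewrite {1}(can_inj ss' Es); exact: hjf.
  exists (cond_of b2'), (cond_of b2'), (star (tr w (act_name e y))); split=> //.
  + exact: Q_cond_of.
  + exact/cond_of_le.
  + apply/in_star_pair; exists p', (tr w (act_name e y)), b2'; split=> //.
    apply/in_tr; exists p', (act_name e y), (act_cond f p), d'; split=> //.
      by split=> //; rewrite -Ee; exact: sub3_act.
    by move=> n k v np; exists (s' n); split; [apply/hw; rewrite s's|apply/hp'; exists n;
      split=> //; apply/hw; rewrite s's].
  + rewrite Et Ey1; apply: (IH _ (sub3_tmem s3y) ny hy My my) => //.
      move=> i im; exists (jf i); split; last exact: hjf (mmy _ im).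
      by apply/hw; rewrite he //; exact: mmy.
    by rewrite -Ey1 -Et.
(* The converse inclusion exchanges the roles of a and c and of b2' and w; this time the listing is
   extended so that the positions of the columns c i are filled. *)
- move=> /in_star_pair[p' [u [b3' [/in_tr[p'' [y1 [p [d [[Fp' s3 Fp Pd dw] fp mw /pair_inj[Ep
  Eu]]]]]] _ Pb3 hp' [-> ->]]]]].
  rewrite -{}Ep {u}Eu in hp' mw Fp' * => /(cond_of_le Pb3 Pb1) b13.
  have [y [s3y Ey1]] := sub3_act_inv s3.
  have [ny hy My] := And3 (sub3_name s3y nx) (sub3_hs s3y hx) (sub3_M s3y Mx).
  have [my smy] : symmetric_name y by case: hy.
  have [Lp hLp] := Fn_bound Fp; have [Ld hLd] := PInj_bound Pd.
  have [B hB] := bounded_image c' (maxn Lp Ld).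
  pose mm := maxn (maxn m my) B.
  have mmm i : i < m -> i < mm by move=> im; rewrite !leq_max im.
  have mmy i : i < my -> i < mm by move=> im; rewrite !leq_max im orbT.
  have mmL l : l < Lp \/ l < Ld -> c' l < mm.
    by move=> h; rewrite !leq_max hB ?orbT // leq_max; case: h => ->; rewrite ?orbT.
  have [K hK] := bounded_image (s' \o c) mm.
  have [b2' [Pb2 b21 cov _]] := ext_dom K 0 Pb1.
  have [jf hjf] : {jf : nat -> nat & forall i, i < mm -> pr b2' (s' (c i)) (jf i)}.
    apply: (@choice _ _ (fun i j => i < mm -> pr b2' (s' (c i)) j)) => i.
    have [im|im] := boolP (i < mm); last by exists 0.
    by have [j hj] := cov _ (hK _ im); exists j.
  have [_ _ b22 b23] := Pb2.
  have [e [Ge he]] : exists f, cohen_group f /\ forall i, i < mm -> f i = jf i.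
    apply: group_ext => i j im jm E.
    apply: (can_inj cc'); apply: (can_inj s's).
    by apply: b23 (hjf _ im) _; rewrite E; exact: hjf.
  have [e' [Ge' ee' e'e]] := cohen_inv Ge.
  have ea i : i < m -> e i = a i.
    move=> im; rewrite he ?mmm //; have [j [/hw E bj]] := hb _ im.
    have := hjf _ (mmm _ im); rewrite E ss' => h; exact: b22 h (b21 _ (b1b _ bj)).
  have Ee : act_name e x = act_name a x by exact: act_agree ea nx sx.
  pose f := e \o c'; pose f' := c \o e'.
  have ff' : cancel f f' by exact: can_comp.
  have f'f : cancel f' f by exact: can_comp.
  have actf z : is_name Fn z -> act_name f (act_name c z) = act_name e z.
    move=> nz; rewrite act_comp //; suff -> : f \o c = e by [].
    by apply/funext => i; rewrite /f /= cc'.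
  have ny1 : is_name Fn y1 by exact: sub3_name s3 ncx.
  have [d' [Pd' hd' Ed']] := PInj_act ff' f'f Pd.
  have := fmem_act ff' f'f Fp (is_name_opn (is_name_rdot Pd) ny1) ncx fp.
  rewrite act_opn Ed' Ey1 !actf // Ee => fp'.
  (* Moved by f, p says of the Cohen reals what p' says of the listed reals, and p' is true of
     those. *)
  have Gfp : gG (act_cond f p).
    apply: G_true; first exact: (Fn_act ff' Fp).
    move=> n k v /(bit_act ff' f'f) np; have [nL _] := hLp _ _ _ np.
    have [n1 [/hw E n1p]] := mw _ _ _ np; have [n2 [n12 t2]] := hp' _ _ _ n1p.
    have im : e' n < mm by rewrite -(cc' (e' n)); apply: mmL; left.
    have := hjf _ im; have := b21 _ (b13 _ n12) => h1.
    rewrite -[c (e' n)]/(f' n) E ss' => h2.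
    have E2 : n2 = n by rewrite (b22 _ _ _ h1 h2) -he // e'e.
    by rewrite E2 in t2.
  have My1 : gM (act_name e y) by exact: M_act.
  have := val_mem_of (M_opn (M_rdot Pd') My1) Max Gfp fp'; rewrite val_opn -/(cond_of d') => d'y.
  have [_ nQy] := nQpair _ _ d'y.
  exists (cond_of b2'), (cond_of d'), (val (act_name e y)); split=> //.
  + exact: Q_cond_of.
  + exact/cond_of_le.
  + apply/cond_of_le => //; apply: PInj_incl => // i j /hd' dij.
    have /dw/hw E := dij; have [_ jL] := hLd _ _ dij.
    have im : e' j < mm by rewrite -(cc' (e' j)); apply: mmL; right.
    by have := hjf _ im; rewrite -[c (e' j)]/(f' j) E ss' -he // e'e.
  + apply: feq_sym; apply: (IH _ (sub3_tmem s3y) ny hy My my) => //.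
    move=> i im; exists (s' (c i)); split; first by apply/hw; rewrite s's.
    by rewrite he ?mmy //; exact: hjf (mmy _ im).
Qed.

Lemma perm_graph_group f : cohen_group f -> perm_graph (graph f).
Proof.
move=> /cohen_inv[f' [_ ff' f'f]]; exists f, f'; split=> // i j; exact: pr_graph.
Qed.

(** [tr_correct] with both permutations trivial: b is extended until it lists the first m reals, and
    w is a permutation that agrees with this listing on their positions. *)
Lemma name_repr t b : N t -> is_name Q t -> PInj b -> exists b' s,
  [/\ PInj b', rev_incl b' b, gM s & feqQ (cond_of b') t (star s)].
Proof.
move=> [x [Mx nx hx ->]] nQ Pb; have [m sx] : symmetric_name x by case: hx.
have [b' [Pb' b'b cov]] := ext_ran m Pb; have [_ _ b2 b3] := Pb'.
have [jf hjf] : {jf : nat -> nat & forall i, i < m -> pr b' (jf i) i}.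
  apply: (@choice _ _ (fun i j => i < m -> pr b' j i)) => i.
  have [im|im] := boolP (i < m); last by exists 0.
  by have [j hj] := cov _ im; exists j.
have [f [Gf hf]] := @group_ext jf m (fun i j im jm E =>
  b2 _ _ _ (hjf _ im) (eq_ind_r (fun z => pr b' z j) (hjf _ jm) E)).
have [f' [Gf' ff' f'f]] := cohen_inv Gf.
exists b', (tr (graph f') x); split=> //.
  have [h _] := T_tr (T_const (M_graph Gf')) (T_const Mx).
  by apply: (h (fun=> num 0)) => n; exact: M_num.
rewrite -{1}(act_id nx) -{2}(act_id nx).
apply: (tr_correct nx hx Mx sx) => //; try exact: cohen_group_id.
- exact: perm_graph_group.
- move=> i im; exists (jf i); split; last exact: hjf.
  by apply/pr_graph; rewrite -hf // ff'.
- by rewrite act_id.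
Qed.

(** * Forcing with Inj(ω, X) reduced to Cohen forcing *)

Lemma star_scons t e : (fun n => star (scons t e n)) = scons (star t) (fun n => star (e n)).
Proof. by apply/funext => -[]. Qed.

Lemma D_forcesM_const e phi : env e -> definable (fun e' => forcesM (e' 0) e phi).
Proof.
move=> Me; apply: (D_forcesM phi (u := fun n _ => e n)); first exact: T_var.
by move=> n; exact: T_const.
Qed.

Lemma D_exM_forcesM e phi : env e ->
  definable (fun e' => exists t, gM t /\ forcesM (e' 0) (scons t e) phi).
Proof.
move=> Me; apply: D_exM.
apply: (D_ext (D_forcesM phi (t := fun e' => e' 1)
  (u := fun n e' => if n is m.+1 then e m else e' 0) _ _)).
- exact: T_var.
- by case=> [|n]; [exact: T_var|exact: T_const].
- move=> e' _.
  have -> // : (fun n => match n with 0 => e' 0 | m.+1 => e m end) = scons (e' 0) e.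
  by apply/funext => -[].
Qed.

(** Negation and existence rest on [decide]. For existence, a Q-name of N is first replaced by the
    star of a Cohen name through [name_repr]. Conditions true along one listing can be united by
    [hold_cup]. *)
Lemma transfer phi e b : env e -> PInj b ->
  forces Q rev_incl N (cond_of b) (fun n => star (e n)) phi <->
  exists p, [/\ Fn p, hold p b & forcesM p e phi].
Proof.
elim: phi e b => [i j|i j|phi IH|phi IH psi IH'|phi IH] e b Me Pb /=.
- split; first exact: fmem_star_forced.
  by move=> [p [Fp hp h]]; exact: fmem_star_of hp h.
- split; first exact: feq_star_forced.
  by move=> [p [Fp hp h]]; exact: feq_star_of hp h.
- split=> [h|[p [Fp hp h]] q /Q_inv[b1 [Pb1 ->]] /(cond_of_le Pb Pb1) b1b /IH[]//].
    have [[p [Fp hp np]]|[b1 [p [Pb1 b1b Fp fp hp]]]] := decide (P :=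
      fun p => forcesM p e phi) (D_forcesM_const phi Me) Pb.
      by exists p; split=> // q /in_FnV Fq qp fq; exact: np q Fq fq qp.
    by case: (h (cond_of b1) (Q_cond_of Pb1)); [exact/cond_of_le|apply/IH => //; exists p].
  move=> p1 [Fp1 hp1 f1]; have [Fp2 hp2] := hold_cup Pb1 Fp Fp1 (hold_ext hp b1b) hp1.
  apply: (h (cupV p p1)); first exact/in_FnV.
    by move=> z z0; apply/in_cupV; left.
  by apply: forcesM_mono f1 _ => z z0; apply/in_cupV; right.
- split=> [[/IH-/(_ Me Pb)[p [Fp hp h]] /IH'-/(_ Me Pb)[p' [Fp' hp' h']]]|[p [Fp hp [h h']]]].
    have [Fq hq] := hold_cup Pb Fp Fp' hp hp'; exists (cupV p p'); split=> //; split.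
      by apply: forcesM_mono h _ => z z0; apply/in_cupV; left.
    by apply: forcesM_mono h' _ => z z0; apply/in_cupV; right.
  by split; [apply/IH|apply/IH'] => //; exists p.
- have DE := D_exM_forcesM phi Me.
  split=> [h|[p [Fp hp h]] q /Q_inv[b1 [Pb1 ->]] /(cond_of_le Pb Pb1) b1b].
    have [|[p [Fp hp np]]|[b1 [p [Pb1 b1b Fp np hp]]]] := @decide _ _ (fun r =>
      forall q, q ∈ FnV -> rev_incl q r -> ~ exists t, gM t /\ forcesM q (scons t e) phi) b _ Pb.
    + have DE' t : dterm t -> definable (fun e' => exists t0,
      gM t0 /\ forcesM (t e') (scons t0 e) phi).
        exact: (D_app1 (R := fun p => exists t0, gM t0 /\ forcesM p (scons t0 e) phi)).
      apply: D_allin; first exact: T_const M_FnV.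
      apply: D_imp; first by dfn.
      exact/D_not/DE'/T_var.
    + exists p; split=> // q /in_FnV Fq qp; apply: contrapT => H.
      apply: (np q Fq _ qp) => r Fr rq ft; apply: H; exists r; split=> //.
    + have [|r [/Q_inv[b2 [Pb2 ->]] /(cond_of_le Pb1 Pb2) b21 [t [Nt nt ft]]]] :=
      h (cond_of b1) (Q_cond_of Pb1).
        exact/cond_of_le.
      have [b3 [s [Pb3 b32 Ms E]]] := name_repr Nt nt Pb2.
      have f3 : forces Q rev_incl N (cond_of b3) (fun n => star (scons s e n)) phi.
        rewrite star_scons; apply: (forces_cong (e := scons t (fun n => star (e n)))).
          by move=> [|n] _ //=; exact: feq_refl.
        by apply: forces_mono ft _; exact/cond_of_le.
      have [p3 [Fp3 hp3 h3]] := (IH _ _ (env_scons Ms Me) Pb3).1 f3.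
      have [Fq hq] := hold_cup Pb3 Fp Fp3 (hold_ext (hold_ext hp b21) b32) hp3.
      case: (np (cupV p p3)); first exact/in_FnV.
        by move=> z z0; apply/in_cupV; left.
      exists s; split=> //.
      by apply: forcesM_mono h3 _ => z z0; apply/in_cupV; right.
  have [[p1 [Fp1 hp1 np1]]|[b2 [p1 [Pb2 b21 Fp1 [t [Mt ft]] hp1]]]] := decide (P :=
    fun p => exists t, gM t /\ forcesM p (scons t e) phi) DE Pb1.
    have [Fp2 hp2] := hold_cup Pb1 Fp Fp1 (hold_ext hp b1b) hp1.
    have [||r [/in_FnV Fr [rq ft]]] := h (cupV p p1); first exact/in_FnV.
      by move=> z z0; apply/in_cupV; left.
    case: (np1 r Fr ft); apply: incl_trans rq _ => z z0; apply/in_cupV; by right.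
  exists (cond_of b2); split; [exact: Q_cond_of|exact/cond_of_le|exists (star t)].
  split; [exact: N_star|exact: is_name_star|].
  by rewrite -star_scons; apply/IH => //; [exact: env_scons|exists p1].
Qed.

End Gen.

(** * Mixing *)

(* Two compatible squares are nested, so the minimal squares with a given
   property form an antichain, and no well-order of Fn is needed for mixing. *)
Definition square (p : V) : Prop := exists l : nat, forall i j : nat,
  (exists x v, opair x v ∈ p /\ x = opair (num i) (num j)) <->
  (num i ∈ num l /\ num j ∈ num l).

Definition square_of l p : Prop := forall i j, (exists v, bit i j v ∈ p) <-> i < l /\ j < l.

Lemma squareP p : Fn p -> square p <-> exists l, square_of l p.
Proof.
move=> [_ p1 _].
have E i j : (exists x v, opair x v ∈ p /\ x = opair (num i) (num j)) <->
    exists v, bit i j v ∈ p.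
  split=> [[x [v [xv Ex]]]|[v h]]; last by exists (opair (num i) (num j)), (num v).
  have [n [k [v' /pair_inj[_ Ev]]]] := p1 _ xv.
  by exists v'; rewrite /bit -Ex -Ev.
by split=> -[l h]; exists l => i j; have := h i j; rewrite E !num_lt.
Qed.

Lemma square_sub l l' p q : Fn q -> square_of l p -> square_of l' q -> rev_incl q p ->
  l' <= l -> rev_incl p q.
Proof.
move=> Fq sp sq pq ll; apply: Fn_incl => // i j v ijq.
have [il jl] : i < l' /\ j < l' by apply/sq; exists v.
have [v' ijp] : exists v, bit i j v ∈ p by apply/sp; split; exact: leq_trans ll.
by have [_ _ q2] := Fq; rewrite (q2 _ _ _ _ ijq (pq _ ijp)).
Qed.

(** A square of least side is minimal: a square inside it that has the property has at least the
    same side and hence equals it. *)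
Lemma square_min (P : V -> Prop) q : Fn q -> square q -> P q ->
  exists p, [/\ rev_incl q p, square p, P p &
    forall p', rev_incl p p' -> square p' -> P p' -> p' = p].
Proof.
move=> Fq /squareP-/(_ Fq)[l0 sq] Pq.
pose R l := `[< exists p, [/\ rev_incl q p, square_of l p & P p] >].
have exR : exists l, R l by exists l0; apply/asboolP; exists q.
case: (ex_minnP exR) => l /asboolP[p [pq sp Pp]] lmin.
have Fp := Fn_sub Fq pq.
exists p; split=> //; first by apply/squareP => //; exists l.
move=> p' p'p /squareP-/(_ (Fn_sub Fp p'p))[l' sp'] Pp'.
have ll : l <= l'.
  by apply: lmin; apply/asboolP; exists p'; split=> //; exact: incl_trans pq p'p.
apply: V_ext => z; split; first exact: p'p.
exact: square_sub sp' sp p'p ll z.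
Qed.

Lemma sub_PInj b b' : PInj b -> rev_incl b b' -> PInj b'.
Proof.
move=> [fb b1 b2 b3] h; split.
- exact: sub_finite_set h fb.
- by move=> z /h /b1.
- by move=> i j k /h ij /h ik; exact: b2 ij ik.
- by move=> i j k /h ik /h jk; exact: b3 ik jk.
Qed.

(** H_m is closed under inverses, so one inclusion for all of its elements gives the other. *)
Lemma act_fixed t m : is_name Fn t ->
  (forall f, cohen_H m f -> rev_incl t (act_name f t)) ->
  forall f, cohen_H m f -> act_name f t = t.
Proof.
move=> nt h f Hf; have [Gf fm] := Hf; have [f' [Gf' ff' f'f]] := cohen_inv Gf.
apply: V_ext => z; split; first exact: h.
move=> zt; have Hf' : cohen_H m f' by split=> // k km; rewrite -{1}(fm _ km) ff'.
have [p [s [E Fp ns]]] := is_name_pair nt zt; rewrite E in zt *.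
apply/in_act; exists (act_cond f' p), (act_name f' s).
rewrite (act_condK f'f ff' Fp) (actK f'f ff' ns); split=> //.
by apply: (h f' Hf'); apply/in_act; exists p, s.
Qed.

(** Trades quantifiers over functions for quantifiers over numbers, and equality of numbers for
    equality of numerals, to obtain definability. *)
Lemma perm_graphE w : perm_graph w <->
  (forall n, exists m, pr w n m /\ forall m', pr w n m' -> num m' = num m) /\
  (forall m, exists n, pr w n m /\ forall n', pr w n' m -> num n' = num n).
Proof.
split=> [[s [s' [ss' s's hw]]]|[h1 h2]].
  split=> [n|m]; [exists (s n)|exists (s' m)]; split; rewrite ?hw ?s's // => k /hw E.
    by rewrite E.
  by rewrite E ss'.
have [s hs] := choice h1; have [s' hs'] := choice h2; exists s, s'; split.
- move=> n; have [a _] := hs n; have [_ b] := hs' (s n); exact/esym/num_inj/b.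
- move=> m; have [a _] := hs' m; have [_ b] := hs (s' m); exact/esym/num_inj/b.
- by move=> i j; have [a b] := hs i; split=> [/b/num_inj//|->].
Qed.

Section Ctm.
Context {C : ctm}.

Lemma D_perm_graph t : dterm t -> definable (fun e => perm_graph (t e)).
Proof.
apply: D_app1; apply: (D_ext (P := fun e =>
  (forall n, exists m, pr (e 0) n m /\ forall m', pr (e 0) n m' -> num m' = num m) /\
  (forall m, exists n, pr (e 0) n m /\ forall n', pr (e 0) n' m -> num n' = num n))); last first.
  by move=> e _; rewrite perm_graphE.
apply: D_and.
  apply: (D_alln (P := fun n e => exists m, opair n (num m) ∈ e 0 /\
    forall m', opair n (num m') ∈ e 0 -> num m' = num m)).
  apply: (D_exn (P := fun m e => opair (e 0) m ∈ e 1 /\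
    forall m', opair (e 0) (num m') ∈ e 1 -> num m' = m)).
  apply: D_and; first by dfn.
  apply: (D_alln (P := fun m' e => opair (e 1) m' ∈ e 2 -> m' = e 0)); dfn.
apply: (D_alln (P := fun m e => exists n, opair (num n) m ∈ e 0 /\
  forall n', opair (num n') m ∈ e 0 -> num n' = num n)).
apply: (D_exn (P := fun n e => opair n (e 0) ∈ e 1 /\
  forall n', opair (num n') (e 0) ∈ e 1 -> num n' = n)).
apply: D_and; first by dfn.
apply: (D_alln (P := fun n' e => opair n' (e 1) ∈ e 2 -> n' = e 0)); dfn.
Qed.

Lemma D_square t : dterm t -> definable (fun e => square (t e)).
Proof.
apply: D_app1; rewrite /square.
apply: (D_exn (P := fun l e => forall i j : nat,
  (exists x v, opair x v ∈ e 0 /\ x = opair (num i) (num j)) <->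
  (num i ∈ l /\ num j ∈ l))).
apply: (D_alln (P := fun i e => forall j : nat,
  (exists x v, opair x v ∈ e 1 /\ x = opair i (num j)) <->
  (i ∈ e 0 /\ num j ∈ e 0))).
apply: (D_alln (P := fun j e =>
  (exists x v, opair x v ∈ e 2 /\ x = opair (e 0) j) <->
  (e 0 ∈ e 1 /\ j ∈ e 1))); dfn.
Qed.

Definition codom_is (m b : V) : Prop := forall j : nat,
  (exists x y, opair x y ∈ b /\ y = num j) <-> num j ∈ m.

Lemma D_codom_is t u : dterm t -> dterm u -> definable (fun e => codom_is (t e) (u e)).
Proof.
apply: D_app2; rewrite /codom_is.
apply: (D_alln (P := fun j e => (exists x y, opair x y ∈ e 1 /\ y = j) <-> j ∈ e 0)); dfn.
Qed.

Lemma codom_isP m b : PInj b -> codom_is (num m) b <-> forall j, (exists i, pr b i j) <-> j < m.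
Proof.
move=> [_ b1 _ _].
have E j : (exists x y, opair x y ∈ b /\ y = num j) <-> exists i, pr b i j.
  split=> [[x [y [xy Ey]]]|[i ij]]; last by exists (num i), (num j).
  have [i [j' /pair_inj[Ex _]]] := b1 _ xy; exists i; by rewrite -Ex -Ey.
by split=> h j; have := h j; rewrite E num_lt.
Qed.

End Ctm.
#[export] Hint Resolve D_perm_graph D_square D_codom_is : dfn.

Section Main.
Context {C : ctm} {g : gen}.

Notation val := (name_val gG).
Notation xr := (cohen_real gG).
Notation N := (cohen_model gM gG).
Notation Q := (N `&` Inj omega (cohen_X gG)).
Notation feqQ := (forces_eq Q rev_incl).
Notation frc := (forces Q rev_incl N).

(** The square is filled with the actual bits of the listed reals, with which a true p agrees. *)
Lemma square_ext p b : Fn p -> PInj b -> hold p b -> exists b' p',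
  [/\ PInj b', rev_incl b' b, Fn p', rev_incl p' p & square p' /\ hold p' b'].
Proof.
move=> Fp Pb hp; have [L hL] := Fn_bound Fp.
have [b' [Pb' b'b cov _]] := ext_dom L 0 Pb; have [_ _ b2 _] := Pb'.
have [jf hjf] : {jf : nat -> nat & forall i, i < L -> pr b' i (jf i)}.
  apply: (@choice _ _ (fun i j => i < L -> pr b' i j)) => i.
  have [im|im] := boolP (i < L); last by exists 0.
  by have [j hj] := cov _ im; exists j.
pose (vf i j := `[< num j ∈ xr (jf i) >]).
have tvf i j : true_bit (jf i) j (vf i j) by split=> /asboolP.
pose (p' := vset (fun u : {u : nat * nat | u.1 < L /\ u.2 < L} =>
  bit (sval u).1 (sval u).2 (vf (sval u).1 (sval u).2))).
have hp' i j v : bit i j v ∈ p' <-> [/\ i < L, j < L & v = vf i j].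
  rewrite in_vset; split=> [[[[i' j'] /= [iL jL]] /bit_inj[<- <- <-]]//|[iL jL ->]].
  by exists (exist _ (i, j) (conj iL jL)).
have Fp' : Fn p'.
  split.
  - apply: (@sub_finite_set _ _ ((fun u : nat * nat => bit u.1 u.2 (vf u.1 u.2)) @`
      (`I_L `*` `I_L))).
      by move=> z /in_vset[[u [u1 u2]] /= <-]; exists u.
    by apply: finite_image; apply: finite_setX; exact: finite_II.
  - by move=> z /in_vset[[u h] /= <-]; exists u.1, u.2, (vf u.1 u.2).
  - by move=> n k v v' /hp'[_ _ ->] /hp'[_ _ ->].
exists b', p'; split=> //.
  apply: Fn_incl => // n k v np; have [nL kL] := hL _ _ _ np; apply/hp'; split=> //.
  have [n' [nn' t]] := hold_ext hp b'b np.
  by rewrite (b2 _ _ _ nn' (hjf _ nL)) in t; exact: true_bit_uniq t (tvf _ _).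
split.
  apply/squareP => //; exists L => i j; split=> [[v /hp'[]]//|[iL jL]].
  by exists (vf i j); apply/hp'.
by move=> n k v /hp'[nL _ ->]; exists (jf n); split=> //; exact: hjf.
Qed.

Section Mix.
Variables (theta : form) (m : nat) (x e : nat -> V).
Hypothesis Mx : forall n, gM (x n).
Hypothesis nx : forall n, is_name Fn (x n).
Hypothesis hx : forall n, hereditarily_symmetric (x n).
Hypothesis sx : forall n f, cohen_H m f -> act_name f (x n) = x n.
Hypothesis ex : forall n, n < free_bound theta -> e n = val (x n).
Hypothesis ne : forall n, is_name Q (e n).

(* [cond_of b] fixes the positions of the first m reals, which determines a
   permutation w matching the generic enumeration of X with the original one up
   to m; the parameters e n then become the Cohen names [tr w (x n)]. *)
Definition witness (b p s : V) : Prop := exists w, gM w /\ (perm_graph w /\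
  (rev_incl w b /\ forcesM p (scons s (fun n => tr w (x n))) theta)).

(** Since the range of b is exactly m, distinct placements are incompatible; minimality of the
    square does the same for conditions. *)
Definition good (b p : V) : Prop := codom_is (num m) b /\ (square p /\
  ((exists s, gM s /\ witness b p s) /\
   forall p', p' ∈ FnV -> rev_incl p p' -> square p' -> (exists s, gM s /\ witness b p' s) ->
     p' = p)).

Lemma D_witness t u v : dterm t -> dterm u -> dterm v -> definable (fun e => witness (t e) (u
  e) (v e)).
Proof.
apply: D_app3; rewrite /witness; apply: D_exM.
do 2!(apply: D_and; first by dfn).
apply: (D_ext (D_forcesM theta (t := fun e => e 2)
  (u := fun n e => if n is k.+1 then tr (e 0) (x k) else e 3) _ _)).
- exact: T_var.
- by case=> [|n]; [exact: T_var|by have := Mx n; dfn].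
- move=> e' _.
  have -> // : (fun n => match n with 0 => e' 3 | k.+1 => tr (e' 0) (x k) end) =
    scons (e' 3) (fun n => tr (e' 0) (x n)).
  by apply/funext => -[].
Qed.
#[local] Hint Resolve D_witness : dfn.

Lemma D_good t u : dterm t -> dterm u -> definable (fun e => good (t e) (u e)).
Proof. by apply: D_app2; rewrite /good; dfn. Qed.
#[local] Hint Resolve D_good : dfn.

Lemma chosen_ex : exists f, [/\ gM f,
  forall w, w ∈ f -> exists b p s, [/\ w = opair (opair b p) s, PInj b, Fn p,
    good b p & witness b p s],
  forall a s s', opair a s ∈ f -> opair a s' ∈ f -> s = s' &
  forall b p, PInj b -> Fn p -> good b p -> exists s, opair (opair b p) s ∈ f].
Proof.
have [||f [Mf f1 f2 f3]] := M_choice (A := prodV PInjV FnV) (R := fun a s =>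
  good (fst_V a) (snd_V a) /\ witness (fst_V a) (snd_V a) s).
- by dfn.
- by dfn.
exists f; split=> //.
  move=> w /f1[_ [s [-> /in_prodV[b [p [/in_PInjV Pb /in_FnV Fp ->]]]]]].
  by rewrite fst_pair snd_pair => -[? ?]; exists b, p, s.
move=> b p Pb Fp gbp; apply: f3.
  by apply/pair_in_prodV; split; [exact/in_PInjV|exact/in_FnV].
have [_ [_ [[s [Ms ws]] _]]] := gbp.
by exists s; rewrite fst_pair snd_pair.
Qed.

Definition chosen : V := sval (cid chosen_ex).

Lemma chosenP : [/\ gM chosen,
  forall w, w ∈ chosen -> exists b p s, [/\ w = opair (opair b p) s, PInj b, Fn p,
    good b p & witness b p s],
  forall a s s', opair a s ∈ chosen -> opair a s' ∈ chosen -> s = s' &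
  forall b p, PInj b -> Fn p -> good b p -> exists s, opair (opair b p) s ∈ chosen].
Proof. by rewrite /chosen; case: cid => f h /=. Qed.

Lemma chosen_in b p s : opair (opair b p) s ∈ chosen ->
  [/\ PInj b, Fn p, good b p, witness b p s & gM s].
Proof.
have [Mch h _ _] := chosenP; move=> bps; have [b' [p' [s' [E Pb Fp gbp w]]]] := h _ bps.
have [/pair_inj[-> ->] ->] := pair_inj E; split=> //.
by rewrite E in bps; exact: M_snd bps Mch.
Qed.

(** The injection b contains only one placement with range exactly m. Squares true of the same reals
    are nested, and minimality makes them equal. *)
Lemma good_uniq b b1 b2 p1 p2 : PInj b -> PInj b1 -> PInj b2 -> Fn p1 -> Fn p2 ->
  rev_incl b b1 -> rev_incl b b2 -> hold p1 b -> hold p2 b -> good b1 p1 -> good b2 p2 ->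
  b1 = b2 /\ p1 = p2.
Proof.
move=> Pb Pb1 Pb2 Fp1 Fp2 bb1 bb2 h1 h2 [/(codom_isP _ Pb1) c1 [s1 [w1 m1]]].
move=> [/(codom_isP _ Pb2) c2 [s2 [w2 m2]]].
have [_ _ q2 q3] := Pb.
have Eb : b1 = b2.
  apply: PInj_ext => // i j; split=> ij.
    have [|i' ij'] := (c2 j).2; first by apply/c1; exists i.
    by rewrite (q3 _ _ _ (bb1 _ ij) (bb2 _ ij')).
  have [|i' ij'] := (c1 j).2; first by apply/c2; exists i.
  by rewrite (q3 _ _ _ (bb2 _ ij) (bb1 _ ij')).
split=> //; rewrite -{}Eb in w2 m2.
have sub p q l l' : Fn p -> square_of l p -> square_of l' q -> hold p b -> hold q b -> l <= l' ->
    rev_incl q p.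
  move=> Fp sp sq hp hq ll; apply: Fn_incl => // n k v np.
  have [nl kl] : n < l /\ k < l by apply/sp; exists v.
  have [v' nq] : exists v, bit n k v ∈ q by apply/sq; split; exact: leq_trans ll.
  have [n1 [nn1 t1]] := hp _ _ _ np; have [n2 [nn2 t2]] := hq _ _ _ nq.
  by rewrite (q2 _ _ _ nn2 nn1) in t2; rewrite (true_bit_uniq t1 t2).
have [l1 sl1] := (squareP Fp1).1 s1; have [l2 sl2] := (squareP Fp2).1 s2.
case: (leqP l1 l2) => [ll|/ltnW ll].
  by apply: m2 => //; [exact/in_FnV|exact: sub sl1 sl2 h1 h2 ll].
by apply/esym; apply: m1 => //; [exact/in_FnV|exact: sub sl2 sl1 h2 h1 ll].
Qed.

(** Designed so that [star y] enters the mixture at [cond_of b] exactly when b contains a placement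
    b0, and makes true a square p and a condition q, such that (q, y) belongs to the name chosen for
    (b0, p). *)
Definition mixK (p' b y : V) : Prop := exists a s, opair a s ∈ chosen /\
  exists b0 p, a = opair b0 p /\ (rev_incl b b0 /\ (pushes b p p' /\
    exists q y', opair q y' ∈ s /\ (y' = y /\ (q ∈ FnV /\ pushes b q p')))).

(** Two unions lead from [chosen] to a chosen name s and three more to the subnames of s, hence
    five. *)
Definition mixname : V :=
  imgV (prodV (prodV FnV PInjV) (iter 5 unionV chosen))
    (fun u => mixK (fst_V (fst_V u)) (snd_V (fst_V u)) (snd_V u))
    (fun u => opair (fst_V (fst_V u)) (opn (rdot (snd_V (fst_V u))) (sname (snd_V u)))).

Lemma in_mixname z : z ∈ mixname <-> exists p' b y,
  [/\ Fn p', PInj b, mixK p' b y & z = opair p' (opn (rdot b) (sname y))].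
Proof.
rewrite in_imgV; split.
  move=> [_ [/in_prodV[_ [y [/in_prodV[p' [b [/in_FnV Fp' /in_PInjV Pb ->]]] _ ->]]]]].
  by rewrite !(fst_pair, snd_pair) => k ->; exists p', b, y.
move=> [p' [b [y [Fp' Pb k ->]]]]; exists (opair (opair p' b) y); rewrite !(fst_pair, snd_pair).
split=> //; apply/pair_in_prodV; split.
  by apply/pair_in_prodV; split; [exact/in_FnV|exact/in_PInjV].
have U a c t : opair a c ∈ t -> c ∈ unionV (unionV t).
  move=> h; apply/in_unionV; exists (upair a c); split; last by apply/in_upair; right.
  by apply/in_unionV; exists (opair a c); split=> //; apply/in_upair; right.
have [a [s [as_ [b0 [p [_ [_ [_ [q [y' [qy [<- _]]]]]]]]]]]] := k.
apply/in_unionV; exists (upair q y'); split; last by apply/in_upair; right.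
apply/in_unionV; exists (opair q y'); split; last by apply/in_upair; right.
by apply/in_unionV; exists s; split=> //; exact: U as_.
Qed.

Lemma M_mixname : gM mixname.
Proof.
have [Mch _ _ _] := chosenP; rewrite /mixname /mixK /=.
by apply: M_img; dfn.
Qed.

Lemma is_name_mixname : is_name Fn mixname.
Proof.
constructor=> z /in_mixname[p' [b [y [Fp' Pb _ ->]]]].
exists p', (opn (rdot b) (sname y)); split=> //.
by apply: is_name_opn; [exact: is_name_rdot|exact: is_name_sname].
Qed.

(** A permutation in H_m moves b and p' but not the placement b0, whose values are below m. The
    subnames y occur only through [sname], which every permutation fixes. *)
Lemma hs_mixname : hereditarily_symmetric mixname.
Proof.
constructor; last first.
  move=> p s /in_mixname[p' [b [y [_ Pb _ /pair_inj[_ ->]]]]].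
  by apply: hs_opn; [exact: hs_rdot|exact: hs_sname].
exists m; apply: act_fixed; first exact: is_name_mixname.
move=> f [Gf fm] z /in_act[q [t [/in_mixname[p' [b [y [Fp' Pb k /pair_inj[-> ->]]]]] ->]]].
have [f' [Gf' ff' f'f]] := cohen_inv Gf.
have [b' [Pb' hb' Eb']] := PInj_act ff' f'f Pb.
apply/in_mixname; exists (act_cond f p'), b', y; split=> //; first exact: (Fn_act ff' Fp').
  have [a [s [as_ [b0 [p [Ea [bb0 [m1 [q0 [y' [qy [Ey [Fq m2]]]]]]]]]]]]] := k.
  exists a, s; split=> //; exists b0, p; split=> //; split.
    rewrite Ea in as_; have [Pb0 _ [/(codom_isP _ Pb0) c _] _ _] := chosen_in as_.
    apply: PInj_incl => // i j ij; apply/hb'.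
    have jm : j < m by apply/c; exists i.
    by move: (fm _ jm) => E; rewrite -{1}E ff'; exact: bb0.
  split; first exact: (pushes_act ff' f'f hb' m1).
  exists q0, y'; split=> //; split=> //; split=> //; exact: (pushes_act ff' f'f hb' m2).
by rewrite act_opn Eb' (act_sname _ ff' f'f).
Qed.

Definition mixture : V := val mixname.

Lemma N_mixture : N mixture.
Proof.
exists mixname; split; [exact: M_mixname|exact: is_name_mixname|exact: hs_mixname|exact: erefl].
Qed.

Lemma in_mixture z : z ∈ mixture <-> exists b y b0 p s q,
  [/\ PInj b, opair (opair b0 p) s ∈ chosen, rev_incl b b0, opair q y ∈ s &
   [/\ Fn q, hold p b, hold q b & z = opair (cond_of b) (star y)]].
Proof.
rewrite in_val; split.
  move=> [p1 [t [/in_mixname[p' [b [y [Fp' Pb k /pair_inj[-> ->]]]]] Gp' ->]]].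
  have [a [s [as_ [b0 [p [Ea [bb0 [m1 [q0 [y' [qy [Ey [/in_FnV Fq m2]]]]]]]]]]]]] := k.
  rewrite Ea in as_; have [Pb0 Fp _ _ _] := chosen_in as_; rewrite Ey in qy.
  exists b, y, b0, p, s, q0; split=> //; split=> //.
  - by apply/hold_pushes => //; exists p'.
  - by apply/hold_pushes => //; exists p'.
  - by rewrite val_opn.
move=> [b [y [b0 [p [s [q [Pb as_ bb0 qy [Fq hp hq ->]]]]]]]].
have [_ Fp _ _ _] := chosen_in as_.
have [Fpq hpq] := hold_cup Pb Fp Fq hp hq.
have [p' [Gp' m12]] := (hold_pushes Fpq Pb).1 hpq.
exists p', (opn (rdot b) (sname y)); rewrite val_opn; split=> //.
apply/in_mixname; exists p', b, y; split=> //; first exact: G_Fn.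
exists (opair b0 p), s; split=> //; exists b0, p; split=> //; split=> //; split.
  by move=> n k v np; apply: m12; apply/in_cupV; left.
exists q, y; split=> //; split=> //; split; first exact/in_FnV.
by move=> n k v np; apply: m12; apply/in_cupV; right.
Qed.

Lemma is_name_mixture : is_name Q mixture.
Proof.
constructor=> z /in_mixture[b [y [b0 [p [s [q [Pb _ _ _ [_ _ _ ->]]]]]]]].
by exists (cond_of b), (star y); split=> //; [exact: Q_cond_of|exact: is_name_star].
Qed.

(** By [good_uniq] no pair other than (b0, p) contributes along extensions of b. *)
Lemma mixture_eq b b0 p s : PInj b -> opair (opair b0 p) s ∈ chosen -> rev_incl b b0 -> hold p
  b ->
  feqQ (cond_of b) mixture (star s).
Proof.
move=> Pb bps bb0 hp; have [Pb0 Fp gbp _ Ms] := chosen_in bps; have [_ _ chf _] := chosenP.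
apply/feq_forced_sub; split=> r r1 t /Q_inv[b1 [Pb1 ->]] /(cond_of_le Pb Pb1) b1b.
  move=> /in_mixture[b2 [y [b0' [p2 [s2 [q [Pb2 bps2 b2b0 qy [Fq hp2 hq /pair_inj[-> ->]]]]]]]]].
  move=> /(cond_of_le Pb2 Pb1) b12; have [Pb0' Fp2 gbp2 _ _] := chosen_in bps2.
  have [Eb Ep] := good_uniq Pb1 Pb0' Pb0 Fp2 Fp (incl_trans b12 b2b0) (incl_trans b1b bb0)
    (hold_ext hp2 b12) (hold_ext hp b1b) gbp2 gbp.
  rewrite Eb Ep in bps2; rewrite (chf _ _ _ bps2 bps) in qy.
  exists (cond_of b1), (cond_of b2), (star y); split=> //;
    [exact: Q_cond_of| |exact/cond_of_le|exact: feq_refl].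
  by apply/in_star_pair; exists q, y, b2.
move=> /in_star_pair[q [y [b2 [qy Fq Pb2 hq [-> ->]]]]] /(cond_of_le Pb2 Pb1) b12.
exists (cond_of b1), (cond_of b1), (star y); split=> //; [exact: Q_cond_of| |exact: feq_refl].
apply/in_mixture; exists b1, y, b0, p, s, q; split=> //; first exact: incl_trans b1b bb0.
by split=> //; [exact: hold_ext hp b1b|exact: hold_ext hq b12].
Qed.

(** [tr_correct] with trivial permutations. Any w that extends the placement b0 serves, because the
    parameters have support m. *)
Lemma param_eq b b0 w n : PInj b -> PInj b0 -> codom_is (num m) b0 -> rev_incl b b0 ->
  rev_incl w b0 -> perm_graph w -> n < free_bound theta ->
  feqQ (cond_of b) (e n) (star (tr w (x n))).
Proof.
move=> Pb Pb0 /(codom_isP _ Pb0) c bb0 wb0 Pw nk; rewrite (ex nk).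
rewrite -{1}(act_id (nx n)) -{2}(act_id (nx n)).
apply: (tr_correct (nx n) (hx n) (Mx n) (sx n)) => //; try exact: cohen_group_id.
  move=> i im; have [j ji] := (c i).2 im; exists j; split; [exact: wb0|exact: bb0].
by rewrite act_id // -ex //; exact: ne.
Qed.

Lemma M_tr w y : gM w -> gM y -> gM (tr w y).
Proof.
move=> pulls My; have [h _] := T_tr (T_const pulls) (T_const My).
by apply: (h (fun=> num 0)) => n; exact: M_num.
Qed.

Lemma forces_mixture b : PInj b -> frc (cond_of b) e (fEx theta) -> frc (cond_of b) (scons
  mixture e) theta.
Proof.
move=> Pb h; apply: forces_dens => _ /Q_inv[b1 [Pb1 ->]] /(cond_of_le Pb Pb1) b1b.
have [b2 [Pb2 b21 cov]] := ext_ran m Pb1; have [_ _ q2 q3] := Pb2.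
(* The placement of the first m reals in b2. *)
pose (b0 := sepV b2 (fun z => exists i j, z = opair (num i) (num j) /\ j < m)).
have b20 : rev_incl b2 b0 by move=> z /in_sepV[].
have Pb0 := sub_PInj Pb2 b20.
have hb0 i j : pr b0 i j <-> pr b2 i j /\ j < m.
  rewrite in_sepV; split=> [[ij [i' [j' [/pair_inj[_ /num_inj Ej] jm]]]]|[ij jm]].
    by rewrite Ej in ij *.
  by split=> //; exists i, j.
have cb0 : codom_is (num m) b0.
  apply/codom_isP => // j; split=> [[i /hb0[]]//|jm].
  by have [i ij] := cov _ jm; exists i; apply/hb0.
have [|r [/Q_inv[b3 [Pb3 ->]] /(cond_of_le Pb2 Pb3) b32 [t [Nt nt ft]]]] :=
  h (cond_of b2) (Q_cond_of Pb2).
  by apply/cond_of_le => //; exact: incl_trans b21 b1b.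
have [b4 [s [Pb4 b43 Ms Ets]]] := name_repr Nt nt Pb3.
have [jf hjf] : {jf : nat -> nat & forall i, i < m -> pr b2 (jf i) i}.
  apply: (@choice _ _ (fun i j => i < m -> pr b2 j i)) => i.
  have [im|im] := boolP (i < m); last by exists 0.
  by have [j hj] := cov _ im; exists j.
have [f [Gf hf]] : exists f, cohen_group f /\ forall i, i < m -> f i = jf i.
  apply: group_ext => i j im jm E; apply: q2 (hjf _ im) _.
  by rewrite E; exact: hjf.
have [f' [Gf' ff' f'f]] := cohen_inv Gf.
(* The inverse of f takes the position of x_i back to i for i < m, so w extends b0. *)
pose (w := graph f').
have Pw : perm_graph w by exact: perm_graph_group.
have wb0 : rev_incl w b0.
  apply: PInj_incl => // i j /hb0[ij jm]; apply/pr_graph.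
  by rewrite (q3 _ _ _ ij (hjf _ jm)) -hf // ff'.
have Mw' : gM w by exact: M_graph.
have envw w' s' : gM w' -> gM s' -> env (scons s' (fun n => tr w' (x n))).
  by move=> Mw1 Ms'; apply: env_scons => // n; exact: M_tr.
have b42 : rev_incl b4 b2 by exact: incl_trans b43 b32.
have [p1 [Fp1 hp1 f1]] : exists p, [/\ Fn p, hold p b4 &
    forcesM p (scons s (fun n => tr w (x n))) theta].
  apply/(transfer _ (envw _ _ Mw' Ms) Pb4); rewrite star_scons.
  apply: (forces_cong (e := scons t e)); last by apply: forces_mono ft _; exact/cond_of_le.
  move=> [|n] nk //=; apply: (param_eq Pb4 Pb0) => //; last exact: ltnW.
  exact: incl_trans b42 b20.
(* Enlarging p1 to a true square provides a square with a witness, inside which a minimal one is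
   found; the latter is still true. *)
have [b5 [p2 [Pb5 b54 Fp2 p21 [sq2 hp2]]]] := square_ext Fp1 Pb4 hp1.
have [|p3 [p23 sq3 ex3 min3]] :=
  @square_min (fun p => exists s, gM s /\ witness b0 p s) p2 Fp2 sq2.
  exists s; split=> //; exists w; split=> //; split=> //; split=> //.
  exact: forcesM_mono f1 p21.
have Fp3 := Fn_sub Fp2 p23; have hp3 := hold_sub hp2 p23.
have g3 : good b0 p3.
  by split=> //; split=> //; split=> // p' _; exact: min3.
have [_ _ _ ch4] := chosenP; have [s' bps] := ch4 _ _ Pb0 Fp3 g3.
(* The name s' chosen for this pair may differ from s and come with another permutation w';
   [param_eq] identifies the parameters for w' as well. *)
have [_ _ _ [w' [Mw1 [Pw' [wb0' f3]]]] Ms'] := chosen_in bps.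
have b52 : rev_incl b5 b2 by exact: incl_trans b54 b42.
have b50 : rev_incl b5 b0 by exact: incl_trans b52 b20.
exists (cond_of b5); split; [exact: Q_cond_of|apply/cond_of_le => //; exact: incl_trans b52 b21|].
have f5 : frc (cond_of b5) (fun n => star (scons s' (fun n => tr w' (x n)) n)) theta.
  by apply/transfer => //; [exact: envw|exists p3].
rewrite star_scons in f5; apply: forces_cong f5 => -[|n] nk /=; apply: feq_sym.
  exact: (mixture_eq Pb5 bps b50 hp3).
by apply: (param_eq Pb5 Pb0) => //; exact: ltnW.
Qed.

End Mix.

(** * The maximum principle *)

Lemma maximum_principle_cohen : maximum_principle Q rev_incl N.
Proof.
move=> p theta e Qp he; split=> [h|[t [Nt nt ft]] q Qq qp]; last first.
  by exists q; split=> //; exists t; split=> //; exact: forces_mono ft qp.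
have n0 : is_name Fn (num 0) by constructor=> z /in_num0.
have act0 f : act_name f (num 0) = num 0.
  by apply: V_ext => z; rewrite in_act; split=> [[q [s [/in_num0]]]|/in_num0].
have h0 : hereditarily_symmetric (num 0).
  by constructor=> [|q s /in_num0//]; exists 0 => f _.
have [y hy] : {y : nat -> V & forall n, [/\ gM (y n), is_name Fn (y n),
    hereditarily_symmetric (y n) & e n = val (y n)]}.
  apply: (@choice _ _ (fun n z => [/\ gM z, is_name Fn z,
    hereditarily_symmetric z & e n = val z])) => n.
  by have [[z hz] _] := he n; exists z.
have [mf hmf] : {mf : nat -> nat & forall n f, cohen_H (mf n) f -> act_name f (y n) = y n}.
  apply: (@choice _ _ (fun n k => forall f, cohen_H k f -> act_name f (y n) = y n)) => n.
  by have [_ _ [z [k hk] _] _] := hy n; exists k.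
have [B hB] := bounded_image mf (free_bound theta).
(* Beyond the free variables the parameters are replaced by the empty name, so that B is a common
   support of all of them. *)
pose (x n := if n < free_bound theta then y n else num 0).
have hx n : [/\ gM (x n), is_name Fn (x n) & hereditarily_symmetric (x n)].
  by rewrite /x; case: ifP => _; [have [] := hy n|split=> //; exact: M_num].
have sx n f : cohen_H B f -> act_name f (x n) = x n.
  move=> [Gf fB]; rewrite /x; case: ifP => // nk; apply: hmf; split=> // k kn.
  by apply: fB; apply: leq_trans kn _; exact/ltnW/hB.
have ex n : n < free_bound theta -> e n = val (x n).
  by rewrite /x => ->; have [] := hy n.
have Mx n : gM (x n) by have [] := hx n.
have nx n : is_name Fn (x n) by have [] := hx n.
have hsx n : hereditarily_symmetric (x n) by have [] := hx n.
have nen n : is_name Q (e n) by have [] := he n.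
have [bp [Pbp E]] := Q_inv Qp; rewrite {}E in Qp h *.
exists (mixture theta B Mx); split; [exact: N_mixture|exact: is_name_mixture|].
exact: forces_mixture.
Qed.

End Main.

(* Inj(ω, X) is taken inside the model; finiteness is absolute. *)
Theorem theorem12 (M G : set V) (hM : ctm_ZFC M) (hG : generic M Fn rev_incl G) :
  let N := cohen_model M G in
  maximum_principle (N `&` Inj omega (cohen_X G)) rev_incl N.
Proof. exact: (@maximum_principle_cohen (Ctm hM) (@Gen (Ctm hM) G hG)). Qed.
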